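(* Let $d\ge3$, $T>0$ and $0<\varepsilon<2$. There exists $(u,f)\in\mathcal N(Q_T)$ such that: (a) $(u,f)$ satisfies the energy equality on $[0,T)$: $$\tfrac12\|u(t_1)\|_2^2-\tfrac12\|u(t_0)\|_2^2+\int_{t_0}^{t_1}\|\nabla u(t)\|_2^2\,dt=\int_{t_0}^{t_1}\langle u,f\rangle\,dt\quad\text{for all }t_0,t_1\in[0,T);$$ (b) the anomalous work vanishes: $$\lim_{q\to\infty}\int_{T/2}^T\big(\langle u_{\le q},f_{\le q}\rangle-\langle u,f\rangle\big)\,dt=0;$$ (c) the energy is jump discontinuous at $t=T$: $$\lim_{t\to T^-}\|u(t)\|_2^2>\|u(T)\|_2^2;$$ (d) $u\in L^3(0,T;B^{\frac13-\varepsilon}_{3,\infty}(\mathbb T^d))$, $u\in L^p(0,T;L^q(\mathbb T^d))$ for any $p,q\in[1,\infty]$ with $\frac2p+\frac2q=1+\varepsilon$, and $f\in L^{2-\varepsilon}(0,T;H^{-1}(\mathbb T^d))$.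
   Context: $\mathbb T^d$ is the $d$-dimensional ($2\pi$-periodic) torus, $Q_T=\mathbb T^d\times(0,T)$, $\langle\cdot,\cdot\rangle$ is the $L^2(\mathbb T^d)$ inner product, $\|\cdot\|_p$ is the $L^p(\mathbb T^d)$ norm. The forced Navier-Stokes equations (NSE) are $\partial_t u-\Delta u+\operatorname{div}(u\otimes u)+\nabla p=f$, $\operatorname{div}u=0$, with velocity $u$, pressure $p$, force $f$. $\mathcal L(0,T)$ is the set of $g\in L^1_{loc}(0,T)$ such that $\lim_{a\to0^+,\,b\to T^-}\int_a^b g\,dt$ exists (as a finite limit); integrals of such $g$ up to the endpoints are understood as these limits. Class $\mathcal N(Q_T)$ (smooth solutions with finite energy input): pairs $(u,f)$ such that (i) $u\in C^\infty(Q_T)\cap L^\infty(0,T;L^2(\mathbb T^d))$ and $f\in C^\infty(Q_T)$; (ii) $u,f$ satisfy the NSE (with some pressure $p$) at every point of $Q_T$; (iii) $\langle u,f\rangle\in\mathcal L(0,T)$; (iv) the limits of $f(t)$ exist in $\mathcal D'(\mathbb T^d)$ as $t\to0^+$ and $t\to T^-$. For $(u,f)\in\mathcal N(Q_T)$ the weak $L^2$ limits of $u(t)$ as $t\to0^+$ and $t\to T^-$ exist, and $u(0)$, $u(T)$ always denote these weak limits. Littlewood-Paley decomposition: fix a radially non-increasing $\chi\in C_c^\infty(\mathbb R^d)$ with $\chi(\xi)=1$ for $|\xi|\le 1/2$ and $\chi(\xi)=0$ for $|\xi|\ge1$, and put $\varphi(\xi)=\chi(\xi/2)-\chi(\xi)$.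 $\Delta_q$ is the Fourier multiplier with symbol $\varphi(2^{-q}\xi)$ for $q\ge0$ and $\chi(\xi)$ for $q=-1$; $u_{\le q}=\sum_{-1\le r\le q}\Delta_r u$, i.e. the multiplier with symbol $\chi(2^{-(q+1)}\xi)$ applied to $u$. The Besov norm is $\|u\|_{B^s_{3,\infty}}=\sup_{q\ge-1}2^{qs}\|\Delta_q u\|_3$. *)

(* Defs.v *)
From HB Require Import structures.
From mathcomp Require Import all_boot all_order all_algebra.
From mathcomp Require Import all_classical all_reals all_analysis.
From mathcomp Require Import measurable_realfun complex.

Set Implicit Arguments.
Unset Strict Implicit.
Unset Printing Implicit Defensive.

Import Order.TTheory GRing.Theory Num.Theory.
Import numFieldNormedType.Exports.

Local Open Scope classical_set_scope.
Local Open Scope ring_scope.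

(* A function on the torus is a function on 'rV[R]_d that is 2 pi-periodic in
   every coordinate; integrals over the torus are integrals over the period
   cube [0, 2 pi]^d.  The Lebesgue measure of the cube lives on
   d.-tuple (measurableTypeR R), with the product sigma-algebra. *)

Section period_cube.
Context {R : realType}.
Local Notation mR := (measurableTypeR R).

Lemma period_finite :
  ((@lebesgue_measure R) `[0%R, (2 * pi)%R]%classic < +oo)%E.
Proof. by rewrite lebesgue_measure_itv/=; case: ifP => _; rewrite ltry. Qed.

Definition period_measure : {finite_measure set mR -> \bar R} :=
  @mfrestr _ mR R _ _ (measurable_itv `[0%R, (2 * pi)%R]) period_finite.

Definition tuple_cons n (z : mR * n.-tuple mR) : n.+1.-tuple mR :=
  [the n.+1.-tuple mR of z.1 :: z.2].

Lemma measurable_tuple_cons n : measurable_fun [set: mR * n.-tuple mR]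
  (@tuple_cons n).
Proof.
exact: (measurable_cons (measurable_fst) (measurable_snd)).
Qed.

Section step.
Variables (n : nat) (m : {finite_measure set (n.-tuple mR) -> \bar R}).

Definition cube_step : set (n.+1.-tuple mR) -> \bar R :=
  pushforward (period_measure \x m)%E (@tuple_cons n).

Let cube_step0 : cube_step set0 = 0%E.
Proof. by rewrite /cube_step /pushforward preimage_set0 measure0. Qed.

Let cube_step_ge0 A : (0 <= cube_step A)%E.
Proof. by rewrite /cube_step /pushforward measure_ge0. Qed.

Let cube_step_sigma_additive : semi_sigma_additive cube_step.
Proof.
move=> F mF tF mUF; rewrite /cube_step /pushforward preimage_bigcup.
apply: measure_semi_sigma_additive.
- by move=> k; rewrite -[X in measurable X]setTI; exact: measurable_tuple_cons.
- apply/trivIsetP => /= i j _ _ ij; rewrite -preimage_setI.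
  by move/trivIsetP : tF => /(_ _ _ _ _ ij) ->//; rewrite preimage_set0.
- rewrite -preimage_bigcup -[X in measurable X]setTI.
  exact: measurable_tuple_cons.
Qed.

HB.instance Definition _ := isMeasure.Build _ _ _ cube_step
  cube_step0 cube_step_ge0 cube_step_sigma_additive.

Lemma cube_step_finite : fin_num_fun cube_step.
Proof.
move=> A mA; rewrite ge0_fin_numE// /cube_step /pushforward.
apply: (@le_lt_trans _ _ ((period_measure \x m)%E setT)).
  apply: le_measure; rewrite ?inE//.
  by rewrite -[X in measurable X]setTI; exact: measurable_tuple_cons.
rewrite -setXTT product_measure1E//.
by rewrite lte_mul_pinfty// ?fin_num_measure// -ge0_fin_numE// fin_num_measure.
Qed.

HB.instance Definition _ := @Measure_isFinite.Build _ _ _ cube_step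
  cube_step_finite.

End step.

Fixpoint cube_measure (n : nat) : {finite_measure set (n.-tuple mR) -> \bar R} :=
  match n with
  | 0 => \d_([tuple] : 0.-tuple mR)
  | n'.+1 => cube_step (cube_measure n')
  end.

End period_cube.

Section torus.
Context {R : realType} {d : nat}.
Local Notation E := 'rV[R]_d.
Local Notation leb := (@lebesgue_measure R).

Definition pt (x : d.-tuple (measurableTypeR R)) : E := \row_i tnth x i.

Definition dot (x y : E) : R := \sum_i x 0 i * y 0 i.
(* The norm `|x| of 'rV[R]_d is the sup norm, hence this definition. *)
Definition enorm (x : E) : R := Num.sqrt (dot x x).

Definition unit_vec (i : 'I_d) : E := delta_mx 0 i.

Definition torus_fun {X : Type} (v : E -> X) : Prop :=
  forall (x : E) (i : 'I_d), v (x + (2 * pi) *: unit_vec i) = v x.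

Definition torus_int (g : E -> R) : R := \int[cube_measure d]_x g (pt x).

Definition inner (v w : E -> E) : R := torus_int (fun x => dot (v x) (w x)).
Definition sqnorm2 (v : E -> E) : R := inner v v.

Definition Lq_norm (q : \bar R) (v : E -> E) : \bar R :=
  Lnorm (cube_measure d) q (fun x => (enorm (v (pt x)))%:E).

Definition partial (j : 'I_d) (g : E -> R) : E -> R := 'D_(unit_vec j) g.
Definition coord_fun (v : E -> E) (i : 'I_d) : E -> R := fun x => v x 0 i.

Definition sqnorm2_grad (v : E -> E) : R :=
  torus_int (fun x => \sum_i \sum_j (partial j (coord_fun v i) x) ^+ 2).

Definition L2_field (v : E -> E) : Prop :=
  [/\ torus_fun v,
      forall i, measurable_fun setT
        (fun x : d.-tuple (measurableTypeR R) => coord_fun v i (pt x)) &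
      (Lq_norm 2%:E v < +oo)%E].

End torus.

Section smooth.
Context {R : realType} {V W : normedModType R}.

Fixpoint iter_derive (s : seq V) (F : V -> W) : V -> W :=
  if s is v :: s' then 'D_v (iter_derive s' F) else F.

(* C^oo on the open set O: iterated directional derivatives of all orders, in
   all directions, exist and are continuous on O. *)
Definition smooth_on (O : set V) (F : V -> W) : Prop :=
  forall (s : seq V) (z : V), O z ->
    (forall v : V, derivable (iter_derive s F) z v) /\
    {for z, continuous (iter_derive s F)}.

End smooth.

Section time_integrals.
Context {R : realType}.
Local Notation leb := (@lebesgue_measure R).

(* g is in L^1_loc(a, b) and its integrals over [a', b'] tend to I as
   a' -> a+ and b' -> b- jointly. *)
Definition limit_integral (g : R -> R) (a b I : R) : Prop :=
  locally_integrable `]a, b[ g /\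
  (fun z : R * R => \int[leb]_(t in `[z.1, z.2]) g t) @
    filter_prod (a^'+) (b^'-) --> I.

Definition classL (a b : R) (g : R -> R) : Prop :=
  exists I : R, limit_integral g a b I.

Definition oriented_integral (g : R -> R) (a b I : R) : Prop :=
  if a <= b then limit_integral g a b I else limit_integral g b a (- I).

(* Membership in L^p(0, T; X), where N t is the X-norm at time t; the value of
   N outside ]0, T[ is irrelevant. *)
Definition in_Lp_time (T : R) (p : \bar R) (N : R -> \bar R) : Prop :=
  measurable_fun `]0, T[ N /\ ('N[leb]_p[N \_ `]0%R, T[] < +oo)%E.

End time_integrals.

Section fourier.
Context {R : realType} {d : nat}.
Local Notation E := 'rV[R]_d.
Local Open Scope complex_scope.

Definition freq (k : 'rV[int]_d) : E := map_mx intr k.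

Definition expi (a : R) : R[i] := cos a +i* sin a.

Definition fourier_coef (g : E -> R) (k : 'rV[int]_d) : R[i] :=
  (((2 * pi) ^- d)%:C) *
  (torus_int (fun x => g x * cos (dot (freq k) x)) +i*
   (- torus_int (fun x => g x * sin (dot (freq k) x)))).

(* Only used for compactly supported m, so that the sum is finite.  For v real
   and m even the sum is real, and Re is just the retraction of R[i] onto R. *)
Definition multiplier (m : E -> R) (v : E -> E) : E -> E := fun x => \row_i
  complex.Re (\sum_(k \in [set: 'rV[int]_d])
    (m (freq k))%:C * fourier_coef (coord_fun v i) k * expi (dot (freq k) x)).

Definition LP_cutoff (chi : E -> R) : Prop :=
  [/\ smooth_on setT (chi : E -> R^o),
      forall x y : E, enorm x <= enorm y -> chi y <= chi x,
      forall x : E, enorm x <= 2^-1 -> chi x = 1 &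
      forall x : E, 1 <= enorm x -> chi x = 0].

Definition LP_symbol (chi : E -> R) (q : int) (xi : E) : R :=
  if (0 <= q)%R then
    let eta := ((2 : R) ^ (- q)) *: xi in chi (2^-1 *: eta) - chi eta
  else chi xi.

(* The frequency index q ranges over the integers >= -1. *)
Definition LP_block (chi : E -> R) (q : int) (v : E -> E) : E -> E :=
  multiplier (LP_symbol chi q) v.

Definition LP_le (chi : E -> R) (q : nat) (v : E -> E) : E -> E :=
  fun x => \sum_(r < q.+2) LP_block chi (r%:Z - 1) v x.

Definition besov_norm (chi : E -> R) (s : R) (v : E -> E) : \bar R :=
  ereal_sup [set ((2 `^ (q%:~R * s))%:E * Lq_norm 3%:E (LP_block chi q v))%E |
             q in [set q : int | (-1 <= q)%R]].

Definition sq_abs (z : R[i]) : R := complex.Re z ^+ 2 + complex.Im z ^+ 2.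

Definition Hm1_norm (v : E -> E) : \bar R :=
  (esum [set: 'rV[int]_d] (fun k =>
    ((1 + dot (freq k) (freq k))^-1 *
     \sum_i sq_abs (fourier_coef (coord_fun v i) k))%:E) `^ 2^-1)%E.

End fourier.

Section distributions.
Context {R : realType} {d : nat}.
Local Notation E := 'rV[R]_d.

Definition test_field (phi : E -> E) : Prop :=
  torus_fun phi /\ smooth_on setT phi.

(* Linear forms on smooth fields on the torus that are continuous for the
   C^oo topology. *)
Definition torus_distribution (L : (E -> E) -> R) : Prop :=
  (forall (a : R) (phi psi : E -> E), test_field phi -> test_field psi ->
     L (fun x => a *: phi x + psi x) = a * L phi + L psi) /\
  exists (C : R) (m : nat), forall (phi : E -> E) (M : R), test_field phi ->
    (forall (s : seq 'I_d) (x : E), (size s <= m)%N ->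
       enorm (iter_derive (map unit_vec s) phi x) <= M) ->
    `|L phi| <= C * M.

Definition has_dist_limit (f : R -> E -> E) (F : set_system R) : Prop :=
  exists L : (E -> E) -> R, torus_distribution L /\
    forall phi : E -> E, test_field phi ->
      (fun t => inner (f t) phi) @ F --> L phi.

Definition weak_L2_limit (u : R -> E -> E) (F : set_system R) (u0 : E -> E) :
    Prop :=
  L2_field u0 /\
  forall phi : E -> E, L2_field phi ->
    (fun t => inner (u t) phi) @ F --> inner u0 phi.

End distributions.

Section navier_stokes.
Context {R : realType} {d : nat}.
Local Notation E := 'rV[R]_d.

Definition QT (T : R) : set (R^o * E) := [set z | 0 < z.1 < T].

Definition smooth_QT (T : R) {W : normedModType R} (g : R -> E -> W) : Prop :=
  smooth_on (QT T) (fun z : R^o * E => g z.1 z.2) /\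
  forall t, 0 < t < T -> torus_fun (g t).

Definition divergence (v : E -> E) (x : E) : R :=
  \sum_j partial j (coord_fun v j) x.
Definition laplacian (g : E -> R) (x : E) : R :=
  \sum_j partial j (partial j g) x.

Definition NSE (T : R) (u f : R -> E -> E) (p : R -> E -> R) : Prop :=
  forall (t : R) (x : E), 0 < t < T ->
    divergence (u t) x = 0 /\
    forall i : 'I_d,
      derive1 (fun s : R => coord_fun (u s) i x) t
      - laplacian (coord_fun (u t) i) x
      + \sum_j partial j (fun y => coord_fun (u t) i y * coord_fun (u t) j y) x
      + partial i (p t) x
      = coord_fun (f t) i x.

Definition classN (T : R) (u f : R -> E -> E) : Prop :=
  [/\ smooth_QT T u /\ in_Lp_time T +oo%E (fun t => Lq_norm 2%:E (u t)),
      smooth_QT T f,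
      exists p : R -> E -> R, smooth_QT T (p : R -> E -> R^o) /\ NSE T u f p,
      classL 0 T (fun t => inner (u t) (f t)) &
      has_dist_limit f (0^'+) /\ has_dist_limit f (T^'-)].

(* The values u 0 and u T, which classN does not constrain, are
   representatives of the weak L^2 limits at the endpoints. *)
Definition weak_endpoints (T : R) (u : R -> E -> E) : Prop :=
  weak_L2_limit u (0^'+) (u 0) /\ weak_L2_limit u (T^'-) (u T).

Definition energy_equality (T : R) (u f : R -> E -> E) : Prop :=
  forall t0 t1 : R, 0 <= t0 < T -> 0 <= t1 < T ->
    exists D W : R,
      [/\ oriented_integral (fun t => sqnorm2_grad (u t)) t0 t1 D,
          oriented_integral (fun t => inner (u t) (f t)) t0 t1 W &
          2^-1 * sqnorm2 (u t1) - 2^-1 * sqnorm2 (u t0) + D = W].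

Definition anomalous_work_vanishes (chi : E -> R) (T : R)
    (u f : R -> E -> E) : Prop :=
  exists W : nat -> R,
    (forall q : nat, limit_integral
       (fun t => inner (LP_le chi q (u t)) (LP_le chi q (f t))
                 - inner (u t) (f t)) (T / 2) T (W q)) /\
    W @ \oo --> (0 : R).

End navier_stokes.

(* Main.v *)
Require Import Defs.
From HB Require Import structures.
From mathcomp Require Import all_boot all_order all_algebra.
From mathcomp Require Import all_classical all_reals all_analysis.
From mathcomp Require Import measurable_realfun ess_sup_inf complex.
From mathcomp Require Import ring lra zify.
Set Implicit Arguments.
Unset Strict Implicit.
Unset Printing Implicit Defensive.

Import Order.TTheory GRing.Theory Num.Theory.
Import numFieldNormedType.Exports.

Local Open Scope classical_set_scope.
Local Open Scope ring_scope.

(** Why such a pair exists.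

    Before time T the velocity is a divergence-free trigonometric polynomial
    with moving amplitudes, and the force is what the equations with zero
    pressure make of it.  So only the velocity has to be chosen: its energy
    must run off to infinite frequency as t tends to T, and this must remain
    invisible to the work of the force on low frequencies.  If the modes
    merely changed their amplitudes, the force would have to pay for the
    energy that crosses the threshold of a filter.  The cascade below lets
    the transport term carry that energy instead.

    Write b = 2^(n + 6) for the scale of the n-th stage and X = b^D for its
    peak, where D = 3 d e is large.  In this stage the energy passes from a
    thin slab of X^2 frequencies, at distance X / b^3 from the origin along
    one axis, to the next slab, along another axis.  The modes of the two
    slabs have the sizes cos(a) / X and sin(a) / X', where X' is the next peak
    and the angle a turns smoothly from 0 to pi / 2, so that the energy stays
    close to half the volume of the torus while the maximum of the velocity
    is O(X).  A third family, the shear, contains all the differences of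
    frequencies of the two slabs.  Its amplitude is proportional to the
    derivative of a and is adjusted so that in each triad the transport hands
    over energy at the rate at which the angle turns.  The frequencies of a slab are nearly parallel, hence
    the gains and losses of a triad cancel up to the relative thickness 1 / b
    of the slabs, separately at each of its three frequencies
    ([triad_balance]).  Therefore, for every symbol s with values in [0, 1],
    the filtered product <s(D) u, u_t + (u . grad) u> is at most
    C X^2 / b^6 ([stage_work], [work_bound]), and the dissipation has the
    same bound.

    A stage lasts about b^5 / X^2, so anything of size X^2 / b^6 is integrable
    up to time T ([slot_weight], [stage_integrable]).  The work of the force
    is of this kind, with or without a filter, and at a fixed time the filters
    eventually act as the identity: dominated convergence makes the anomalous
    work vanish ([usol_anomalous]).  The energy equality holds on [0, T)
    because the solution is smooth there.  As t tends to T the energy tends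
    to half the volume of the torus, whereas the frequencies leave every
    finite set, so that u(t) tends weakly to 0 by Bessel's inequality
    ([cvg_weak]); this is the jump.

    A norm that is O(X^a) in the n-th stage belongs to L^p(0, T) as soon as
    a p < 2, with a margin of order 1 / D ([in_Lp_pow]).  Interpolation
    between the energy and the maximum gives a = 1 - 2 / q for the L^q norm
    and a = 1 / 3 for the L^3 norm, and the frequencies are O(X / b^3); the
    H^-1 norm of the force is O(X), its three parts being a time derivative,
    a Laplacian, both at frequencies of order X / b^3, and the divergence of
    u (x) u.  In each case the exponents of the statement keep a p away from 2
    by a margin that depends on eps alone, and D is chosen accordingly.

    Finally the force tends to 0 at time T in the sense of distributions: all the
    frequencies of a stage lie on the lattice b Z^d, incompressibility removes
    the mean, and the Fourier coefficients of a smooth field decay faster than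
    the powers of b by which the amplitudes of the force grow
    ([fsol_limits]). *)

(** * Integration over the torus *)

Section torus_measure.
Context {R : realType}.
Local Notation mR := (measurableTypeR R).
Local Notation leb := (@lebesgue_measure R).

Lemma pi2_gt0 : 0 < 2 * pi :> R.
Proof. by rewrite mulr_gt0// pi_gt0. Qed.

Lemma fin_integrable d (T : measurableType d)
    (mu : {measure set T -> \bar R}) (f : T -> R) (C : R) :
  (mu setT < +oo)%E -> measurable_fun setT f -> (forall x, `|f x| <= C) ->
  mu.-integrable setT (EFin \o f).
Proof.
move=> muT mf fC; apply: (@measurable_bounded_integrable _ _ _ mu) => //.
exists C; split; first exact: num_real.
by move=> x Cx y _ /=; rewrite (le_trans (fC y))// ltW.
Qed.

Lemma fin_measure_ltT d (T : measurableType d)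
    (mu : {finite_measure set T -> \bar R}) : (mu setT < +oo)%E.
Proof. by rewrite ltey_eq fin_num_measure. Qed.

Lemma prod_measure_ltT n :
  ((period_measure \x @cube_measure R n)%E setT < +oo)%E.
Proof.
rewrite -setXTT product_measure1E//.
by rewrite lte_mul_pinfty// ?fin_num_measure// fin_measure_ltT.
Qed.

(** The period cube is built from a restriction of Lebesgue measure; calculus
    applies to the integral over the interval. *)
Lemma integral_period (f : mR -> R) (C : R) : measurable_fun setT f ->
    (forall x, `|f x| <= C) ->
  (\int[period_measure]_x (f x)%:E =
   \int[leb]_(x in `[0%R, (2 * pi)%R]) (f x)%:E)%E.
Proof.
move=> mf fC; pose D := `[0%R, (2 * pi)%R]%classic : set mR.
have mD : measurable D by exact: measurable_itv.
rewrite (@negligible_integral _ _ _ _ setT (~` D))//.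
- rewrite setTD setCK; apply: eq_measure_integral => /= A mA AD.
  by rewrite /period_measure/= /mfrestr /mrestr setIidl.
- exact: measurableC.
- exact: (fin_integrable (fin_measure_ltT _) mf fC).
- by rewrite /= /mfrestr /mrestr setICl measure0.
Qed.

Definition tuple_upd n (x : n.-tuple mR) (j : 'I_n) (s : mR) : n.-tuple mR :=
  [tuple if i == j then s else tnth x i | i < n].

Lemma cube_consE n (H : n.+1.-tuple mR -> R) (C : R) : measurable_fun setT H ->
    (forall x, `|H x| <= C) ->
  (\int[cube_measure n.+1]_x (H x)%:E =
   \int[(period_measure \x cube_measure n)%E]_z (H (tuple_cons z))%:E)%E.
Proof.
move=> mH HC; rewrite /= /cube_step integral_pushforward//.
- exact: measurable_tuple_cons.
- exact/measurable_EFinP.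
- rewrite preimage_setT.
  apply: (fin_integrable (C := C) (prod_measure_ltT n)) => [|x]; last exact: HC.
  by apply: measurableT_comp => //; exact: measurable_tuple_cons.
Qed.

(** Fubini, one coordinate at a time: the cube splits off its first factor,
    and the coordinate [j] is either that factor or one of the remaining cube.
    *)
Lemma cube_slice0 n (H : n.-tuple mR -> R) (j : 'I_n) (C : R) :
  measurable_fun setT H -> (forall x, `|H x| <= C) ->
  (forall x, \int[leb]_(s in `[0, 2 * pi]) H (tuple_upd x j s) = 0) ->
  (\int[cube_measure n]_x (H x)%:E = 0)%E.
Proof.
elim: n H j => [|n IH] H j mH HC slice; first by case: j slice.
rewrite (cube_consE mH HC).
have mHc : measurable_fun setT (H \o (@tuple_cons R n)).
  by apply: measurableT_comp => //; exact: measurable_tuple_cons.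
have iHc : (period_measure \x cube_measure n)%E.-integrable setT
    (EFin \o (H \o (@tuple_cons R n))).
  by apply: (fin_integrable (C := C) (prod_measure_ltT n)) => // x; exact: HC.
case: (unliftP ord0 j) => [j'|] jE.
- rewrite -(integral12_prod_meas1 iHc) /fubini_F.
  apply: integral0_eq => s _.
  apply: (IH (fun y => H (tuple_cons (s, y))) j').
  + by apply: (measurableT_comp mHc); exact: pair1_measurable.
  + by move=> x; exact: HC.
  + move=> x; rewrite -[RHS](slice (tuple_cons (s, x))); apply: eq_Rintegral => t _.
    congr (H _); apply: eq_from_tnth => i.
    rewrite tnth_mktuple jE; case: (unliftP ord0 i) => [i'|] ->.
      by rewrite (inj_eq lift_inj) !(tnthS, tnth_mktuple)//.
    by rewrite (negbTE (neq_lift _ _)) !tnth0.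
- rewrite -(integral21_prod_meas1 iHc) /fubini_G.
  apply: integral0_eq => y _ /=.
  have mHy : measurable_fun setT (fun s : mR => H (tuple_cons (s, y))).
    by apply: (measurableT_comp mHc); exact: pair2_measurable.
  have fin := integrable_fin_num measurableT
    (fin_integrable (fin_measure_ltT (@period_measure R)) mHy (fun s => HC _)).
  rewrite -[LHS](fineK fin) (integral_period mHy (fun s => HC _)).
  apply: etrans (congr1 EFin (slice (tuple_cons (0, y)))); rewrite /Rintegral.
  congr (fine _)%:E; apply: eq_integral => s _; congr (H _)%:E.
  apply: eq_from_tnth => i.
  rewrite tnth_mktuple jE; case: (unliftP ord0 i) => [i'|] ->.
    by rewrite eq_sym (negbTE (neq_lift _ _)) !tnthS.
  by rewrite eqxx tnth0.
Qed.

End torus_measure.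

Section calculus.
Context {R : realType}.
Local Notation leb := (@lebesgue_measure R).

Lemma FTC_Rintegral (F f : R -> R) (a b : R) : a <= b ->
  (forall s : R, is_derive s 1 F (f s)) -> continuous f ->
  \int[leb]_(s in `[a, b]) f s = F b - F a.
Proof.
rewrite le_eqVlt => /predU1P[->|ab] dF cf.
  by rewrite set_itv1 Rintegral_set1 subrr.
have cF : continuous F.
  by move=> s; apply/differentiable_continuous/derivable1_diffP; case: (dF s).
rewrite /Rintegral (@continuous_FTC2 _ f F a b)//.
- exact: continuous_subspaceT.
- split; first by move=> s _; case: (dF s).
  + exact/cvg_at_right_filter/cF.
  + exact/cvg_at_left_filter/cF.
- by move=> s _; rewrite derive1E; case: (dF s).
Qed.

Lemma cos_period_int (x : R) (k : int) : cos (x + k%:~R * (2 * pi)) = cos x.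
Proof.
have cosP (n : nat) (y : R) : cos (y + n%:R * (2 * pi)) = cos y.
  elim: n y => [|n IH] y; first by rewrite mul0r addr0.
  have -> : y + n.+1%:R * (2 * pi) = y + n%:R * (2 * pi) + pi *+ 2.
    by rewrite -natr1 mulr2n; ring.
  by rewrite cosD2pi IH.
case: k => n; first exact: cosP.
have -> : (Negz n)%:~R = - n.+1%:R :> R by rewrite NegzE mulrNz.
by rewrite mulNr -(cosP n.+1 (x - _)) subrK.
Qed.

Lemma continuous_bigsum (V : normedModType R) (T : topologicalType) (I : Type)
    (r : seq I) (F : I -> T -> V) :
  (forall i, continuous (F i)) -> continuous (fun x => \sum_(i <- r) F i x).
Proof.
move=> cF; elim: r => [|i r IH] x.
  by under eq_fun do rewrite big_nil; exact: cvg_cst.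
under eq_fun do rewrite big_cons.
by apply: cvgD; [exact: cF|exact: IH].
Qed.

Lemma is_derive_cos_affine (c p s : R) :
  is_derive s 1 (fun s => cos (c * s + p)) (- (c * sin (c * s + p))).
Proof.
have -> : - (c * sin (c * s + p)) = - sin (c * s + p) * c by rewrite mulNr mulrC.
apply: (is_derive1_comp (f := cos) (g := fun s => c * s + p)).
have D : is_derive s 1 ((c \*: @id R) + cst p) (c *: 1 + 0) by exact: is_deriveD.
by move: D; rewrite /GRing.scale/= mulr1 addr0.
Qed.

End calculus.

Section torus_integral.
Context {R : realType} {d : nat}.
Local Notation mR := (measurableTypeR R).
Local Notation leb := (@lebesgue_measure R).
Local Notation E := 'rV[R]_d.
Implicit Types g h : E -> R.

Definition tmeas g := measurable_fun setT (fun x : d.-tuple mR => g (pt x)).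
Definition tint g := (cube_measure d).-integrable setT
  (fun x : d.-tuple mR => (g (pt x))%:E).

(** The measurable sets of the cube are generated by its coordinates, so an
    open set has to be written as a countable union of boxes: those with
    rational centre and radius 1 / n that it contains. *)
Lemma tmeas_cont g : continuous g -> tmeas g.
Proof.
move=> cg; apply: (measurability _ (RGenOInfty.measurableE R)) => _ [_ [y ->] <-].
rewrite setTI.
pose U := g @^-1` `]y, +oo[%classic.
have oU : open U by apply: open_comp => //; move=> x _; exact: cg.
pose box (z : 'rV[rat]_d * nat) : set E :=
  [set w | forall i, `|ratr (z.1 0 i) - w 0 i| < z.2.+1%:R^-1].
pose B z : set (d.-tuple mR) :=
  if `[< box z `<=` U >] then [set x | box z (pt x)] else set0.
have -> : (fun x : d.-tuple mR => g (pt x)) @^-1` `]y, +oo[ = \bigcup_z B z.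
  apply/seteqP; split => x; last first.
    by move=> [z _]; rewrite /B; case: asboolP => // zU /zU.
  move=> /= Ux.
  have : nbhs (pt x) U by apply: open_nbhs_nbhs; split.
  rewrite -nbhs_ballE => -[e /= e0 eU].
  have [k ke] : exists k : nat, 2 * k.+1%:R^-1 < e.
    exists (Num.bound (2 / e)); rewrite ltr_pdivrMr// -ltr_pdivrMl// mulrC.
    rewrite (lt_trans (archi_boundP _))// ?ltr_nat//.
    by rewrite divr_ge0// ltW.
  have k0 : 0 < k.+1%:R^-1 :> R by rewrite invr_gt0.
  have lt2 (a : R) : a - k.+1%:R^-1 < a + k.+1%:R^-1.
    by rewrite ltrD2l (lt_trans _ k0)// oppr_lt0.
  have [q Hq] := choice (fun i : 'I_d => rat_in_itvoo (lt2 (tnth x i))).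
  exists (\row_i q i, k) => //; rewrite /B.
  have qx i : `|ratr (q i) - tnth x i| < k.+1%:R^-1.
    by have := Hq i; rewrite in_itv/= ltr_distl.
  case: asboolP => [_ i|]; first by rewrite /= !mxE.
  case => w bw; apply: eU; split => // i0 i; rewrite ord1.
  have := bw i; rewrite /= !mxE => wi.
  rewrite -ball_normE/=; apply: le_lt_trans ke.
  rewrite -(subrK (ratr (q i)) (tnth x i)) -addrA (le_trans (ler_normD _ _))//.
  rewrite mulr_natl mulr2n lerD//; first by rewrite distrC ltW.
  exact: ltW.
have cT : countable [set: 'rV[rat]_d * nat] by exact: countableP.
apply: (countable_bigcupT_measurable cT).
move=> z; rewrite /B; case: asboolP => // _.
have -> : [set x | box z (pt x)] = \bigcap_(i in [set: 'I_d])
    [set x : d.-tuple mR | `|ratr (z.1 0 i) - tnth x i| < z.2.+1%:R^-1].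
  apply/seteqP; split => x /=; first by move=> + i _ => /(_ i); rewrite mxE.
  by move=> H i; rewrite mxE; exact: H.
apply: fin_bigcap_measurable => // i _.
have mi : measurable_fun setT
    (fun x : d.-tuple mR => `|ratr (z.1 0 i) - tnth x i|).
  apply: measurableT_comp => //; apply: measurable_funB => //.
  exact: measurable_tnth.
have := mi measurableT _ (measurable_itv `]-oo, z.2.+1%:R^-1[).
by rewrite setTI; congr measurable; apply/seteqP; split => x /=; rewrite in_itv.
Qed.

Lemma tint_bounded g (C : R) : tmeas g -> (forall x, `|g x| <= C) -> tint g.
Proof. by move=> mg gC; apply: (fin_integrable (fin_measure_ltT _) mg). Qed.

Lemma eq_torus_int g h : g =1 h -> torus_int g = torus_int h.
Proof. by move=> gh; apply: eq_Rintegral => x _; rewrite gh. Qed.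

Lemma torus_intD g h : tint g -> tint h ->
  torus_int (fun x => g x + h x) = torus_int g + torus_int h.
Proof. by move=> ig ih; rewrite /torus_int RintegralD. Qed.

Lemma torus_intZ (c : R) g : tint g ->
  torus_int (fun x => c * g x) = c * torus_int g.
Proof. by move=> ig; rewrite /torus_int RintegralZl. Qed.

Lemma tintD g h : tint g -> tint h -> tint (fun x => g x + h x).
Proof. by move=> ig ih; rewrite /tint; under eq_fun do rewrite EFinD; exact: integrableD. Qed.

Lemma tintZ (c : R) g : tint g -> tint (fun x => c * g x).
Proof. by move=> ig; rewrite /tint; under eq_fun do rewrite EFinM; exact: integrableZl. Qed.

Lemma tint0 : tint (fun=> 0).
Proof. by apply: (@tint_bounded _ 0) => [|x]; [exact: measurable_cst|rewrite normr0]. Qed.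

Lemma torus_int0 : torus_int (fun _ : E => 0 : R) = 0.
Proof. by rewrite /torus_int /Rintegral integral0. Qed.

Lemma tint_sum (I : Type) (r : seq I) (P : pred I) (F : I -> E -> R) :
  (forall i, P i -> tint (F i)) -> tint (fun x => \sum_(i <- r | P i) F i x).
Proof.
move=> iF; elim: r => [|i r IH].
  by under eq_fun do rewrite big_nil; exact: tint0.
under eq_fun do rewrite big_cons.
by case Pi : (P i) => //; apply: tintD => //; exact: iF.
Qed.

Lemma torus_int_sum (I : Type) (r : seq I) (P : pred I) (F : I -> E -> R) :
  (forall i, P i -> tint (F i)) ->
  torus_int (fun x => \sum_(i <- r | P i) F i x) =
  \sum_(i <- r | P i) torus_int (F i).
Proof.
move=> iF; elim: r => [|i r IH].
  by rewrite big_nil (eq_torus_int (h := fun _ : E => 0)) ?torus_int0// => x; rewrite big_nil.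
rewrite big_cons; case: ifPn => Pi.
  rewrite -IH -torus_intD; [|exact: iF|exact: tint_sum].
  by apply: eq_torus_int => x; rewrite big_cons Pi.
by rewrite -IH; apply: eq_torus_int => x; rewrite big_cons (negbTE Pi).
Qed.

Lemma torus_int_le g h : tint g -> tint h -> (forall x, g x <= h x) ->
  torus_int g <= torus_int h.
Proof. by move=> ig ih gh; apply: le_Rintegral. Qed.

Lemma torus_int_ge0 g : (forall x, 0 <= g x) -> 0 <= torus_int g.
Proof. by move=> g0; apply: Rintegral_ge0. Qed.

Lemma le_norm_torus_int g : tint g -> `|torus_int g| <= torus_int (fun x => `|g x|).
Proof. by move=> ig; apply: le_normr_Rintegral. Qed.

Lemma tint_norm g : tint g -> tint (fun x => `|g x|).
Proof. by move=> /integrable_norm. Qed.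

Lemma cube_measureT n : cube_measure n setT = ((2 * pi) ^+ n)%:E :> \bar R.
Proof.
elim: n => [|n IH] /=; first by rewrite diracT expr0.
rewrite /cube_step /pushforward preimage_setT -setXTT product_measure1E//.
rewrite [X in (_ * X)%E](_ : _ = ((2 * pi) ^+ n)%:E)//.
rewrite /period_measure/= /mfrestr /mrestr setTI lebesgue_measure_itv/=.
by rewrite lte_fin pi2_gt0 -EFinD subr0 -EFinM exprS.
Qed.

Lemma torus_int_cst (c : R) : torus_int (fun _ : E => c) = c * (2 * pi) ^+ d.
Proof.
rewrite /torus_int Rintegral_cst//; congr (_ * _).
exact: (congr1 fine (cube_measureT d)).
Qed.

(** A derivative along a coordinate has mean zero on each period, since its
    integral is the difference of two equal values. *)
Lemma torus_int_deriv0 (G G' : E -> R) (j : 'I_d) (C : R) :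
  continuous G' -> (forall x, `|G' x| <= C) -> torus_fun G ->
  (forall x (s : R), is_derive s 1 (fun s => G (x + s *: unit_vec j))
     (G' (x + s *: unit_vec j))) ->
  torus_int G' = 0.
Proof.
move=> cG' bG' pG dG; rewrite /torus_int /Rintegral.
rewrite (@cube_slice0 _ _ _ j C)//; first exact: tmeas_cont.
move=> x; pose x0 := pt x - tnth x j *: unit_vec j.
have xE s : pt (tuple_upd x j s) = x0 + s *: unit_vec j.
  apply/rowP => i; rewrite !mxE /= tnth_mktuple.
  by case: eqVneq => [->|]; rewrite ?mulr1 ?mulr0 ?subrK ?subr0 ?addr0 // subrr add0r.
under eq_Rintegral do rewrite xE.
rewrite (@FTC_Rintegral _ (fun s => G (x0 + s *: unit_vec j))).
- by rewrite scale0r addr0 pG subrr.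
- exact/ltW/pi2_gt0.
- move=> s; apply: (@continuous_comp R E R (fun s => x0 + s *: unit_vec j) G').
    apply: (@cvgD R E R (nbhs s)); first exact: cvg_cst.
    by apply: cvgZr_tmp; exact: cvg_id.
  exact: cG'.
Qed.

Lemma dotDr (x y z : E) : dot x (y + z) = dot x y + dot x z.
Proof. by rewrite /dot -big_split; apply: eq_bigr => i _; rewrite mxE mulrDr. Qed.

Lemma dotZr (a : R) (x y : E) : dot x (a *: y) = a * dot x y.
Proof. by rewrite /dot mulr_sumr; apply: eq_bigr => i _; rewrite mxE mulrCA. Qed.

Lemma dotC (x y : E) : dot x y = dot y x.
Proof. by apply: eq_bigr => i _; rewrite mulrC. Qed.

Lemma dotDl (x y z : E) : dot (x + y) z = dot x z + dot y z.
Proof. by rewrite dotC dotDr !(dotC z). Qed.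

Lemma dotZl (a : R) (x y : E) : dot (a *: x) y = a * dot x y.
Proof. by rewrite dotC dotZr dotC. Qed.

Lemma dot_unit (x : E) j : dot x (unit_vec j) = x 0 j.
Proof.
rewrite /dot (bigD1 j)//= mxE !eqxx mulr1 big1 ?addr0// => i ij.
by rewrite mxE (negbTE ij) andbF mulr0.
Qed.

Lemma continuous_coord (i : 'I_d) : continuous (fun x : E => x 0 i).
Proof. exact: coord_continuous. Qed.

Lemma continuous_dot (k : E) : continuous (dot k).
Proof.
apply: continuous_bigsum => i x.
apply: (@cvgM R E (nbhs x)); [exact: cvg_cst|exact: continuous_coord].
Qed.

Definition wave (k : 'rV[int]_d) (p : R) (x : E) : R := cos (dot (freq k) x + p).

Lemma continuous_wave k p : continuous (wave k p).
Proof.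
move=> x; apply: (@continuous_comp E R R (fun x => dot (freq k) x + p) cos).
  apply: (@cvgD R R E (nbhs x)); first exact: continuous_dot.
  exact: cvg_cst.
exact: continuous_cos.
Qed.

Lemma wave_le1 k p x : `|wave k p x| <= 1.
Proof. exact: cos_max. Qed.

Lemma torus_fun_wave k p : torus_fun (wave k p).
Proof.
move=> x i; rewrite /wave dotDr dotZr dot_unit mxE addrAC.
by rewrite mulrC cos_period_int.
Qed.

Lemma is_derive_wave k p j x (s : R) :
  is_derive s 1 (fun s => wave k p (x + s *: unit_vec j))
    ((k 0 j)%:~R * wave k (p + pi / 2) (x + s *: unit_vec j)).
Proof.
have E1 t q : wave k q (x + t *: unit_vec j) =
    cos ((k 0 j)%:~R * t + (dot (freq k) x + q)).
  rewrite /wave dotDr dotZr dot_unit mxE; congr cos; ring.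
rewrite (_ : (fun _ => _) = fun t => cos ((k 0 j)%:~R * t + (dot (freq k) x + p))).
  rewrite E1 !addrA cosDpihalf mulrN -!addrA; exact: is_derive_cos_affine.
by apply/funext => t; rewrite E1.
Qed.

Lemma tint_wave k p : tint (wave k p).
Proof.
apply: (@tint_bounded _ 1); last exact: wave_le1.
by apply: tmeas_cont; exact: continuous_wave.
Qed.

(** A wave of nonzero frequency is, up to a constant, a derivative of its
    shift by a quarter turn. *)
Lemma torus_int_wave k p :
  torus_int (wave k p) = if k == 0 then (2 * pi) ^+ d * cos p else 0.
Proof.
case: eqVneq => [->|k0].
  rewrite -[RHS]mulrC -torus_int_cst; apply: eq_torus_int => x.
  rewrite /wave /dot big1 ?add0r// => i _.
  by rewrite !mxE mul0r.
have [j kj] : exists j, k 0 j != 0.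
  apply/existsP; apply: contraNT k0 => /existsPn k0; apply/eqP/rowP => j.
  by rewrite mxE; apply/eqP/negbNE/k0.
have kj0 : (k 0 j)%:~R != 0 :> R by rewrite intr_eq0.
apply: (@torus_int_deriv0 (fun x => (k 0 j)%:~R^-1 * wave k (p - pi / 2) x) _ j 1).
- exact: continuous_wave.
- exact: wave_le1.
- by move=> x i; rewrite torus_fun_wave.
- move=> x s; have := is_derive_wave k (p - pi / 2) j x s.
  rewrite subrK => dw; apply: is_derive_eq.
  by rewrite /GRing.scale/= mulrA mulVf// mul1r.
Qed.

End torus_integral.

(** * Trigonometric fields *)

Section line_derivative.
Context {R : realType} {V W : normedModType R}.

Lemma is_derive_line (F : V -> W) (x v : V) (dF : W) :
  is_derive (0 : R) 1 (fun h : R => F (h *: v + x)) dF -> is_derive x v F dF.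
Proof.
move=> [dG vG]; apply: DeriveDef; first exact/derivable1P.
rewrite -vG /derive.
set A := (A in lim (A @ _)); set B := (B in _ = lim (B @ _)).
suff -> : A = B by [].
apply/funext => h; rewrite /A /B /=.
have -> : h%:A + 0 = h :> R by rewrite addr0 /GRing.scale/= mulr1.
by rewrite scale0r add0r.
Qed.

Lemma is_derive_bigsum (I : Type) (r : seq I)
    (G : I -> V -> W) (dG : I -> W) (x v : V) :
  (forall i, is_derive x v (G i) (dG i)) ->
  is_derive x v (fun x => \sum_(i <- r) G i x) (\sum_(i <- r) dG i).
Proof.
move=> HG; elim: r => [|i r IH].
  rewrite big_nil; under eq_fun do rewrite big_nil; exact: is_derive_cst.
under eq_fun do rewrite big_cons; rewrite big_cons.
exact: is_deriveD.
Qed.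

End line_derivative.

Section trig.
Context {R : realType} {d : nat}.
Local Notation E := 'rV[R]_d.
Local Notation F := 'rV[int]_d.
Implicit Types (k l : F) (p q : R) (x : E).

Definition vol : R := (2 * pi) ^+ d.
Definition mean_wave k p : R := if k == 0 then vol * cos p else 0.

Lemma vol_gt0 : 0 < vol.
Proof. by rewrite exprn_gt0// pi2_gt0. Qed.

Lemma freqD k l : freq (k + l) = freq k + freq l :> E.
Proof. by apply/rowP => i; rewrite !mxE rmorphD. Qed.

Lemma freqN k : freq (- k) = - freq k :> E.
Proof. by apply/rowP => i; rewrite !mxE rmorphN. Qed.

Lemma freq0 : freq 0 = 0 :> E.
Proof. by apply/rowP => i; rewrite !mxE. Qed.

Lemma dotNl (x y : E) : dot (- x) y = - dot x y.
Proof. by rewrite -scaleN1r dotZl mulN1r. Qed.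

Lemma dotNr (x y : E) : dot x (- y) = - dot x y.
Proof. by rewrite dotC dotNl dotC. Qed.

Lemma dot0l (x : E) : dot 0 x = 0.
Proof. by rewrite /dot big1// => i _; rewrite mxE mul0r. Qed.

Lemma dot0r (x : E) : dot x 0 = 0.
Proof. by rewrite dotC dot0l. Qed.

Lemma dot_sumr (I : Type) (r : seq I) (G : I -> E) (x : E) :
  dot x (\sum_(i <- r) G i) = \sum_(i <- r) dot x (G i).
Proof.
elim: r => [|i r IH]; first by rewrite !big_nil dot0r.
by rewrite !big_cons dotDr IH.
Qed.

Lemma dot_suml (I : Type) (r : seq I) (G : I -> E) (x : E) :
  dot (\sum_(i <- r) G i) x = \sum_(i <- r) dot (G i) x.
Proof. by rewrite dotC dot_sumr; apply: eq_bigr => i _; rewrite dotC. Qed.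

Lemma dot_ge0 x : 0 <= dot x x.
Proof. by apply: sumr_ge0 => i _; rewrite -expr2 sqr_ge0. Qed.

Lemma waveM k l p q x : wave k p x * wave l q x =
  2^-1 * wave (k + l) (p + q) x + 2^-1 * wave (k - l) (p - q) x.
Proof.
rewrite /wave freqD freqD freqN dotDl dotDl dotNl.
set a := dot _ _; set b := dot _ _.
have -> : a + b + (p + q) = (a + p) + (b + q) by ring.
have -> : a - b + (p - q) = (a + p) - (b + q) by ring.
move: (a + p) (b + q) => {}a {}b; rewrite cosD cosB; by field.
Qed.

Lemma torus_int_waveE k p : torus_int (wave k p : E -> R) = mean_wave k p.
Proof. exact: torus_int_wave. Qed.

(** Real modes with a phase: cosines and sines need no separate treatment, and
    complex coefficients are avoided. A field may repeat a frequency. *)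
Record mode := Mode { fr : F; ph : R; amp : E }.

Lemma mode_tripleK : cancel (fun m => (fr m, ph m, amp m))
  (fun z => Mode z.1.1 z.1.2 z.2).
Proof. by case. Qed.

HB.instance Definition _ := Equality.copy mode (can_type mode_tripleK).

Implicit Types (U W : seq mode) (m n : mode).

Definition ev U (x : E) : E := \sum_(m <- U) wave (fr m) (ph m) x *: amp m.

Definition mean2 (m n : mode) : R :=
  2^-1 * mean_wave (fr m + fr n) (ph m + ph n)
  + 2^-1 * mean_wave (fr m - fr n) (ph m - ph n).

Lemma eq_tint (g h : E -> R) : g =1 h -> tint g -> tint h.
Proof. by move=> /funext ->. Qed.

Lemma tint_wave2 k l p q : tint (fun x : E => wave k p x * wave l q x).
Proof.
apply: (eq_tint (fun x => esym (waveM k l p q x))).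
by apply: tintD; apply: tintZ; exact: tint_wave.
Qed.

Lemma torus_int_wave2 m n :
  torus_int (fun x => wave (fr m) (ph m) x * wave (fr n) (ph n) x) = mean2 m n.
Proof.
rewrite (eq_torus_int (h := fun x => 2^-1 * wave (fr m + fr n) (ph m + ph n) x +
  2^-1 * wave (fr m - fr n) (ph m - ph n) x)); last by move=> x; rewrite waveM.
rewrite torus_intD; [|by apply: tintZ; exact: tint_wave..].
by rewrite !torus_intZ ?torus_int_waveE; [|exact: tint_wave..].
Qed.

Lemma ev_cat U W x : ev (U ++ W) x = ev U x + ev W x.
Proof. by rewrite /ev big_cat. Qed.

Lemma evE U x i : ev U x 0 i = \sum_(m <- U) wave (fr m) (ph m) x * amp m 0 i.
Proof.
rewrite /ev; elim: U => [|m U IH]; first by rewrite !big_nil mxE.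
by rewrite !big_cons !mxE IH.
Qed.

Lemma continuous_ev U : continuous (ev U).
Proof.
apply: continuous_bigsum => m x.
apply: (@cvgZr_tmp R E E (nbhs x)); exact: continuous_wave.
Qed.

Lemma torus_fun_ev U : torus_fun (ev U).
Proof. by move=> x i; apply: eq_bigr => m _; rewrite torus_fun_wave. Qed.

Lemma dot_ev U W x : dot (ev U x) (ev W x) =
  \sum_(m <- U) \sum_(n <- W)
    dot (amp m) (amp n) * (wave (fr m) (ph m) x * wave (fr n) (ph n) x).
Proof.
rewrite dot_suml; apply: eq_bigr => m _; rewrite dot_sumr; apply: eq_bigr => n _.
by rewrite dotZl dotZr; ring.
Qed.

Definition pairing U W : R :=
  \sum_(m <- U) \sum_(n <- W) dot (amp m) (amp n) * mean2 m n.

Lemma inner_ev U W : inner (ev U) (ev W) = pairing U W.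
Proof.
rewrite /inner (eq_torus_int (dot_ev U W)) torus_int_sum; last first.
  by move=> m _; apply: tint_sum => n _; apply: tintZ; exact: tint_wave2.
apply: eq_bigr => m _; rewrite torus_int_sum; last first.
  by move=> n _; apply: tintZ; exact: tint_wave2.
by apply: eq_bigr => n _; rewrite torus_intZ ?torus_int_wave2//; exact: tint_wave2.
Qed.

Lemma tint_dot_ev U W : tint (fun x => dot (ev U x) (ev W x)).
Proof.
apply: (eq_tint (fun x => esym (dot_ev U W x))).
by apply: tint_sum => m _; apply: tint_sum => n _; apply: tintZ; exact: tint_wave2.
Qed.

(** A derivative turns the phase by a quarter. *)
Definition deriv_mode (y : E) m :=
  Mode (fr m) (ph m + pi / 2) (dot (freq (fr m)) y *: amp m).

Lemma is_derive_wave_line k p x y :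
  is_derive x y (wave k p) (dot (freq k) y * wave k (p + pi / 2) x).
Proof.
apply: is_derive_line.
have -> : (fun h : R => wave k p (h *: y + x)) =
    fun h => cos (dot (freq k) y * h + (dot (freq k) x + p)).
  apply/funext => h; rewrite /wave dotDr dotZr; congr cos; ring.
have := is_derive_cos_affine (dot (freq k) y) (dot (freq k) x + p) 0.
by rewrite mulr0 add0r /wave addrA cosDpihalf mulrN.
Qed.

Lemma is_derive_coord_wave k p (w : R) x y :
  is_derive x y (fun x => wave k p x * w)
    (dot (freq k) y * wave k (p + pi / 2) x * w).
Proof.
have dw := is_derive_wave_line k p x y.
have -> : (fun x => wave k p x * w) = w \*: (wave k p).
  by apply/funext => z; rewrite /GRing.scale/= mulrC.
by apply: is_derive_eq; rewrite /GRing.scale/= mulrC.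
Qed.

Lemma is_derive_ev_coord U i x y :
  is_derive x y (fun x => ev U x 0 i) (ev (map (deriv_mode y) U) x 0 i).
Proof.
have -> : (fun x => ev U x 0 i) =
    fun x => \sum_(m <- U) wave (fr m) (ph m) x * amp m 0 i.
  by apply/funext => z; rewrite evE.
rewrite evE big_map.
have := @is_derive_bigsum R E R mode U
  (fun m x => wave (fr m) (ph m) x * amp m 0 i)
  (fun m => wave (fr m) (ph m + pi / 2) x * (dot (freq (fr m)) y *: amp m) 0 i) x y.
apply=> m; apply: is_derive_eq (is_derive_coord_wave _ _ _ _ _) _.
by rewrite mxE; ring.
Qed.

Lemma partial_ev U i j x :
  partial j (coord_fun (ev U) i) x = ev (map (deriv_mode (unit_vec j)) U) x 0 i.
Proof. by rewrite /partial; have [_ ->] := is_derive_ev_coord U i x (unit_vec j). Qed.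

Definition div_free U := forall m, m \in U -> dot (amp m) (freq (fr m)) = 0.

(** The sign is that of minus the Laplacian, a nonnegative operator. *)
Definition lap_mode m := Mode (fr m) (ph m) (dot (freq (fr m)) (freq (fr m)) *: amp m).

Lemma laplacian_ev U i x :
  laplacian (coord_fun (ev U) i) x = - ev (map lap_mode U) x 0 i.
Proof.
rewrite /laplacian.
transitivity (\sum_j ev (map (deriv_mode (unit_vec j))
    (map (deriv_mode (unit_vec j)) U)) x 0 i).
  apply: eq_bigr => j _.
  have -> : partial j (coord_fun (ev U) i) =
      coord_fun (ev (map (deriv_mode (unit_vec j)) U)) i.
    by apply/funext => y; rewrite partial_ev.
  by rewrite partial_ev.
under eq_bigr do rewrite evE !big_map.
rewrite exchange_big/= evE big_map -sumrN; apply: eq_bigr => m _ /=.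
have Z (a : R) (v : E) : (a *: v) 0 i = a * v 0 i by rewrite mxE.
rewrite Z [in RHS]/dot mulrA mulr_sumr mulr_suml -sumrN; apply: eq_bigr => j _.
rewrite !Z !dot_unit /wave -[in LHS]addrA -splitr addrA cosDpi; ring.
Qed.

(** The field of [n] transports that of [m]; the product of two waves gives
    the sum and the difference of their frequencies. *)
Definition conv2 m n : seq mode :=
  let c := dot (amp n) (freq (fr m)) / 2 in
  [:: Mode (fr m + fr n) (ph m + pi / 2 + ph n) (c *: amp m);
      Mode (fr m - fr n) (ph m + pi / 2 - ph n) (c *: amp m)].

Definition conv U W : seq mode := flatten [seq conv2 m n | m <- U, n <- W].

Lemma ev_flatten (S : seq (seq mode)) x : ev (flatten S) x = \sum_(U <- S) ev U x.
Proof.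
elim: S => [|U S IH] /=; first by rewrite /ev !big_nil.
by rewrite ev_cat big_cons IH.
Qed.

Lemma ev_conv2 m n x : ev (conv2 m n) x =
  (wave (fr m) (ph m + pi / 2) x * wave (fr n) (ph n) x
   * dot (amp n) (freq (fr m))) *: amp m.
Proof.
rewrite /ev !big_cons big_nil addr0 /= waveM !scalerA -scalerDl; congr (_ *: _).
by field.
Qed.

Lemma ev_conv U W x i : ev (conv U W) x 0 i =
  \sum_j ev W x 0 j * ev (map (deriv_mode (unit_vec j)) U) x 0 i.
Proof.
rewrite /conv ev_flatten big_allpairs_dep /= summxE.
transitivity (\sum_(m <- U) \sum_(n <- W) \sum_j
   wave (fr m) (ph m + pi / 2) x * wave (fr n) (ph n) x *
   (amp n 0 j * freq (fr m) 0 j) * amp m 0 i).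
  apply: eq_bigr => m _; rewrite summxE; apply: eq_bigr => n _.
  by rewrite ev_conv2 mxE /dot mulr_sumr mulr_suml.
transitivity (\sum_j \sum_(m <- U) \sum_(n <- W)
   wave (fr m) (ph m + pi / 2) x * wave (fr n) (ph n) x *
   (amp n 0 j * freq (fr m) 0 j) * amp m 0 i).
  rewrite [RHS]exchange_big/=; apply: eq_bigr => m _.
  by rewrite [RHS]exchange_big.
apply: eq_bigr => j _.
rewrite !evE big_map big_distrlr/= exchange_big/=; apply: eq_bigr => m _.
apply: eq_bigr => n _.
have Z (a : R) (v : E) : (a *: v) 0 i = a * v 0 i by rewrite mxE.
rewrite Z dot_unit; ring.
Qed.

Lemma divergence_ev U x : div_free U -> divergence (ev U) x = 0.
Proof.
move=> dU; rewrite /divergence; under eq_bigr do rewrite partial_ev evE big_map.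
rewrite exchange_big/= big_seq big1// => m mU.
transitivity (wave (fr m) (ph m + pi / 2) x * dot (amp m) (freq (fr m))).
  rewrite [in RHS]/dot mulr_sumr; apply: eq_bigr => j _.
  rewrite [X in _ * X]mxE dot_unit; ring.
by rewrite dU// mulr0.
Qed.

(** The terms in which the divergence falls on the transporting factor vanish,
    so the divergence form of the nonlinearity is the transport term. *)
Lemma div_tensor_ev U i x : div_free U ->
  \sum_j partial j (fun y => coord_fun (ev U) i y * coord_fun (ev U) j y) x =
  ev (conv U U) x 0 i.
Proof.
move=> dU; rewrite ev_conv.
transitivity (\sum_j (ev U x 0 j * ev (map (deriv_mode (unit_vec j)) U) x 0 i +
  ev U x 0 i * partial j (coord_fun (ev U) j) x)).
  apply: eq_bigr => j _; rewrite partial_ev.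
  have d1 := is_derive_ev_coord U i x (unit_vec j).
  have d2 := is_derive_ev_coord U j x (unit_vec j).
  have [_] : is_derive x (unit_vec j)
     ((fun y => ev U y 0 i) * (fun y => ev U y 0 j) : E -> R) _ := is_deriveM d1 d2.
  rewrite /partial => ->; rewrite /GRing.scale/=; ring.
rewrite big_split/= -mulr_sumr -/(divergence _ _) divergence_ev// mulr0 addr0//.
Qed.

Definition scale_mode (c : R) m := Mode (fr m) (ph m) (c *: amp m).

Lemma ev_scale c U x : ev (map (scale_mode c) U) x = c *: ev U x.
Proof.
rewrite /ev big_map scaler_sumr; apply: eq_bigr => m _ /=.
by rewrite !scalerA mulrC.
Qed.

Lemma pairing_catl U U' W : pairing (U ++ U') W = pairing U W + pairing U' W.
Proof. by rewrite /pairing big_cat. Qed.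

Lemma pairing_catr U W W' : pairing U (W ++ W') = pairing U W + pairing U W'.
Proof. by rewrite /pairing -big_split; apply: eq_bigr => m _; rewrite big_cat. Qed.

Lemma pairing_scalel c U W : pairing (map (scale_mode c) U) W = c * pairing U W.
Proof.
rewrite /pairing big_map mulr_sumr; apply: eq_bigr => m _; rewrite mulr_sumr.
by apply: eq_bigr => n _; rewrite dotZl mulrA.
Qed.

Lemma pairing_scaler c U W : pairing U (map (scale_mode c) W) = c * pairing U W.
Proof.
rewrite /pairing mulr_sumr; apply: eq_bigr => m _; rewrite big_map mulr_sumr.
by apply: eq_bigr => n _; rewrite dotZr; ring.
Qed.

Definition mult_mode (s : E -> R) m := Mode (fr m) (ph m) (s (freq (fr m)) *: amp m).

Definition mean3 (a b c : mode) : R :=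
  4^-1 * (mean_wave (fr a + fr b + fr c) (ph a + ph b + ph c)
   + mean_wave (fr a + fr b - fr c) (ph a + ph b - ph c)
   + mean_wave (fr a - fr b + fr c) (ph a - ph b + ph c)
   + mean_wave (fr a - fr b - fr c) (ph a - ph b - ph c)).

Definition shift_mode m := Mode (fr m) (ph m + pi / 2) (amp m).

Lemma mean_waveN k p : mean_wave (- k) (- p) = mean_wave k p.
Proof. by rewrite /mean_wave oppr_eq0 cosN. Qed.

(** The triads in the product of the filtered field [U] with the transport of
    [V] by [W]; the quarter turn of the middle factor comes from its gradient.
    *)
Definition trilinear (s : E -> R) U V W : R :=
  \sum_(a <- U) \sum_(b <- V) \sum_(c <- W)
    s (freq (fr a)) * dot (amp a) (amp b) * dot (amp c) (freq (fr b))
    * mean3 a (shift_mode b) c.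

Lemma pairing_conv s U V W :
  pairing (map (mult_mode s) U) (conv V W) = trilinear s U V W.
Proof.
rewrite /pairing big_map; apply: eq_bigr => a _.
rewrite /conv big_flatten/= big_allpairs_dep/=.
apply: eq_bigr => b _; apply: eq_bigr => c _.
rewrite !big_cons big_nil addr0 /= dotZl !dotZr /mean2 /mean3 /=.
have -> : fr a + (fr b + fr c) = fr a + fr b + fr c by rewrite addrA.
have -> : fr a - (fr b + fr c) = fr a - fr b - fr c by rewrite opprD addrA.
have -> : fr a + (fr b - fr c) = fr a + fr b - fr c by rewrite addrA.
have -> : fr a - (fr b - fr c) = fr a - fr b + fr c by rewrite opprB addrA addrAC.
have -> : ph a + (ph b + pi / 2 + ph c) = ph a + (ph b + pi / 2) + ph c by ring.
have -> : ph a - (ph b + pi / 2 + ph c) = ph a - (ph b + pi / 2) - ph c by ring.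
have -> : ph a + (ph b + pi / 2 - ph c) = ph a + (ph b + pi / 2) - ph c by ring.
have -> : ph a - (ph b + pi / 2 - ph c) = ph a - (ph b + pi / 2) + ph c by ring.
by field.
Qed.

(** Two modes interact only if their frequencies agree up to sign, and there
    an even symbol takes the same value. *)
Lemma pairing_mult s U W : (forall x, s (- x) = s x) ->
  pairing (map (mult_mode s) U) (map (mult_mode s) W) =
  pairing (map (mult_mode (fun x => s x ^+ 2)) U) W.
Proof.
move=> sN; rewrite /pairing !big_map; apply: eq_bigr => m _; rewrite big_map.
apply: eq_bigr => n _ /=; rewrite !dotZl dotZr /mean2 /=.
rewrite /mean_wave addr_eq0 subr_eq0.
have [E1|_] := eqVneq (fr m) (- fr n).
  by rewrite E1 freqN sN; ring.
have [->|_] := eqVneq (fr m) (fr n); first by ring.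
by rewrite !mulr0 addr0 !mulr0.
Qed.

End trig.

Arguments vol : clear implicits.
Arguments vol_gt0 : clear implicits.

(** * Fourier coefficients *)

Section fourier_theory.
Context {R : realType} {d : nat}.
Local Notation E := 'rV[R]_d.
Local Notation F := 'rV[int]_d.
Local Notation mode := (@mode R d).
Implicit Types (k l : F) (p q : R) (x : E).

Lemma cos_wave k x : cos (dot (freq k) x) = wave k 0 x.
Proof. by rewrite /wave addr0. Qed.

Lemma sin_wave k x : sin (dot (freq k) x) = wave k (- (pi / 2)) x.
Proof. by rewrite /wave cosBpihalf. Qed.

Lemma tint_mulwave (g : E -> R) k p : tint g -> tint (fun x => g x * wave k p x).
Proof.
move=> ig; apply: (le_integrable measurableT _ _ ig) => /=.
  apply/measurable_EFinP; apply: measurable_funM.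
    by apply/measurable_EFinP; exact: measurable_int ig.
  by apply: tmeas_cont; exact: continuous_wave.
move=> x _ /=; rewrite lee_fin normrM -[leRHS]mulr1 ler_wpM2l//.
exact: wave_le1.
Qed.

(** The phases 0 and - (pi / 2) give the cosine and the sine coefficients. *)
Definition coef (g : E -> R) k p : R := torus_int (fun x => g x * wave k p x).

Lemma fourier_coefE (g : E -> R) k : fourier_coef g k =
  Complex ((vol R d)^-1 * coef g k 0) (- ((vol R d)^-1 * coef g k (- (pi / 2)))).
Proof.
rewrite /fourier_coef /coef.
have -> : (fun x => g x * cos (dot (freq k) x)) = (fun x => g x * wave k 0 x).
  by apply/funext => x; rewrite cos_wave.
have -> : (fun x => g x * sin (dot (freq k) x)) =
    (fun x => g x * wave k (- (pi / 2)) x).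
  by apply/funext => x; rewrite sin_wave.
by apply/eqP; rewrite eq_complex /= !mul0r subr0 addr0 mulrN !eqxx.
Qed.

Lemma coef_ev (U : seq mode) i k p :
  coef (coord_fun (ev U) i) k p = \sum_(m <- U) amp m 0 i * mean2 m (Mode k p 0).
Proof.
rewrite /coef (eq_torus_int (h := fun x => \sum_(m <- U)
   amp m 0 i * (wave (fr m) (ph m) x * wave k p x))); last first.
  move=> x; rewrite /coord_fun evE mulr_suml; apply: eq_bigr => m _; ring.
rewrite torus_int_sum; last by move=> m _; apply: tintZ; exact: tint_wave2.
apply: eq_bigr => m _; rewrite torus_intZ; last exact: tint_wave2.
by rewrite (torus_int_wave2 m (Mode k p 0)).
Qed.

Lemma big_seq_pick (I : eqType) (r : seq I) (l : I) (G : I -> R) : uniq r ->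
  l \in r -> \sum_(k <- r) (if k == l then G k else 0) = G l.
Proof.
move=> ur lr; rewrite (bigD1_seq l)//= eqxx big1 ?addr0// => k kl.
by rewrite (negbTE kl).
Qed.

Lemma Re_sum (I : Type) (r : seq I) (G : I -> R[i]) :
  complex.Re (\sum_(k <- r) G k) = \sum_(k <- r) complex.Re (G k).
Proof.
elim: r => [|k r IH]; first by rewrite !big_nil.
by rewrite !big_cons -IH; case: (G k) => a b; case: (\sum_(_ <- _) _).
Qed.

Definition supp (W : seq mode) : seq F := undup (map (@fr R d) W ++ map (fun m => - fr m) W).

Lemma coef_supp (U : seq mode) i k p : k \notin supp U -> coef (coord_fun (ev U) i) k p = 0.
Proof.
rewrite mem_undup mem_cat negb_or => /andP[k1 k2].
rewrite coef_ev big_seq big1// => m mU; rewrite /mean2 /mean_wave /=.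
case: eqVneq => [h|_].
  case/negP: k2; apply/mapP; exists m => //.
  by apply/eqP; rewrite -addr_eq0 addrC h.
case: eqVneq => [h|_]; last by rewrite !mulr0 addr0 mulr0.
by case/negP: k1; apply/mapP; exists m => //; apply/eqP; rewrite eq_sym -subr_eq0 h.
Qed.

(** A real mode has its two frequencies [fr m] and [- fr m] in [r], and each
    contributes one half of it; the value of an even symbol is common to both.
    *)
Lemma fourier_sum_ev (s : E -> R) (U : seq mode) r x i : (forall y, s (- y) = s y) ->
  uniq r -> {subset supp U <= r} ->
  \sum_(k <- r) s (freq k) * (vol R d)^-1 * (coef (coord_fun (ev U) i) k 0 * wave k 0 x
     + coef (coord_fun (ev U) i) k (- (pi / 2)) * wave k (- (pi / 2)) x)
  = ev (map (mult_mode s) U) x 0 i.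
Proof.
move=> sN ur sub.
have rU a : a \in U -> fr a \in r /\ - fr a \in r.
  move=> aW; split; apply: sub; rewrite !mem_undup !mem_cat.
    by rewrite (map_f (@fr R d) aW).
  by rewrite (map_f (fun a : mode => - fr a) aW) orbT.
rewrite evE big_map.
transitivity (\sum_(k <- r) \sum_(m <- U) s (freq k) * (vol R d)^-1 * amp m 0 i *
   (mean2 m (Mode k 0 0) * wave k 0 x +
    mean2 m (Mode k (- (pi / 2)) 0) * wave k (- (pi / 2)) x)).
  apply: eq_bigr => k _; rewrite !coef_ev !mulr_suml -big_split mulr_sumr /=.
  by apply: eq_bigr => m _; ring.
rewrite exchange_big/= big_seq [RHS]big_seq; apply: eq_bigr => m mU.
have [r1 r2] := rU _ mU.
pose G k := 2^-1 * s (freq k) * amp m 0 i *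
  (cos (ph m) * wave k 0 x + cos (ph m - pi / 2) * wave k (- (pi / 2)) x).
pose H k := 2^-1 * s (freq k) * amp m 0 i *
  (cos (ph m) * wave k 0 x + cos (ph m + pi / 2) * wave k (- (pi / 2)) x).
transitivity (\sum_(k <- r) ((if k == - fr m then G k else 0) +
                             (if k == fr m then H k else 0))).
  apply: eq_bigr => k _; rewrite /mean2 /mean_wave /= addr0 subr0 opprK.
  rewrite addr_eq0 subr_eq0 ![fr m == _]eq_sym eqr_oppLR.
  have v0 := lt0r_neq0 (vol_gt0 R d).
  rewrite /G /H; case: eqP => _; case: eqP => _; rewrite ?mulr0 ?addr0 ?add0r; by field.
rewrite big_split/= !big_seq_pick// /G /H /wave freqN dotNl sN /=.
rewrite [X in _ = _ * X]mxE !addr0 cosBpihalf cosDpihalf !cosBpihalf cosN sinN cosD; by field.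
Qed.

(** The sum over all frequencies in [multiplier] has finitely many nonzero
    terms here. *)
Lemma multiplier_ev (s : E -> R) (U : seq mode) : (forall x, s (- x) = s x) ->
  multiplier s (ev U) = ev (map (mult_mode s) U).
Proof.
move=> sN; apply/funext => x; apply/rowP => i; rewrite mxE.
have ur : uniq (supp U) by exact: undup_uniq.
rewrite -(fourier_sum_ev x i sN ur)//.
rewrite -(fsbig_widen [set` supp U] setT)//; last first.
  move=> k [_ /= /negP kr]; rewrite fourier_coefE !coef_supp//.
  have -> : Complex ((vol R d)^-1 * 0) (- ((vol R d)^-1 * 0)) = 0 :> R[i].
    by apply/eqP; rewrite eq_complex /= mulr0 oppr0 eqxx.
  by rewrite mulr0 mul0r.
rewrite -fsbig_seq// Re_sum; apply: eq_bigr => k _.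
rewrite fourier_coefE /expi cos_wave sin_wave /=.
by rewrite !mul0r !subr0 !addr0; ring.
Qed.

(** The square of the difference between [g] and its partial Fourier sum [h]
    has a nonnegative integral. The list [r] need not be symmetric, so for the
    integral of [h ^+ 2] there is only an inequality. *)
Lemma bessel (g : E -> R) (r : seq F) : tint g -> tint (fun x => g x ^+ 2) ->
  uniq r ->
  \sum_(k <- r) (coef g k 0 ^+ 2 + coef g k (- (pi / 2)) ^+ 2) <=
  vol R d * torus_int (fun x => g x ^+ 2).
Proof.
move=> ig ig2 ur.
pose A k := coef g k 0; pose B k := coef g k (- (pi / 2)).
pose v := vol R d.
have v0 : 0 < v := vol_gt0 R d.
pose S := \sum_(k <- r) (A k ^+ 2 + B k ^+ 2).
rewrite -/S.
pose h x := \sum_(k <- r) v^-1 * (A k * wave k 0 x + B k * wave k (- (pi / 2)) x).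
have itw k p : tint (fun x => g x * wave k p x) by exact: tint_mulwave.
have ighk k : tint (fun x => A k * (g x * wave k 0 x) +
    B k * (g x * wave k (- (pi / 2)) x)).
  by apply: tintD; apply: tintZ.
have ghE x : g x * h x = \sum_(k <- r) v^-1 * (A k * (g x * wave k 0 x) +
    B k * (g x * wave k (- (pi / 2)) x)).
  rewrite /h mulr_sumr; apply: eq_bigr => k _; ring.
have igh : tint (fun x => g x * h x).
  by apply: (eq_tint (fun x => esym (ghE x))); apply: tint_sum => k _; apply: tintZ.
have gh : torus_int (fun x => g x * h x) = v^-1 * S.
  rewrite (eq_torus_int ghE) torus_int_sum; last by move=> k _; apply: tintZ.
  rewrite mulr_sumr; apply: eq_bigr => k _; rewrite torus_intZ//.
  by rewrite torus_intD ?torus_intZ// ?expr2//; apply: tintZ.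
pose T k l x := A k * A l * (wave k 0 x * wave l 0 x) +
  A k * B l * (wave k 0 x * wave l (- (pi / 2)) x) +
  (B k * A l * (wave k (- (pi / 2)) x * wave l 0 x) +
  B k * B l * (wave k (- (pi / 2)) x * wave l (- (pi / 2)) x)).
have iT k l : tint (T k l).
  by do 2! apply: tintD; apply: tintZ; exact: tint_wave2.
have hhE x : h x ^+ 2 = \sum_(k <- r) \sum_(l <- r) (v^-1 * v^-1) * T k l x.
  rewrite expr2 /h big_distrlr/=; apply: eq_bigr => k _; apply: eq_bigr => l _.
  rewrite /T; ring.
have ihh : tint (fun x => h x ^+ 2).
  apply: (eq_tint (fun x => esym (hhE x))).
  by apply: tint_sum => k _; apply: tint_sum => l _; apply: tintZ.
have ATN k : A (- k) = A k.
  by apply: eq_torus_int => x; rewrite /wave freqN dotNl !addr0 cosN.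
have BTN k : B (- k) = - B k.
  rewrite -[RHS]mulN1r /B /coef -torus_intZ//; apply: eq_torus_int => x.
  rewrite /wave freqN dotNl !cosBpihalf sinN; ring.
have TE k l : torus_int (T k l) = v / 2 *
    ((if l == k then A k ^+ 2 + B k ^+ 2 else 0) +
     (if l == - k then A k ^+ 2 + B k ^+ 2 else 0)).
  pose m0 := Mode k 0 0 : mode; pose m1 := Mode k (- (pi / 2)) 0 : mode.
  pose n0 := Mode l 0 0 : mode; pose n1 := Mode l (- (pi / 2)) 0 : mode.
  have it m n : tint (fun x => wave (fr m) (ph m) x * wave (fr n) (ph n) x : R).
    exact: tint_wave2.
  rewrite /T !torus_intD ?torus_intZ//;
    try by [exact: it m0 n0|exact: it m0 n1|exact: it m1 n0|exact: it m1 n1];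
    try by do ?apply: tintD; apply: tintZ; exact: tint_wave2.
  rewrite (torus_int_wave2 m0 n0) (torus_int_wave2 m0 n1) (torus_int_wave2 m1 n0)
    (torus_int_wave2 m1 n1) /mean2 /mean_wave /m0 /m1 /n0 /n1 /=.
  rewrite addr_eq0 subr_eq0 ![k == _]eq_sym eqr_oppLR.
  have -> : - (pi / 2) - pi / 2 = - pi :> R by field.
  rewrite !(addr0, subr0, sub0r, opprK, add0r, addNr, cos0, cosN, cos_pihalf).
  rewrite cospi -/v.
  have [->|lk] := eqVneq l k; have [kN|kN] := eqVneq _ (- _).
  - have B0 : B k = 0.
      by have := BTN k; rewrite -kN; lra.
    rewrite B0; by field.
  - by field.
  - rewrite kN ATN BTN; by field.
  - by field.
have hh : torus_int (fun x => h x ^+ 2) <= v^-1 * S.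
  rewrite (eq_torus_int hhE) torus_int_sum; last first.
    by move=> k _; apply: tint_sum => l _; apply: tintZ.
  rewrite mulr_sumr big_seq [leRHS]big_seq; apply: ler_sum => k kr.
  rewrite torus_int_sum; last by move=> l _; apply: tintZ.
  under eq_bigr do rewrite torus_intZ// TE.
  rewrite -mulr_sumr -mulr_sumr big_split/= big_seq_pick//.
  have -> : v^-1 * v^-1 * (v / 2 * (A k ^+ 2 + B k ^+ 2 +
     \sum_(i <- r) (if i == - k then A k ^+ 2 + B k ^+ 2 else 0))) =
     v^-1 * ((A k ^+ 2 + B k ^+ 2 +
     \sum_(i <- r) (if i == - k then A k ^+ 2 + B k ^+ 2 else 0)) / 2).
    by field; rewrite gt_eqF.
  rewrite ler_pM2l ?invr_gt0// ler_pdivrMr// mulr_natr mulr2n lerD2l.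
  have [kr'|kr'] := boolP (- k \in r); first by rewrite big_seq_pick.
  rewrite big_seq big1 ?addr_ge0 ?sqr_ge0// => l lr.
  by case: eqP => // lk; rewrite -lk lr in kr'.
have : 0 <= torus_int (fun x => (g x - h x) ^+ 2).
  by apply: torus_int_ge0 => x; exact: sqr_ge0.
have -> : torus_int (fun x => (g x - h x) ^+ 2) =
   torus_int (fun x => g x ^+ 2) + ((-2) * torus_int (fun x => g x * h x) +
   torus_int (fun x => h x ^+ 2)).
  rewrite -torus_intZ// -!torus_intD//; last 2 first.
  - by apply: tintD => //; exact: tintZ.
  - exact: tintZ.
  by apply: eq_torus_int => x; ring.
rewrite gh => H; rewrite -ler_pdivrMl//; lra.
Qed.

End fourier_theory.

(** * Norms *)

Section norms.
Context {R : realType} {d : nat}.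
Local Notation E := 'rV[R]_d.
Local Notation F := 'rV[int]_d.
Local Notation mode := (@mode R d).
Local Notation mR := (measurableTypeR R).
Implicit Types (x y : E) (v w : E -> E) (U W : seq mode).

Lemma dot_CS x y : dot x y ^+ 2 <= dot x x * dot y y.
Proof.
have [y0|y0] := eqVneq (dot y y) 0.
  have -> : y = 0.
    apply/rowP => i; rewrite mxE; apply/eqP; move/eqP: y0.
    rewrite psumr_eq0 => [/allP/(_ i)|j _]; last by rewrite -expr2 sqr_ge0.
    by rewrite mem_index_enum mulf_eq0 orbb => /(_ isT).
  by rewrite !dot0r expr0n/= mulr0.
have yy : 0 < dot y y by rewrite lt_neqAle eq_sym y0 dot_ge0.
have := dot_ge0 (dot y y *: x - dot x y *: y).
rewrite !dotDl !dotDr !dotNl !dotNr !dotZl !dotZr (dotC y x) => H.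
rewrite -(ler_pM2l yy); nra.
Qed.

Lemma enorm_ge0 x : 0 <= enorm x.
Proof. exact: sqrtr_ge0. Qed.

Lemma enorm_sqr x : enorm x ^+ 2 = dot x x.
Proof. by rewrite sqr_sqrtr// dot_ge0. Qed.

Lemma enorm_le (x : E) (c : R) : 0 <= c -> dot x x <= c ^+ 2 -> enorm x <= c.
Proof. by move=> c0 h; rewrite -(@ler_pXn2r _ 2) ?nnegrE ?enorm_ge0// enorm_sqr. Qed.

Lemma enormZ (c : R) x : enorm (c *: x) = `|c| * enorm x.
Proof.
rewrite /enorm dotZl dotZr mulrA -expr2 sqrtrM ?sqr_ge0// sqrtr_sqr//.
Qed.

Lemma dot_le x y : `|dot x y| <= enorm x * enorm y.
Proof.
rewrite -(@ler_pXn2r _ 2)// ?nnegrE// ?mulr_ge0 ?enorm_ge0//.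
by rewrite real_normK ?num_real// exprMn !enorm_sqr dot_CS.
Qed.

Lemma enormD x y : enorm (x + y) <= enorm x + enorm y.
Proof.
rewrite -(@ler_pXn2r _ 2)// ?nnegrE ?enorm_ge0 ?addr_ge0 ?enorm_ge0//.
rewrite enorm_sqr !dotDl !dotDr (dotC y x) sqrrD !enorm_sqr.
have := ler_norm (dot x y); have := dot_le x y; lra.
Qed.

Lemma enorm0 : enorm (0 : E) = 0.
Proof. by rewrite /enorm dot0l sqrtr0. Qed.

Lemma enorm_sum (I : Type) (r : seq I) (G : I -> E) :
  enorm (\sum_(i <- r) G i) <= \sum_(i <- r) enorm (G i).
Proof.
elim: r => [|i r IH]; first by rewrite !big_nil enorm0.
by rewrite !big_cons (le_trans (enormD _ _))// lerD2l.
Qed.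

Lemma coord_le_enorm x i : `|x 0 i| <= enorm x.
Proof.
rewrite -dot_unit; apply: le_trans (dot_le _ _) _.
by rewrite [enorm (unit_vec i)]/enorm dot_unit mxE !eqxx sqrtr1 mulr1.
Qed.

Definition l1 U : R := \sum_(m <- U) enorm (amp m).

Lemma enorm_ev U x : enorm (ev U x) <= l1 U.
Proof.
apply: le_trans (enorm_sum _ _) _; apply: ler_sum => m _.
rewrite enormZ -[leRHS]mul1r ler_wpM2r ?enorm_ge0//; exact: wave_le1.
Qed.

Lemma l1_ge0 U : 0 <= l1 U.
Proof. by apply: sumr_ge0 => m _; exact: enorm_ge0. Qed.

Lemma continuous_enorm : continuous (enorm : E -> R).
Proof.
move=> x; apply: (@continuous_comp E R R (fun x => dot x x) Num.sqrt).
  apply: (@continuous_bigsum R R E _ _ (fun i (x : E) => x 0 i * x 0 i)) => i y.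
  by apply: (@cvgM R E (nbhs y)); exact: continuous_coord.
exact: sqrt_continuous.
Qed.

Definition fmeas v := tmeas (fun x => enorm (v x)).

Lemma fmeas_cont v : continuous v -> fmeas v.
Proof.
move=> cv; apply: tmeas_cont => x.
by apply: (@continuous_comp E E R v enorm); [exact: cv|exact: continuous_enorm].
Qed.

Lemma cube_gt0 : (0 < cube_measure d [set: d.-tuple mR])%E.
Proof. by have := vol_gt0 R d; rewrite -lte_fin -(cube_measureT d). Qed.

Lemma le_poweR (r : R) (a b : \bar R) : 0 <= r -> (0 <= a)%E -> (a <= b)%E ->
  (a `^ r <= b `^ r)%E.
Proof.
move=> r0 a0 ab; apply: gt0_ler_poweR => //.
  by rewrite in_itv/= a0 leey.
by rewrite in_itv/= leey (le_trans a0 ab).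
Qed.

Lemma Lnorm_realE (q : R) (f : d.-tuple mR -> R) :
  ('N[cube_measure d]_q%:E[EFin \o f] =
   (\int[cube_measure d]_x (`|f x| `^ q)%:E) `^ q^-1)%E.
Proof. by rewrite unlock. Qed.

Lemma measurable_powR_norm (q : R) (f : d.-tuple mR -> R) :
  measurable_fun setT f -> measurable_fun setT (fun z => (`|f z| `^ q)%:E).
Proof.
move=> mf; apply/measurable_EFinP.
apply: (@measurableT_comp _ _ _ _ _ _ (@powR R ^~ q)).
  exact: measurable_powR.
exact: measurableT_comp.
Qed.

Lemma tint_cst (a : R) : tint (fun _ : E => a).
Proof. by apply: (tint_bounded (C := `|a|)) => //; exact: measurable_cst. Qed.

Lemma Lnorm_le (q : \bar R) (f g : d.-tuple mR -> R) :
  measurable_fun setT f -> measurable_fun setT g -> (1 <= q)%E ->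
  (forall z, 0 <= f z <= g z) ->
  ('N[cube_measure d]_q[EFin \o f] <= 'N[cube_measure d]_q[EFin \o g])%E.
Proof.
move=> mf mg q1 fg; case: q q1 => [q| |]; last by [].
- rewrite lee_fin !Lnorm_realE => q1; have q0 : 0 < q := lt_le_trans ltr01 q1.
  apply: le_poweR; first by rewrite invr_ge0 ltW.
    by apply: integral_ge0 => x _; rewrite lee_fin powR_ge0.
  apply: ge0_le_integral => //.
  + exact: measurable_powR_norm.
  + exact: measurable_powR_norm.
  + move=> x _; rewrite lee_fin; have /andP[f0 fgx] := fg x.
    have g0 := le_trans f0 fgx.
    by rewrite !ger0_norm// ge0_ler_powR// ?nnegrE// ltW.
- move=> _; rewrite unlock cube_gt0; apply: le_ess_sup; apply: aeW => x /=.
  have /andP[f0 fgx] := fg x; have g0 := le_trans f0 fgx.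
  by rewrite lee_fin !ger0_norm.
Qed.

Lemma Lq_norm_triangle (q : \bar R) v w : fmeas v -> fmeas w ->
  fmeas (fun x => v x - w x) -> (1 <= q)%E ->
  (Lq_norm q v <= Lq_norm q w + Lq_norm q (fun x => (v x - w x)%R))%E.
Proof.
move=> mv mw mvw q1.
have := @eminkowski _ _ _ (cube_measure d) _ _ q mw mvw q1.
apply: le_trans; apply: Lnorm_le => //.
  exact: measurable_funD.
move=> x; rewrite enorm_ge0/=.
rewrite (le_trans _ (enormD _ _))//.
by rewrite addrC subrK.
Qed.

Lemma Lq_norm_ge0 (q : \bar R) v : (0 <= Lq_norm q v)%E.
Proof. exact: Lnorm_ge0. Qed.

(** The norm of the constant 1 in L^q of the cube. *)
Definition Kq (q : \bar R) : R := if q is q'%:E then vol R d `^ q'^-1 else 1.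

Lemma Lq_norm_bounded (q : \bar R) v (c : R) : fmeas v -> (1 <= q)%E ->
  (forall x, enorm (v x) <= c) -> (Lq_norm q v <= (Kq q * c)%:E)%E.
Proof.
move=> mv q1 vc.
have c0 : 0 <= c by rewrite (le_trans (enorm_ge0 _) (vc 0)).
apply: (@le_trans _ _ ('N[cube_measure d]_q[EFin \o cst c])%E).
  apply: Lnorm_le => // x; rewrite enorm_ge0; exact: vc.
case: q q1 => [q| |]; last by [].
- rewrite lee_fin Lnorm_realE => q1; have q0 : 0 < q := lt_le_trans ltr01 q1.
  have -> : (\int[cube_measure d]_x (`|cst c x| `^ q)%:E =
      (`|c| `^ q)%:E * cube_measure d [set: d.-tuple mR])%E by rewrite -integral_cst.
  rewrite (cube_measureT d).
  rewrite -EFinM poweR_EFin lee_fin powRM ?powR_ge0// ?exprn_ge0//; last first.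
    exact/ltW/pi2_gt0.
  by rewrite -powRrM mulfV ?gt_eqF// powRr1 ?normr_ge0// ger0_norm// mulrC.
- move=> _; rewrite unlock cube_gt0 mul1r; apply: (@ess_sup_inf.ess_sup_ler _ _ _ _ (fun=> `|c|)).
  by move=> x; rewrite lee_fin ger0_norm.
Qed.

Lemma Lq_norm_fin_num (q : \bar R) v (c : R) : fmeas v -> (1 <= q)%E ->
  (forall x, enorm (v x) <= c) -> Lq_norm q v \is a fin_num.
Proof.
move=> mv q1 vc; rewrite ge0_fin_numE ?Lq_norm_ge0//.
exact: le_lt_trans (Lq_norm_bounded mv q1 vc) (ltry _).
Qed.

(** Interpolation between L^2 and L^oo; below q = 2 the bound |v|^q <= 1 +
    |v|^2 does. *)
Lemma Lq_norm_interp (q : R) v (c S : R) : fmeas v -> 1 <= q ->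
  (forall x, enorm (v x) <= c) -> sqnorm2 v <= S ->
  tint (fun x => dot (v x) (v x)) ->
  (Lq_norm q%:E v <= ((if 2 <= q then c `^ (q - 2) * S else vol R d + S) `^ q^-1)%:E)%E.
Proof.
move=> mv q1 vc vS iv.
have q0 : 0 < q := lt_le_trans ltr01 q1.
have c0 : 0 <= c by rewrite (le_trans (enorm_ge0 _) (vc 0)).
have S0 : 0 <= S by apply: le_trans vS; apply: torus_int_ge0 => x; exact: dot_ge0.
rewrite /Lq_norm Lnorm_realE -poweR_EFin; apply: le_poweR.
- by rewrite invr_ge0 ltW.
- by apply: integral_ge0 => x _; rewrite lee_fin powR_ge0.
have iw (a b : R) : (\int[cube_measure d]_x (a + b * dot (v (pt x)) (v (pt x)))%:E =
   (a * vol R d + b * sqnorm2 v)%:E)%E.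
  have i1 : tint (fun x => a + b * dot (v x) (v x)).
    by apply: tintD; [exact: tint_cst|exact: tintZ].
  rewrite -[LHS]fineK; last exact: (integrable_fin_num measurableT i1).
  congr EFin; rewrite -[LHS]/(torus_int (fun x => a + b * dot (v x) (v x))).
  rewrite torus_intD ?torus_int_cst ?torus_intZ//; last exact: tintZ.
  exact: tint_cst.
have mdot : measurable_fun setT (fun x : d.-tuple mR => dot (v (pt x)) (v (pt x))).
  by apply/measurable_EFinP; exact: measurable_int iv.
have me : measurable_fun setT (fun x : d.-tuple mR => (`|enorm (v (pt x))| `^ q)%:E).
  exact: measurable_powR_norm.
case: ifPn => q2.
- apply: (@le_trans _ _ (\int[cube_measure d]_x
     (0 + c `^ (q - 2) * dot (v (pt x)) (v (pt x)))%:E)%E).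
    apply: ge0_le_integral => //.
    + apply/measurable_EFinP; apply: measurable_funD => //.
      exact: measurable_funM.
    + move=> x _; rewrite lee_fin add0r ger0_norm ?enorm_ge0//.
      set e := enorm _.
      have -> : e `^ q = e `^ (q - 2) * e `^ 2.
        by rewrite -powRD subrK// gt_eqF.
      rewrite -enorm_sqr -/e.
      rewrite powR_mulrn ?enorm_ge0// ler_wpM2r ?sqr_ge0//.
      by apply: ge0_ler_powR; rewrite ?subr_ge0 ?nnegrE ?enorm_ge0//; exact: vc.
  by rewrite iw mul0r add0r lee_fin ler_wpM2l// powR_ge0.
- apply: (@le_trans _ _ (\int[cube_measure d]_x
     (1 + 1 * dot (v (pt x)) (v (pt x)))%:E)%E).
    apply: ge0_le_integral => //.
    + apply/measurable_EFinP; apply: measurable_funD => //.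
      exact: measurable_funM.
    + move=> x _; rewrite lee_fin mul1r ger0_norm ?enorm_ge0// -enorm_sqr.
      have [e1|e1] := leP (enorm (v (pt x))) 1.
        rewrite (@le_trans _ _ 1) ?lerDl ?sqr_ge0//.
        rewrite -[leRHS](congr1 (@^~ q) (@powR1 R)).
        by apply: ge0_ler_powR; rewrite ?nnegrE ?enorm_ge0 ?ler01// ltW.
      rewrite -powR_mulrn ?enorm_ge0// (@le_trans _ _ (enorm (v (pt x)) `^ 2))//.
        by rewrite ler_powR ?ltW// ltNge.
      by rewrite lerDr.
  by rewrite iw mul1r mul1r lee_fin lerD2l.
Qed.

End norms.

(** * Smooth functions of time *)

Section smooth_functions.
Context {R : realType}.
Implicit Types a b : R -> R.

(** Smoothness in one variable through successive derivatives, a form that is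
    stable under products and compositions by induction. *)
Fixpoint Cn (n : nat) a : Prop :=
  if n is n'.+1 then exists2 a', (forall x : R, is_derive x 1 a (a' x)) & Cn n' a'
  else True.

Definition smooth1 a := forall n, Cn n a.

Lemma Cn_mono n a : Cn n.+1 a -> Cn n a.
Proof.
elim: n a => [//|n IH] a [a' da Ca]; exists a' => //; exact: IH.
Qed.

Lemma smooth1_derivable a (x : R) : smooth1 a -> derivable a x 1.
Proof. by move=> /(_ 1%N) [a' da _]; case: (da x). Qed.

Lemma smooth1_is_derive a (x : R) : smooth1 a -> is_derive x 1 a (derive1 a x).
Proof.
by move=> sa; rewrite derive1E; apply: derivableP; exact: smooth1_derivable.
Qed.

Lemma smooth1_continuous a : smooth1 a -> continuous a.
Proof.
move=> sa x; apply/differentiable_continuous/derivable1_diffP.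
exact: smooth1_derivable.
Qed.

Lemma smooth1_derive1 a : smooth1 a -> smooth1 (derive1 a).
Proof.
move=> sa n; have [a' da Ca] := sa n.+1.
suff -> : derive1 a = a' by [].
by apply/funext => x; rewrite derive1E; case: (da x).
Qed.

Lemma Cn_cst n (c : R) : Cn n (fun=> c).
Proof.
elim: n c => [//|n IH] c; exists (fun=> 0) => [x|]; last exact: IH.
exact: is_derive_cst.
Qed.

Lemma CnD n a b : Cn n a -> Cn n b -> Cn n (fun x => a x + b x).
Proof.
elim: n a b => [//|n IH] a b [a' da Ca] [b' db Cb].
by exists (fun x => a' x + b' x); [move=> x; exact: is_deriveD|exact: IH].
Qed.

Lemma CnM n a b : Cn n a -> Cn n b -> Cn n (fun x => a x * b x).
Proof.
elim: n a b => [//|n IH] a b Ca Cb; have := Ca; have := Cb.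
move=> [b' db Cb'] [a' da Ca'].
exists (fun x => a x * b' x + b x * a' x).
  by move=> x; exact: is_deriveM.
by apply: CnD; apply: IH => //; exact: Cn_mono.
Qed.

Lemma Cn_comp n a b : Cn n a -> Cn n b -> Cn n (fun x => a (b x)).
Proof.
elim: n a b => [//|n IH] a b Ca Cb; have := Ca; have := Cb.
move=> [b' db Cb'] [a' da Ca'].
exists (fun x => a' (b x) * b' x).
  by move=> x; exact: (is_derive1_comp (f := a) (g := b)).
by apply: CnM => //; apply: IH => //; exact: Cn_mono.
Qed.

Lemma Cn_id n : Cn n (@id R).
Proof.
case: n => [//|n]; exists (fun=> 1); last exact: Cn_cst.
by move=> x; exact: is_derive_id.
Qed.

Lemma smooth1_cst (c : R) : smooth1 (fun=> c).
Proof. by move=> n; exact: Cn_cst. Qed.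

Lemma smooth1D a b : smooth1 a -> smooth1 b -> smooth1 (fun x => a x + b x).
Proof. by move=> sa sb n; apply: CnD. Qed.

Lemma smooth1M a b : smooth1 a -> smooth1 b -> smooth1 (fun x => a x * b x).
Proof. by move=> sa sb n; apply: CnM. Qed.

Lemma smooth1_comp a b : smooth1 a -> smooth1 b -> smooth1 (fun x => a (b x)).
Proof. by move=> sa sb n; apply: Cn_comp. Qed.

Lemma smooth1Z (c : R) a : smooth1 a -> smooth1 (fun x => c * a x).
Proof. by move=> sa; apply: smooth1M => //; exact: smooth1_cst. Qed.

Lemma smooth1_affine (c p : R) : smooth1 (fun x => c * x + p).
Proof.
apply: smooth1D; last exact: smooth1_cst.
by apply: smooth1Z => n; exact: Cn_id.
Qed.

Lemma smooth1_cos_sin : smooth1 cos /\ smooth1 (sin : R -> R).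
Proof.
suff H n : Cn n (cos : R -> R) /\ Cn n (sin : R -> R) by split=> n; case: (H n).
elim: n => [//|n [IHc IHs]]; split.
  exists (fun x => -1 * sin x); last by apply: CnM => //; exact: Cn_cst.
  by move=> x; rewrite mulN1r; exact: is_derive_cos.
by exists cos => // x; exact: is_derive_sin.
Qed.

Lemma smooth1_cos : smooth1 cos. Proof. by case: smooth1_cos_sin. Qed.
Lemma smooth1_sin : smooth1 sin. Proof. by case: smooth1_cos_sin. Qed.

(** The functions t^(-j) exp (-1/t), extended by 0 to t <= 0: this family is
    stable under differentiation. *)
Definition flat (j : nat) (t : R) : R :=
  if 0 < t then t^-1 ^+ j * expR (- t^-1) else 0.

Lemma flat_ge0 j t : 0 <= flat j t.
Proof.
rewrite /flat; case: ifPn => // t0.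
by rewrite mulr_ge0 ?expR_ge0// exprn_ge0// invr_ge0 ltW.
Qed.

Lemma flat_le j (t : R) : 0 < t -> flat j t <= j.+1`!%:R * t.
Proof.
move=> t0; rewrite /flat t0 expRN ler_pdivrMr ?expR_gt0//.
have := @expR_ge1Dxn R t^-1 j; rewrite invr_ge0 (ltW t0) => /(_ isT) H.
have f0 : 0 < (j.+1)`!%:R :> R by rewrite ltr0n fact_gt0.
have {}H : t^-1 ^+ j.+1 / (j.+1)`!%:R <= expR t^-1.
  by apply: le_trans H; rewrite lerDr.
rewrite ler_pdivrMr// in H.
rewrite -mulrA mulrC mulrAC -(ler_pM2l (_ : 0 < t^-1)) ?invr_gt0//.
by rewrite -exprS !mulrA mulVf ?gt_eqF// mul1r mulrC.
Qed.

(** Only t = 0 needs care: there the difference quotient of [flat j] is [flat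
    j.+1], which is bounded by a multiple of the increment. *)
Lemma is_derive_flat j (t : R) :
  is_derive t 1 (flat j) (flat j.+2 t + - j%:R * flat j.+1 t).
Proof.
have [t0|t0|->] := ltrgtP t 0.
- have -> : flat j.+2 t + - j%:R * flat j.+1 t = 0.
    by rewrite /flat (lt_gtF t0) mulr0 addr0.
  apply: (near_eq_is_derive (f := fun=> 0)).
  near=> s; rewrite /flat ifF//; apply/negbTE; rewrite -leNgt.
  by near: s; exact: lt_le_nbhsl.
- have -> : flat j.+2 t + - j%:R * flat j.+1 t =
      t^-1 ^+ j * (expR (- t^-1) * t ^- 2) +
      expR (- t^-1) * (- j%:R * t^-1 ^+ j.+1).
    by rewrite /flat t0 -exprVn !exprS; ring.
  have N : \near t, (fun t : R => t^-1 ^+ j * expR (- t^-1)) t = flat j t.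
    near=> s; rewrite /flat ifT//.
    by near: s; exact: lt_nbhsr.
  apply: near_eq_is_derive N _.
  have tn0 : t != 0 by rewrite gt_eqF.
  have di : is_derive t 1 (fun t : R => t^-1) (- t ^- 2).
    have := @is_deriveV R id t 1 1 tn0 (is_derive_id _ _).
    by rewrite /GRing.scale/= mulr1.
  have dX i : is_derive t 1 (fun t : R => t^-1 ^+ i) (- i%:R * t^-1 ^+ i.+1).
    elim: i => [|i IH].
      by under eq_fun do rewrite expr0; rewrite oppr0 mul0r; exact: is_derive_cst.
    under eq_fun do rewrite exprS.
    have := is_deriveM di IH; congr is_derive.
    by rewrite /GRing.scale/= -exprVn !exprS -natr1; ring.
  have dE : is_derive t 1 (fun t : R => expR (- t^-1)) (expR (- t^-1) * t ^- 2).
    apply: (is_derive1_comp (f := expR) (g := fun t => - t^-1)).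
    rewrite -[X in is_derive _ _ _ X]opprK; exact: is_deriveN.
  exact: is_deriveM (dX j) dE.
- have -> : flat j.+2 0 + - j%:R * flat j.+1 0 = 0.
    by rewrite /flat ltxx mulr0 addr0.
  have C0 : (fun h : R => h^-1 *: ((flat j \o shift 0) (h *: 1) - flat j 0))
      @ 0^' --> (0 : R).
    apply/cvgrPdist_le => e e0; near=> h.
    rewrite sub0r normrN /=.
    have -> : h%:A + 0 = h :> R by rewrite addr0 /GRing.scale/= mulr1.
    have -> : flat j 0 = 0 by rewrite /flat ltxx.
    rewrite subr0.
    have [h0|h0] := ltP 0 h; last first.
      by rewrite /flat ltNge h0/= scaler0 normr0 ltW.
    have -> : h^-1 *: flat j h = flat j.+1 h.
      by rewrite /flat h0 exprS /GRing.scale/= mulrA.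
    rewrite ger0_norm ?flat_ge0// (le_trans (flat_le _ h0))//.
    rewrite mulrC -ler_pdivlMr ?ltr0n ?fact_gt0//.
    rewrite -(ger0_norm (ltW h0)); near: h.
    by apply: dnbhs0_le; rewrite divr_gt0// ltr0n fact_gt0.
  apply: DeriveDef; first by apply/cvg_ex; exists 0.
  exact: cvg_lim C0.
Unshelve. all: by end_near. Qed.

Lemma smooth1_flat j : smooth1 (flat j).
Proof.
move=> n; elim: n j => [//|n IH] j.
exists (fun t => flat j.+2 t + - j%:R * flat j.+1 t).
  by move=> t; exact: is_derive_flat.
by apply: CnD => //; apply: CnM => //; exact: Cn_cst.
Qed.

(** An angle that turns smoothly from 0 for t <= 0 to pi/2 for t >= 1; it is
    obtained by composing exp (-1/t) with itself. *)
Definition angle (t : R) : R :=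
  pi / 2 * (1 - expR 1 * flat 0 (1 - expR 1 * flat 0 t)).

Lemma smooth1_angle : smooth1 angle.
Proof.
have sub1 b : smooth1 b -> smooth1 (fun t => 1 - expR 1 * b t).
  move=> sb; have -> : (fun t => 1 - expR 1 * b t) = (fun t => 1 + - expR 1 * b t).
    by apply/funext => t; rewrite mulNr.
  by apply: smooth1D; [exact: smooth1_cst|exact: smooth1Z].
apply: smooth1Z; apply: (sub1 (fun t => flat 0 (1 - expR 1 * flat 0 t))).
apply: smooth1_comp; first exact: smooth1_flat.
exact: (sub1 _ (smooth1_flat 0)).
Qed.

Lemma angle_le0 t : t <= 0 -> angle t = 0.
Proof.
move=> t0; rewrite /angle /flat (ltNge 0 t) t0/= mulr0 subr0 ltr01.
by rewrite invr1 expr0 mul1r -expRD subrr expR0 subrr mulr0.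
Qed.

Lemma angle_ge1 t : 1 <= t -> angle t = pi / 2.
Proof.
move=> t1; rewrite /angle.
have t0 : 0 < t := lt_le_trans ltr01 t1.
rewrite {1}/flat ifF ?mulr0 ?subr0 ?mulr1//.
apply/negbTE; rewrite -leNgt subr_le0 /flat t0 expr0 mul1r -expRD.
by rewrite -[leLHS](@expR0 R) ler_expR subr_ge0 invf_le1.
Qed.

Lemma derive1_locally_cst (a : R -> R) (t c : R) :
  (\near t, a t = c) -> derive1 a t = 0.
Proof.
move=> ac; rewrite derive1E.
have -> : 'D_1 a t = 'D_1 (fun _ : R => c) t by exact: near_eq_derive.
exact: derive_cst.
Qed.

Lemma angle'_out t : t < 0 \/ 1 < t -> derive1 angle t = 0.
Proof.
case=> tt.
  apply: (@derive1_locally_cst _ _ 0); near=> s; apply: angle_le0.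
  by near: s; exact: lt_le_nbhsl.
apply: (@derive1_locally_cst _ _ (pi / 2)); near=> s; apply: angle_ge1.
by near: s; exact: lt_le_nbhsr.
Unshelve. all: by end_near. Qed.

Lemma angle''_out t : t < 0 \/ 1 < t -> derive1 (derive1 angle) t = 0.
Proof.
move=> tt; apply: (@derive1_locally_cst _ _ 0).
case: tt => tt; near=> s; apply: angle'_out; [left|right].
  by near: s; exact: lt_nbhsl.
by near: s; exact: lt_nbhsr.
Unshelve. all: by end_near. Qed.

Lemma smooth1_supp_bounded a : smooth1 a -> (forall t, t < 0 \/ 1 < t -> a t = 0) ->
  exists2 C : R, 0 <= C & forall t, `|a t| <= C.
Proof.
move=> sa a0; have ca := smooth1_continuous sa.
have cN : {within `[0, 1], continuous (fun t => `|a t|)}.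
  apply: continuous_subspaceT => t.
  by apply: (@continuous_comp R R R a (@Num.norm R R)); [exact: ca|exact: norm_continuous].
have [c _ Hc] := EVT_max ler01 cN.
exists `|a c| => // t; have [t0|t0] := ltP t 0; first by rewrite a0 ?normr0//; left.
have [t1|t1] := ltP 1 t; first by rewrite a0 ?normr0//; right.
by apply: Hc; rewrite in_itv/= t0.
Qed.

End smooth_functions.

(** * Trigonometric fields with moving amplitudes *)

Section time_fields.
Context {R : realType} {d : nat}.
Local Notation E := 'rV[R]_d.
Local Notation F := 'rV[int]_d.
Local Notation mode := (@mode R d).
Implicit Types (x y : E) (t s : R).

(** Amplitudes carry their regularity, so that fields built from them are
    smooth without side conditions. *)
Record amplitude := Amplitude { aval :> R -> R; aP : smooth1 aval }.
Definition amp_deriv (a : amplitude) := Amplitude (smooth1_derive1 (aP a)).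
Definition amp_mul (a b : amplitude) := Amplitude (smooth1M (aP a) (aP b)).
Definition amp_scale (c : R) (a : amplitude) := Amplitude (smooth1Z c (aP a)).

Definition tfield := seq (amplitude * mode).
Implicit Types l : tfield.

Definition freeze t l : seq mode := [seq scale_mode (aval z.1 t) z.2 | z : amplitude * mode <- l].
Definition tev l t x : E := ev (freeze t l) x.
Definition tderiv l : tfield := [seq (amp_deriv z.1, z.2) | z : amplitude * mode <- l].
Definition tmap (g : mode -> mode) l : tfield := [seq (z.1, g z.2) | z : amplitude * mode <- l].
Definition tscale (a : amplitude) (U : seq mode) : tfield := [seq (a, m) | m <- U].
Definition tconv l l' : tfield :=
  flatten [seq [seq (amp_mul z.1 w.1, m) | m <- conv2 z.2 w.2] | z : amplitude * mode <- l, w : amplitude * mode <- l'].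

Lemma freeze_cat t l l' : freeze t (l ++ l') = freeze t l ++ freeze t l'.
Proof. exact: map_cat. Qed.

Lemma freeze_tconv t l l' : freeze t (tconv l l') = conv (freeze t l) (freeze t l').
Proof.
rewrite /freeze /tconv /conv map_flatten map_allpairs allpairs_mapl allpairs_mapr.
congr flatten; apply: eq_allpairs => z w.
rewrite /= /scale_mode /conv2 /=; congr [:: Mode _ _ _; Mode _ _ _];
  by rewrite !scalerA dotZl; congr (_ *: _); ring.
Qed.

Lemma tevE l t x : tev l t x =
  \sum_(z <- l) (wave (fr z.2) (ph z.2) x * aval z.1 t) *: amp z.2.
Proof. by rewrite /tev /ev big_map; apply: eq_bigr => z _; rewrite scalerA. Qed.

Lemma is_derive_scal (V W : normedModType R) (c : V -> R) (w : W) (x v : V) (dc : R) :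
  is_derive x v c dc -> is_derive x v (fun h => c h *: w) (dc *: w).
Proof.
move=> [dcx vc].
have C0 : (fun h : R => h^-1 *: (((fun h => c h *: w) \o shift x) (h *: v) - c x *: w))
    @ 0^' --> dc *: w.
  under eq_fun => h do rewrite /= -scalerBl scalerA.
  apply: cvgZr_tmp; rewrite -vc; exact: dcx.
apply: DeriveDef; first by apply/cvg_ex; exists (dc *: w).
exact: cvg_lim C0.
Qed.

(** The derivative in a space-time direction [v] stays within the class of
    fields; hence all iterated derivatives exist and are continuous. *)
Definition tline (v : R^o * E) l : tfield :=
  [seq (amp_scale v.1 (amp_deriv z.1), z.2) | z : amplitude * mode <- l] ++ tmap (deriv_mode v.2) l.

Lemma is_derive_tev l (z v : R^o * E) :
  is_derive z v (fun z : R^o * E => tev l z.1 z.2) (tev (tline v l) z.1 z.2).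
Proof.
have -> : (fun z : R^o * E => tev l z.1 z.2) = (fun z : R^o * E =>
   \sum_(w <- l) (wave (fr w.2) (ph w.2) z.2 * aval w.1 z.1) *: amp w.2).
  by apply/funext => z'; rewrite tevE.
have -> : tev (tline v l) z.1 z.2 = \sum_(w <- l)
   (wave (fr w.2) (ph w.2) z.2 * (v.1 * derive1 (aval w.1) z.1) +
    aval w.1 z.1 * (dot (freq (fr w.2)) v.2 * wave (fr w.2) (ph w.2 + pi / 2) z.2))
   *: amp w.2.
  rewrite tevE big_cat !big_map /= -big_split; apply: eq_bigr => w _ /=.
  by rewrite scalerA -scalerDl; congr (_ *: _); ring.
apply: is_derive_bigsum => w; apply: is_derive_scal; apply: is_derive_line.
pose k := fr w.2; pose p := ph w.2.
have d1 : is_derive (0 : R) 1 (fun h : R => wave k p (h *: v.2 + z.2))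
    (dot (freq k) v.2 * wave k (p + pi / 2) z.2).
  have := @is_derive_cos_affine R (dot (freq k) v.2) (dot (freq k) z.2 + p) 0.
  rewrite mulr0 add0r [wave k (p + _) _]/wave addrA cosDpihalf mulrN.
  congr is_derive; apply/funext => h; rewrite /wave dotDr dotZr; congr cos; ring.
have d2 : is_derive (0 : R) 1 (fun h : R => w.1 (h * v.1 + z.1)) (v.1 * derive1 (aval w.1) z.1).
  have := @is_derive1_comp R w.1 (fun h => v.1 * h + z.1) 0 (derive1 (aval w.1) z.1) v.1.
  rewrite mulr0 add0r => H; rewrite mulrC.
  have -> : (fun h : R => w.1 (h * v.1 + z.1)) = w.1 \o (fun h => v.1 * h + z.1).
    by apply/funext => h /=; rewrite mulrC.
  apply: H; first exact: (smooth1_is_derive _ (aP w.1)).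
  have D : is_derive (0 : R) 1 (( (v.1 : R) \*: @id R) + cst (z.1 : R)) (v.1 *: 1 + 0).
    exact: is_deriveD.
  by move: D; rewrite /GRing.scale/= mulr1 addr0.
have := is_deriveM d1 d2.
by rewrite scale0r !mul0r !add0r.
Qed.

Lemma continuous_tev l : continuous (fun z : R^o * E => tev l z.1 z.2).
Proof.
have -> : (fun z : R^o * E => tev l z.1 z.2) = (fun z : R^o * E =>
   \sum_(w <- l) (wave (fr w.2) (ph w.2) z.2 * aval w.1 z.1) *: amp w.2).
  by apply/funext => z'; rewrite tevE.
apply: continuous_bigsum => w z; apply: cvgZr_tmp.
apply: (@cvgM R (R^o * E)%type (nbhs z)).
  apply: (@continuous_comp (R^o * E)%type E R snd (wave (fr w.2) (ph w.2))).
    exact: cvg_snd.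
  exact: continuous_wave.
apply: (@continuous_comp (R^o * E)%type R R fst w.1).
  exact: cvg_fst.
exact/smooth1_continuous/aP.
Qed.

Lemma iter_derive_tev (O : set (R^o * E)) (G : R^o * E -> E) l : open O ->
  (forall z, O z -> G z = tev l z.1 z.2) ->
  forall vs z, O z -> iter_derive vs G z = tev (foldr tline l vs) z.1 z.2.
Proof.
move=> oO GE; elim=> [|v vs IH] z Oz /=; first exact: GE.
have N : \near z, (fun z : R^o * E => tev (foldr tline l vs) z.1 z.2) z =
    iter_derive vs G z.
  near=> z'; rewrite IH//; near: z'; exact: open_nbhs_nbhs.
have [_ <-] := is_derive_tev (foldr tline l vs) z v.
by apply: esym; apply: near_eq_derive.
Unshelve. all: by end_near. Qed.

Lemma continuous_at_near_eq (V W : normedModType R) (f g : V -> W) (z : V) :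
  (\near z, f z = g z) -> {for z, continuous f} -> {for z, continuous g}.
Proof.
move=> N cf; have fz := nbhs_singleton N.
move: cf; rewrite /prop_for /continuous_at -fz; apply: cvg_trans.
exact: near_eq_cvg.
Qed.

Lemma smooth_on_tev (O : set (R^o * E)) (G : R^o * E -> E) l : open O ->
  (forall z, O z -> G z = tev l z.1 z.2) -> smooth_on O G.
Proof.
move=> oO GE s z Oz.
have N : \near z, (fun z : R^o * E => tev (foldr tline l s) z.1 z.2) z =
    iter_derive s G z.
  near=> z'; rewrite (iter_derive_tev oO GE)//; near: z'; exact: open_nbhs_nbhs.
split=> [v|].
  have [D _] := is_derive_tev (foldr tline l s) z v.
  exact: near_eq_derivable N D.
have C : {for z, continuous (fun z : R^o * E => tev (foldr tline l s) z.1 z.2)}.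
  exact: continuous_tev.
exact: continuous_at_near_eq N C.
Unshelve. all: by end_near. Qed.

Lemma derive1_tev l t x i : is_derive t 1 (fun s => tev l s x 0 i) (tev (tderiv l) t x 0 i).
Proof.
have -> : (fun s => tev l s x 0 i) = (fun s =>
   \sum_(z <- l) aval z.1 s * (wave (fr z.2) (ph z.2) x * amp z.2 0 i)).
  apply/funext => s; rewrite tevE summxE; apply: eq_bigr => z _; rewrite mxE; ring.
have -> : tev (tderiv l) t x 0 i =
   \sum_(z <- l) derive1 (aval z.1) t * (wave (fr z.2) (ph z.2) x * amp z.2 0 i).
  rewrite tevE summxE big_map; apply: eq_bigr => z _; rewrite mxE /=; ring.
apply: is_derive_bigsum => z; apply: (@is_derive_scal R R).
exact: (smooth1_is_derive _ (aP z.1)).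
Qed.

Lemma torus_fun_tev l t : torus_fun (tev l t).
Proof. exact: torus_fun_ev. Qed.

(** With this force and zero pressure a divergence-free field solves the
    equations. *)
Definition force l : tfield := tderiv l ++ tmap (@lap_mode R d) l ++ tconv l l.

Definition tdiv_free l := div_free [seq z.2 | z : amplitude * mode <- l].

Lemma div_free_freeze t l : tdiv_free l -> div_free (freeze t l).
Proof.
elim: l => [//|z l IH] dl m; rewrite inE => /orP[/eqP ->|ml].
  by rewrite /= dotZl dl ?mulr0// inE eqxx.
by apply: IH => // n nl; apply: dl; rewrite inE nl orbT.
Qed.

(** The field [u] is only known near the time [t], which is what matching two
    consecutive stages requires. *)
Lemma force_NSE (u : R -> E -> E) l t x i : tdiv_free l ->
  (\near t, u t = tev l t) ->
  derive1 (fun s => coord_fun (u s) i x) t - laplacian (coord_fun (u t) i) x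
  + \sum_j partial j (fun y => coord_fun (u t) i y * coord_fun (u t) j y) x
  = tev (force l) t x 0 i.
Proof.
move=> dl N.
have -> : u t = tev l t by apply: (nbhs_singleton N).
have -> : derive1 (fun s => coord_fun (u s) i x) t = tev (tderiv l) t x 0 i.
  have [_ <-] := derive1_tev l t x i.
  rewrite derive1E; apply: near_eq_derive.
  by apply: filterS N => s ->.
rewrite laplacian_ev opprK div_tensor_ev; last exact: div_free_freeze.
rewrite /force /tev !freeze_cat !ev_cat !mxE freeze_tconv addrA; congr (_ + _ + _).
rewrite /freeze -!map_comp; congr (ev _ _ _ _); apply: eq_map => z /=.
by rewrite /lap_mode /scale_mode /=; congr Mode; rewrite !scalerA mulrC.
Qed.

Lemma smooth1_sum (I : Type) (r : seq I) (G : I -> R -> R) :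
  (forall i, smooth1 (G i)) -> smooth1 (fun t => \sum_(i <- r) G i t).
Proof.
move=> sG; elim: r => [|i r IH].
  by under eq_fun do rewrite big_nil; exact: smooth1_cst.
by under eq_fun do rewrite big_cons; exact: smooth1D.
Qed.

Lemma smooth1_pairing l l' : smooth1 (fun t => pairing (freeze t l) (freeze t l')).
Proof.
have -> : (fun t => pairing (freeze t l) (freeze t l')) = (fun t =>
   \sum_(z <- l) \sum_(w <- l') (dot (amp z.2) (amp w.2) * mean2 z.2 w.2) * (aval z.1 t * aval w.1 t)).
  apply/funext => t; rewrite /pairing big_map; apply: eq_bigr => z _.
  by rewrite big_map; apply: eq_bigr => w _; rewrite /= dotZl dotZr /mean2; ring.
apply: smooth1_sum => z; apply: smooth1_sum => w; apply: smooth1Z.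
by apply: smooth1M; exact: aP.
Qed.

Lemma mean2C (m n : mode) : mean2 m n = mean2 n m.
Proof.
rewrite /mean2 -(mean_waveN (fr m - fr n)) !opprB.
by rewrite (addrC (fr m)) (addrC (ph m)).
Qed.

Lemma is_derive_pairing l t :
  is_derive t 1 (fun t => pairing (freeze t l) (freeze t l))
    (2 * pairing (freeze t l) (freeze t (tderiv l))).
Proof.
have -> : (fun t => pairing (freeze t l) (freeze t l)) = (fun t =>
   \sum_(z <- l) \sum_(w <- l) (aval z.1 t * aval w.1 t) * (dot (amp z.2) (amp w.2) * mean2 z.2 w.2)).
  apply/funext => s; rewrite /pairing big_map; apply: eq_bigr => z _.
  by rewrite big_map; apply: eq_bigr => w _; rewrite /= dotZl dotZr /mean2; ring.
have -> : 2 * pairing (freeze t l) (freeze t (tderiv l)) =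
   \sum_(z <- l) \sum_(w <- l) (aval z.1 t * derive1 (aval w.1) t + aval w.1 t * derive1 (aval z.1) t) *
      (dot (amp z.2) (amp w.2) * mean2 z.2 w.2).
  have -> : pairing (freeze t l) (freeze t (tderiv l)) =
     \sum_(z <- l) \sum_(w <- l) (aval z.1 t * derive1 (aval w.1) t) *
      (dot (amp z.2) (amp w.2) * mean2 z.2 w.2).
    rewrite /pairing big_map; apply: eq_bigr => z _.
    rewrite !big_map; apply: eq_bigr => w _ /=; rewrite dotZl dotZr /mean2 /=; ring.
  rewrite mulr_natl mulr2n {2}exchange_big -big_split; apply: eq_bigr => z _ /=.
  rewrite -big_split; apply: eq_bigr => w _ /=.
  rewrite (dotC (amp w.2)) mean2C; ring.
apply: is_derive_bigsum => z; apply: is_derive_bigsum => w.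
apply: (@is_derive_scal R R); apply: is_deriveM;
  exact: (smooth1_is_derive _ (aP _)).
Qed.

End time_fields.

(** * Smooth fields on the torus *)

Section torus_functions.
Context {R : realType} {d : nat}.
Local Notation E := 'rV[R]_d.
Local Notation F := 'rV[int]_d.
Local Notation mode := (@mode R d).
Implicit Types (g : E -> R) (phi : E -> E).

Lemma torus_fun_int (X : Type) (g : E -> X) (z : int) x i : torus_fun g ->
  g (x + (z%:~R * (2 * pi)) *: unit_vec i) = g x.
Proof.
move=> tg.
have P (n : nat) y : g (y + (n%:R * (2 * pi)) *: unit_vec i) = g y.
  elim: n y => [|n IH] y; first by rewrite mul0r scale0r addr0.
  by rewrite -natr1 mulrDl mul1r scalerDl addrA tg IH.
case: z => n; first exact: P.
have -> : (Negz n)%:~R = - n.+1%:R :> R by rewrite NegzE mulrNz.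
by rewrite mulNr scaleNr -[LHS](P n.+1) subrK.
Qed.

Lemma torus_fun_lattice (X : Type) (g : E -> X) (z : 'I_d -> int) x : torus_fun g ->
  g (x + \sum_i ((z i)%:~R * (2 * pi)) *: unit_vec i) = g x.
Proof.
move=> tg; elim: (index_enum _) x => [|i r IH] x; first by rewrite big_nil addr0.
by rewrite big_cons addrA IH torus_fun_int.
Qed.

(** Integer multiples of the periods move a point into the period cube, which
    is compact. *)
Lemma torus_bounded g : continuous g -> torus_fun g -> exists C : R, forall x, `|g x| <= C.
Proof.
move=> cg tg.
pose K : set E := [set v | forall i : 'I_d, `[0, 2 * pi]%classic (v ord0 i)].
have cK : compact K := @rV_compact R d (fun=> `[0, 2 * pi]%classic) (fun=> @segment_compact R _ _).
have cgK : compact (g @` K).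
  by apply: continuous_compact => //; exact: continuous_subspaceT.
have [M [Mr hM]] := compact_bounded cgK.
exists (M + 1) => x.
pose z i := - Num.floor (x 0 i / (2 * pi)).
rewrite -(torus_fun_lattice z x tg); apply: (hM (M + 1)); first by rewrite ltrDl.
eexists; last reflexivity.
move=> i /=; have p0 := @pi2_gt0 R.
have -> : (x + \sum_i ((z i)%:~R * (2 * pi)) *: unit_vec i) 0 i = x 0 i + (z i)%:~R * (2 * pi).
  rewrite mxE summxE (bigD1 i)//= big1 ?addr0 => [|j ji]; rewrite !mxE eqxx/=.
    by rewrite eqxx mulr1.
  by rewrite eq_sym (negbTE ji) mulr0.
have f1 := Num.Theory.floor_le (x 0 i / (2 * pi)).
have f2 := Num.Theory.floorD1_gt (x 0 i / (2 * pi)).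
rewrite ler_pdivlMr// in f1; rewrite ltr_pdivrMr// intrD in f2.
by rewrite in_itv/= /z mulrNz mulNr; apply/andP; split; lra.
Qed.

Lemma torus_fun_derive phi v : torus_fun phi -> torus_fun ('D_v phi).
Proof.
move=> tphi x i; rewrite /derive.
set A := (A in lim (A @ _)); set B := (B in _ = lim (B @ _)).
suff -> : A = B by [].
by apply/funext => h; rewrite /A /B /= addrA !tphi.
Qed.

Lemma test_field_derive phi v : test_field phi -> test_field ('D_v phi).
Proof.
move=> [tphi sphi]; split; first exact: torus_fun_derive.
move=> s z _; have := sphi (rcons s v) z I.
by have -> : iter_derive (rcons s v) phi = iter_derive s ('D_v phi) by elim: s => //= w s ->.
Qed.

Lemma test_field_continuous phi : test_field phi -> continuous phi.
Proof. by move=> [_ sphi] x; have [_] := sphi [::] x I. Qed.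

Lemma test_field_coord_continuous phi i : test_field phi -> continuous (coord_fun phi i).
Proof.
move=> hphi x; apply: (@continuous_comp E E R phi (fun y => y 0 i)).
  exact: test_field_continuous.
exact: continuous_coord.
Qed.

Lemma test_field_bounded phi : test_field phi -> exists C : R, forall x i, `|phi x 0 i| <= C.
Proof.
move=> hphi; have [C hC] := @torus_bounded (fun x => enorm (phi x))
  (fun x => @continuous_comp E E R phi enorm x (test_field_continuous hphi (x := x)) (@continuous_enorm R d _))
  (fun x i => congr1 enorm (hphi.1 x i)).
exists C => x i; apply: le_trans (hC x); rewrite (ger0_norm (enorm_ge0 _)).
exact: coord_le_enorm.
Qed.

Lemma test_field_tint phi i : test_field phi -> tint (coord_fun phi i).
Proof.
move=> hphi; have [C hC] := test_field_bounded hphi.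
have m : tmeas (coord_fun phi i) := tmeas_cont (@test_field_coord_continuous phi i hphi).
exact: (tint_bounded m (fun x => hC x i)).
Qed.

Lemma is_derive_test_line phi i j x (s : R) : test_field phi ->
  is_derive s 1 (fun s : R => phi (x + s *: unit_vec j) 0 i)
    ('D_(unit_vec j) phi (x + s *: unit_vec j) 0 i).
Proof.
move=> [_ sphi]; set y := x + s *: unit_vec j.
have dy : derivable phi y (unit_vec j) by have [H _] := sphi [::] y I; exact: H.
have D0 : is_derive (0 : R) 1 (fun h : R => phi (h *: unit_vec j + y) 0 i)
    ('D_(unit_vec j) phi y 0 i).
  have /derivable_mxP/(_ 0 i) dc := dy.
  have dc0 : derivable (fun h : R => phi (h *: unit_vec j + y) 0 i) 0 1 :=
    (derivable1P (fun x : E => phi x 0 i) y (unit_vec j)).1 dc.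
  apply: DeriveDef; first exact: dc0.
  rewrite (derive_mx dy) mxE /derive.
  set A := (A in lim (A @ _)); set B := (B in _ = lim (B @ _)).
  suff -> : A = B by [].
  apply/funext => h; rewrite /A /B /=.
  by have -> : h%:A + 0 = h :> R; [rewrite addr0 /GRing.scale/= mulr1|rewrite scale0r add0r].
have sh : is_derive s 1 (fun r : R => r - s) 1.
  have : is_derive s 1 (@id R - cst s) (1 - 0) by exact: is_deriveB.
  by rewrite subr0.
have := @is_derive1_comp R (fun h : R => phi (h *: unit_vec j + y) 0 i) (fun r => r - s) s
  ('D_(unit_vec j) phi y 0 i) 1.
rewrite subrr mulr1 => /(_ D0 sh); congr is_derive; apply/funext => r /=.
by rewrite /y addrCA -scalerDl subrK.
Qed.

(** Integration by parts; the quarter turn of the phase turns the derivative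
    of a wave into a wave. *)
Lemma coef_derive phi i j (k : F) p : test_field phi ->
  (k 0 j)%:~R * coef (coord_fun phi i) k p =
  - coef (coord_fun ('D_(unit_vec j) phi) i) k (p - pi / 2).
Proof.
move=> hphi; have hd := test_field_derive (unit_vec j) hphi.
have [C hC] := test_field_bounded hphi; have [C' hC'] := test_field_bounded hd.
pose w := wave k (p - pi / 2) : E -> R; pose w' := wave k p : E -> R.
pose G' x := phi x 0 i * ((k 0 j)%:~R * w' x) + w x * 'D_(unit_vec j) phi x 0 i.
have cw q : continuous (wave k q : E -> R) by exact: continuous_wave.
have Z : torus_int G' = 0.
  apply: (@torus_int_deriv0 R d (fun x => phi x 0 i * w x) G' j (C * (`|(k 0 j)%:~R| * 1) + 1 * C')).
  - move=> x; apply: (@cvgD R R E (nbhs x)); apply: (@cvgM R E (nbhs x)).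
    + exact: (@test_field_coord_continuous phi i hphi).
    + by apply: (@cvgM R E (nbhs x)); [exact: cvg_cst|exact: cw].
    + exact: cw.
    + exact: (@test_field_coord_continuous _ i hd).
  - move=> x; apply: le_trans (ler_normD _ _) _; rewrite !normrM.
    have W q : `|wave k q x| <= 1 :> R by exact: wave_le1.
    apply: lerD; apply: ler_pM => //; last exact: W.
    by apply: ler_wpM2l => //; exact: W.
  - by move=> x r; rewrite hphi.1 /w torus_fun_wave.
  - move=> x s; have d1 := is_derive_test_line i j x s hphi.
    have d2 := is_derive_wave k (p - pi / 2) j x s; rewrite subrK in d2.
    exact: is_deriveM d1 d2.
have t1 := test_field_tint i hphi; have t2 := test_field_tint i hd.
apply/eqP; rewrite -addr_eq0 -[X in _ == X]Z /coef -torus_intZ; last exact: tint_mulwave.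
rewrite -torus_intD; [|by apply: tintZ; exact: tint_mulwave|exact: tint_mulwave].
by apply/eqP/eq_torus_int => x; rewrite /G' /w /w' /coord_fun; ring.
Qed.

Lemma coef_le (g : E -> R) (C : R) k p : tint g -> (forall x, `|g x| <= C) ->
  `|coef g k p| <= vol R d * C.
Proof.
move=> tg hC; apply: le_trans (le_norm_torus_int (tint_mulwave k p tg)) _.
rewrite mulrC -torus_int_cst; apply: torus_int_le.
- exact/tint_norm/tint_mulwave.
- exact: tint_cst.
by move=> x; rewrite normrM -[leRHS]mulr1; apply: ler_pM => //; exact: wave_le1.
Qed.

(** Each integration by parts trades a factor [k 0 j] for a derivative of the
    field, which is bounded again. *)
Lemma coef_decay phi j n : test_field phi ->
  exists C : R, 0 <= C /\ forall i (k : F) p, `|(k 0 j)%:~R| ^+ n * `|coef (coord_fun phi i) k p| <= C.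
Proof.
elim: n phi => [|n IH] phi hphi.
  have [C hC] := test_field_bounded hphi.
  exists (vol R d * `|C|); split; first by rewrite mulr_ge0// ltW// vol_gt0.
  move=> i k p; rewrite mul1r; apply: coef_le; first exact: test_field_tint.
  by move=> x; apply: le_trans (hC x i) (ler_norm _).
have [C [C0 hC]] := IH _ (test_field_derive (unit_vec j) hphi).
exists C; split=> // i k p; rewrite exprSr -mulrA -normrM coef_derive// normrN.
exact: hC.
Qed.

Lemma coef_decay_max phi n : test_field phi ->
  exists C : R, 0 <= C /\ forall i j (k : F) p, `|(k 0 j)%:~R| ^+ n * `|coef (coord_fun phi i) k p| <= C.
Proof.
move=> hphi; have /choice[c hc] := fun j => coef_decay j n hphi.
exists (\sum_j c j); split; first by apply: sumr_ge0 => j _; have [] := hc j.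
move=> i j k p; have [_ h] := hc j; apply: le_trans (h i k p) _.
by rewrite (bigD1 j)//= lerDl; apply: sumr_ge0 => l _; have [] := hc l.
Qed.

Lemma inner_ev_coef (W : seq mode) phi : (forall i, tint (coord_fun phi i)) ->
  inner (ev W) phi = \sum_(m <- W) \sum_i amp m 0 i * coef (coord_fun phi i) (fr m) (ph m).
Proof.
move=> tphi; have tw i k p : tint (fun x => coord_fun phi i x * wave k p x) by exact: tint_mulwave.
rewrite /inner (eq_torus_int (h := fun x => \sum_(m <- W) \sum_i
   amp m 0 i * (coord_fun phi i x * wave (fr m) (ph m) x))).
  rewrite torus_int_sum => [|m _]; last by apply: tint_sum => i _; exact: tintZ.
  apply: eq_bigr => m _; rewrite torus_int_sum => [|i _]; last exact: tintZ.
  by apply: eq_bigr => i _; rewrite torus_intZ.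
move=> x; rewrite exchange_big /=; apply: eq_bigr => i _.
rewrite evE mulr_suml; apply: eq_bigr => m _; rewrite /coord_fun; ring.
Qed.

Lemma tint_dot_test (W : seq mode) phi : test_field phi -> tint (fun x => dot (ev W x) (phi x)).
Proof.
move=> hphi; apply: (eq_tint (g := fun x => \sum_i \sum_(m <- W)
   amp m 0 i * (coord_fun phi i x * wave (fr m) (ph m) x))).
  move=> x; apply: eq_bigr => i _; rewrite evE mulr_suml; apply: eq_bigr => m _.
  by rewrite /coord_fun; ring.
apply: tint_sum => i _; apply: tint_sum => m _; apply: tintZ; apply: tint_mulwave.
exact: test_field_tint.
Qed.

(** The uniform norm of the test field, a seminorm of order 0, suffices. *)
Lemma torus_distribution_ev (W : seq mode) : torus_distribution (inner (ev W)).
Proof.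
split=> [a phi psi h1 h2|].
  rewrite /inner -torus_intZ; last exact: tint_dot_test.
  rewrite -torus_intD; [|by apply: tintZ; exact: tint_dot_test|exact: tint_dot_test].
  by apply: eq_torus_int => x; rewrite dotDr dotZr.
exists (l1 W * vol R d), 0 => phi M hphi hM.
apply: le_trans (le_norm_torus_int (tint_dot_test W hphi)) _.
have -> : l1 W * vol R d * M = torus_int (fun _ : E => l1 W * M) by rewrite torus_int_cst /vol; ring.
apply: torus_int_le; [exact/tint_norm/tint_dot_test|exact: tint_cst|] => x.
apply: le_trans (dot_le _ _) _; apply: ler_pM; rewrite ?enorm_ge0//; first exact: enorm_ev.
exact: (hM [::] x isT).
Qed.

(** Each mode meets a Fourier coefficient of the test field at a frequency
    with a component of size at least [Y]. Modes of zero amplitude are exempt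
    because products of waves produce such modes at frequency 0. *)
Lemma inner_high (W : seq mode) phi n (C Y : R) : test_field phi -> 0 < Y ->
  (forall i j (k : F) p, `|(k 0 j)%:~R| ^+ n * `|coef (coord_fun phi i) k p| <= C) ->
  (forall m, m \in W -> amp m = 0 \/ exists j, Y <= `|(fr m 0 j)%:~R|) ->
  `|inner (ev W) phi| <= l1 W * (d%:R * (C / Y ^+ n)).
Proof.
move=> hphi Y0 hC hW; rewrite inner_ev_coef => [|i]; last exact: test_field_tint.
apply: le_trans (ler_norm_sum _ _ _) _; rewrite /l1 mulr_suml big_seq [leRHS]big_seq.
apply: ler_sum => m mW; apply: le_trans (ler_norm_sum _ _ _) _.
case: (hW m mW) => [->|[j hj]].
  by rewrite enorm0 mul0r big1// => i _; rewrite mxE mul0r normr0.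
have -> : enorm (amp m) * (d%:R * (C / Y ^+ n)) = \sum_(i < d) enorm (amp m) * (C / Y ^+ n).
  by rewrite sumr_const card_ord -mulr_natl; ring.
apply: ler_sum => i _; rewrite normrM; apply: ler_pM => //; first exact: coord_le_enorm.
rewrite ler_pdivlMr ?exprn_gt0// mulrC.
apply: le_trans (hC i j (fr m) (ph m)); apply: ler_wpM2r => //.
by apply: lerXn2r; rewrite ?nnegrE// ltW.
Qed.

End torus_functions.

(** * Transfer of energy between two slabs of frequencies *)

Section stage.
Context {R : realType} {d : nat}.
Local Notation E := 'rV[R]_d.
Local Notation F := 'rV[int]_d.
Local Notation mode := (@mode R d).
Implicit Types (U V W : seq mode) (s : E -> R).

Lemma freqE (k : F) r : (freq k : E) 0 r = (k 0 r)%:~R.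
Proof. by rewrite mxE. Qed.

Lemma trilinear_cat1 s U U' V W :
  trilinear s (U ++ U') V W = trilinear s U V W + trilinear s U' V W.
Proof. by rewrite /trilinear big_cat. Qed.

Lemma trilinear_cat2 s U V V' W :
  trilinear s U (V ++ V') W = trilinear s U V W + trilinear s U V' W.
Proof. by rewrite /trilinear -big_split; apply: eq_bigr => a _; rewrite big_cat. Qed.

Lemma trilinear_cat3 s U V W W' :
  trilinear s U V (W ++ W') = trilinear s U V W + trilinear s U V W'.
Proof.
rewrite /trilinear -big_split; apply: eq_bigr => a _; rewrite -big_split.
by apply: eq_bigr => b _; rewrite big_cat.
Qed.

Lemma trilinear_scale s (x y z : R) U V W :
  trilinear s (map (scale_mode x) U) (map (scale_mode y) V) (map (scale_mode z) W)
  = x * y * z * trilinear s U V W.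
Proof.
rewrite /trilinear big_map mulr_sumr; apply: eq_bigr => a _.
rewrite big_map mulr_sumr; apply: eq_bigr => b _.
rewrite big_map mulr_sumr; apply: eq_bigr => c _.
by rewrite /mean3 /= !dotZl !dotZr; ring.
Qed.

Lemma mean3_swap12 (a b c : mode) : mean3 a b c = mean3 b a c.
Proof.
rewrite /mean3 (addrC (fr b)) (addrC (ph b)).
have -> : mean_wave (fr b - fr a + fr c) (ph b - ph a + ph c) =
    mean_wave (fr a - fr b - fr c) (ph a - ph b - ph c) :> R.
  rewrite -mean_waveN; congr mean_wave; last by ring.
  by apply/rowP => r; rewrite !mxE; ring.
have -> : mean_wave (fr b - fr a - fr c) (ph b - ph a - ph c) =
    mean_wave (fr a - fr b + fr c) (ph a - ph b + ph c) :> R.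
  rewrite -mean_waveN; congr mean_wave; last by ring.
  by apply/rowP => r; rewrite !mxE; ring.
ring.
Qed.

Lemma mean3_swap23 (a b c : mode) : mean3 a b c = mean3 a c b.
Proof.
rewrite /mean3.
rewrite [fr a + fr c + fr b]addrAC [fr a + fr c - fr b]addrAC.
rewrite [fr a - fr c + fr b]addrAC [fr a - fr c - fr b]addrAC.
rewrite [ph a + ph c + ph b]addrAC [ph a + ph c - ph b]addrAC.
rewrite [ph a - ph c + ph b]addrAC [ph a - ph c - ph b]addrAC.
ring.
Qed.

Section sector.
Variables (L mu : R) (r : 'I_d).
Hypotheses (L0 : 0 < L) (mu0 : 0 <= mu) (muL : 64 * mu <= L).

(** The label [e] will be -1, 0 or 1: it says on which side of the origin a
    component of a frequency lies, if any. *)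
Definition near_int (e : R) (k : int) := `|k%:~R - e * L| <= mu.

Lemma near_intN e k : near_int e k -> near_int (- e) (- k).
Proof.
rewrite /near_int rmorphN/= mulNr => H.
have -> : - k%:~R - - (e * L) = - (k%:~R - e * L) :> R by ring.
by rewrite normrN.
Qed.

(** The errors of three components are too small to make up for labels that do
    not cancel; this rules out most triads. *)
Lemma near_sum3 (e1 e2 e3 : R) (k1 k2 k3 : int) :
  near_int e1 k1 -> near_int e2 k2 -> near_int e3 k3 ->
  1 <= (e1 + e2 + e3) ^+ 2 -> (k1 + k2 + k3)%:~R != 0 :> R.
Proof.
move=> H1 H2 H3 He; apply/eqP; rewrite !rmorphD/= => k0.
have {}He : 1 <= `|e1 + e2 + e3|.
  by rewrite -(@ler_pXn2r _ 2) ?nnegrE// expr1n real_normK ?num_real.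
have : `|(e1 + e2 + e3) * L| <= 3 * mu.
  have -> : (e1 + e2 + e3) * L =
      - ((k1%:~R - e1 * L) + (k2%:~R - e2 * L) + (k3%:~R - e3 * L)) by lra.
  rewrite normrN; apply: le_trans (ler_normD _ _) _.
  move: H1 H2 H3; rewrite /near_int.
  have := ler_normD (k1%:~R - e1 * L) (k2%:~R - e2 * L); lra.
rewrite normrM (gtr0_norm L0) => H.
have {}H : 1 * L <= 3 * mu by apply: le_trans H; rewrite ler_pM2r.
move: L0 mu0 muL H; lra.
Qed.

Lemma near_sum2 (e1 e2 : R) (k1 k2 : int) : near_int e1 k1 -> near_int e2 k2 ->
  1 <= (e1 + e2) ^+ 2 -> (k1 + k2)%:~R != 0 :> R.
Proof.
move=> H1 H2 He; rewrite -[k1 + k2]addr0; apply: (near_sum3 H1 H2 (e3 := 0)).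
  by rewrite /near_int mul0r subr0 normr0.
by rewrite addr0.
Qed.

Lemma mean_wave_ne0 (k : F) (q : R) : (k 0 r)%:~R != 0 :> R -> mean_wave k q = 0 :> R.
Proof.
move=> k0; rewrite /mean_wave ifF//; apply/negbTE/eqP => kE.
by move: k0; rewrite kE mxE eqxx.
Qed.

Lemma mean3_near0 e1 e2 e3 (a b c : mode) :
  near_int e1 (fr a 0 r) -> near_int e2 (fr b 0 r) -> near_int e3 (fr c 0 r) ->
  1 <= (e1 + e2 + e3) ^+ 2 -> 1 <= (e1 + e2 - e3) ^+ 2 ->
  1 <= (e1 - e2 + e3) ^+ 2 -> 1 <= (e1 - e2 - e3) ^+ 2 -> mean3 a b c = 0.
Proof.
move=> Ha Hb Hc; have Nb := near_intN Hb; have Nc := near_intN Hc.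
move=> h1 h2 h3 h4; rewrite /mean3.
rewrite !mean_wave_ne0 ?addr0 ?mulr0// !mxE.
- exact: (near_sum3 Ha Nb Nc h4).
- exact: (near_sum3 Ha Nb Hc h3).
- exact: (near_sum3 Ha Hb Nc h2).
- exact: (near_sum3 Ha Hb Hc h1).
Qed.

Lemma mean2_near0 e1 e2 (a b : mode) :
  near_int e1 (fr a 0 r) -> near_int e2 (fr b 0 r) ->
  1 <= (e1 + e2) ^+ 2 -> 1 <= (e1 - e2) ^+ 2 -> mean2 a b = 0.
Proof.
move=> Ha Hb; have Nb := near_intN Hb; move=> h1 h2; rewrite /mean2.
rewrite (mean_wave_ne0 (k := fr a + fr b)); last by rewrite mxE; exact: (near_sum2 Ha Hb).
rewrite (mean_wave_ne0 (k := fr a - fr b)); last by rewrite !mxE; exact: (near_sum2 Ha Nb).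
by rewrite !mulr0 addr0.
Qed.

End sector.

Section trilinear_zero.
Variables (L mu : R) (r : 'I_d).
Hypotheses (L0 : 0 < L) (mu0 : 0 <= mu) (muL : 64 * mu <= L).

Definition all_near (e : R) U := forall a, a \in U -> near_int L mu e (fr a 0 r).

Lemma trilinear_near0 s e1 e2 e3 U V W :
  all_near e1 U -> all_near e2 V -> all_near e3 W ->
  1 <= (e1 + e2 + e3) ^+ 2 -> 1 <= (e1 + e2 - e3) ^+ 2 ->
  1 <= (e1 - e2 + e3) ^+ 2 -> 1 <= (e1 - e2 - e3) ^+ 2 -> trilinear s U V W = 0.
Proof.
move=> nU nV nW h1 h2 h3 h4; rewrite /trilinear.
rewrite big_seq big1// => a aU; rewrite big_seq big1// => b bV.
rewrite big_seq big1// => c cW.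
rewrite (mean3_near0 L0 mu0 muL (b := shift_mode b) (nU _ aU) (nV _ bV) (nW _ cW))//.
by rewrite mulr0.
Qed.

Lemma pairing_near0 e1 e2 U V :
  all_near e1 U -> all_near e2 V ->
  1 <= (e1 + e2) ^+ 2 -> 1 <= (e1 - e2) ^+ 2 -> pairing U V = 0.
Proof.
move=> nU nV h1 h2; rewrite /pairing.
rewrite big_seq big1// => a aU; rewrite big_seq big1// => b bV.
by rewrite (mean2_near0 L0 mu0 muL (nU _ aU) (nV _ bV))// mulr0.
Qed.

Lemma all_near_mult s e U : all_near e U -> all_near e (map (mult_mode s) U).
Proof. by move=> nU a /mapP[b bU ->] /=; exact: nU. Qed.

End trilinear_zero.

Definition family (I : finType) (k : I -> F) (q : R) (a : I -> E) : seq mode :=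
  [seq Mode (k i) q (a i) | i <- enum I].

Lemma big_family (I : finType) (k : I -> F) q (a : I -> E) (G : mode -> R) :
  \sum_(m <- family k q a) G m = \sum_i G (Mode (k i) q (a i)).
Proof. by rewrite /family big_map big_enum. Qed.

(** The label 1 keeps the sum of two frequencies away from 0, and the
    frequencies are distinct, so the modes are orthogonal. *)
Lemma pairing_family (I : finType) (k : I -> F) q (a : I -> E) s (L mu : R) r :
  0 < L -> 0 <= mu -> 64 * mu <= L ->
  (forall i, near_int L mu 1 (k i 0 r)) -> injective k ->
  pairing (map (mult_mode s) (family k q a)) (family k q a) =
  vol R d / 2 * \sum_i s (freq (k i)) * dot (a i) (a i).
Proof.
move=> L0 mu0 muL nk kI; rewrite /pairing big_map big_family mulr_sumr.
apply: eq_bigr => i _; rewrite big_family (bigD1 i)//= big1 ?addr0 => [|j ji].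
  have k0 : ((k i + k i) 0 r)%:~R != 0 :> R.
    by rewrite mxE; apply: (near_sum2 L0 mu0 muL (nk i) (nk i)); lra.
  rewrite /mean2 /= (mean_wave_ne0 _ k0) subrr /mean_wave eqxx subrr cos0 dotZl; ring.
have k0 : ((k i + k j) 0 r)%:~R != 0 :> R.
  by rewrite mxE; apply: (near_sum2 L0 mu0 muL (nk i) (nk j)); lra.
rewrite /mean2 /= (mean_wave_ne0 _ k0) /mean_wave subr_eq0 (inj_eq kI).
by rewrite eq_sym (negbTE ji) !mulr0 addr0 mulr0.
Qed.

Lemma ler_normM (x y X Y : R) : `|x| <= X -> `|y| <= Y -> `|x * y| <= X * Y.
Proof. by move=> xX yY; rewrite normrM ler_pM. Qed.

Lemma quotient_bound (lam mu k ko : R) : 0 < lam -> 0 <= mu -> 64 * mu <= lam ->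
  `|k - lam| <= mu -> `|ko| <= mu -> `|ko / k| <= 2 * (mu / lam).
Proof.
move=> lam0 mu0 mulam; rewrite ler_norml => /andP[k1 k2] ko_.
have kge : lam / 2 <= k by lra.
have k0 : 0 < k by lra.
rewrite normrM normfV (gtr0_norm k0) ler_pdivrMr//; apply: le_trans ko_ _.
have -> : mu = 2 * (mu / lam) * (lam / 2) by field; rewrite gt_eqF.
have -> : 2 * (2 * (mu / lam) * (lam / 2) / lam) = 2 * (mu / lam).
  by field; rewrite gt_eqF.
by apply: ler_wpM2l => //; rewrite mulr_ge0// divr_ge0// ltW.
Qed.

(** The coefficients of one triad in coordinates. A frequency k near lam e_p
    and a frequency l near lam' e_p' interact through l - k; [kp, kp', ko] and
    [lp, lp', lo] are their components along p, p' and a third axis o, while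
    [al] and [be] are the small slopes that make the two modes
    divergence-free. The leading terms are - lam lam' and + lam lam'; all the
    others are smaller by the factor mu / lam, and the number 64 leaves ample
    room for the constants. *)
Lemma triad_arith (lam lam' mu kp kp' ko lp lp' lo al be : R) :
  0 < lam -> 0 <= mu -> 64 * mu <= lam -> lam <= lam' ->
  `|kp - lam| <= mu -> `|kp'| <= mu -> `|ko| <= mu ->
  `|lp' - lam'| <= mu -> `|lp| <= mu -> `|lo| <= mu ->
  `|al| <= 2 * (mu / lam) -> `|be| <= 2 * (mu / lam') ->
  [/\ `|- (kp' * lp - kp * lp') + (lo - ko - be * (lp' - kp')) * (al * (lp' - kp'))
        - lam * lam'| <= 4 * mu * lam',
      `|(- lp' * kp + lp * kp') + (lo - ko - al * (lp - kp)) * (- (be * (lp - kp)))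
        + lam * lam'| <= 4 * mu * lam',
      `|- ((lo - al * lp) * (- (be * (lp - kp)))) + (ko - be * kp') * (al * (lp' - kp'))|
        <= mu * lam',
      `|al * al| <= mu / lam & `|be * be| <= mu / lam].
Proof.
move=> lam0 mu0 mulam ll' kp_ kp'_ ko_ lp'_ lp_ lo_ al_ be_.
have lam'0 : 0 < lam' by lra.
pose eta := mu / lam; pose eta' := mu / lam'.
have etaE : eta * lam = mu by rewrite /eta divfK// gt_eqF.
have etaE' : eta' * lam' = mu by rewrite /eta' divfK// gt_eqF.
have eta0 : 0 <= eta by rewrite divr_ge0// ltW.
have eta0' : 0 <= eta' by rewrite divr_ge0// ltW.
have eta64 : eta <= 1 / 64 by rewrite /eta ler_pdivrMr//; lra.
have eta'eta : eta' <= eta by rewrite /eta /eta' ler_wpM2l// lef_pV2.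
rewrite -/eta in al_ *; rewrite -/eta' in be_.
have B (x y X Y : R) : `|x| <= X -> `|y| <= Y -> `|x + y| <= X + Y.
  by move=> *; rewrite (le_trans (ler_normD _ _))// lerD.
have BN (x y X Y : R) : `|x| <= X -> `|y| <= Y -> `|x - y| <= X + Y.
  by move=> *; rewrite (le_trans (ler_normB _ _))// lerD.
have kp2 : `|kp| <= 65 / 64 * lam.
  by move: kp_; rewrite !ler_norml => /andP[? ?]; apply/andP; split; lra.
have lp'2 : `|lp'| <= 65 / 64 * lam'.
  by move: lp'_; rewrite !ler_norml => /andP[? ?]; apply/andP; split; lra.
have m1 : `|lp - kp| <= 11 / 10 * lam
  by apply: le_trans (BN _ _ _ _ lp_ kp2) _; move: mulam lam0 mu0; clear; lra.
have m2 : `|lp' - kp'| <= 11 / 10 * lam'.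
  by apply: le_trans (BN _ _ _ _ lp'2 kp'_) _; move: mulam ll' lam0 mu0; clear; lra.
have a1 : `|al * (lp - kp)| <= 22 / 10 * mu.
  by apply: le_trans (ler_normM al_ m1) _; rewrite -etaE; clear; lra.
have a2 : `|al * (lp' - kp')| <= 22 / 10 * (eta * lam').
  by apply: le_trans (ler_normM al_ m2) _; clear; lra.
have mm' : eta' * lam <= mu by rewrite -etaE ler_wpM2r// ltW.
have b1 : `|be * (lp - kp)| <= 22 / 10 * mu.
  by apply: le_trans (ler_normM be_ m1) _; move: mm'; clear; lra.
have b2 : `|be * (lp' - kp')| <= 22 / 10 * mu.
  by apply: le_trans (ler_normM be_ m2) _; rewrite -etaE'; clear; lra.
have P0 : 0 <= mu * lam' by rewrite mulr_ge0// ltW.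
have P1 : mu * mu <= 1 / 64 * (mu * lam').
  have : mu * (64 * mu) <= mu * lam' by rewrite ler_wpM2l//; exact: le_trans ll'.
  by clear; lra.
have P2 : eta * (mu * lam') <= 1 / 64 * (mu * lam') by rewrite ler_wpM2r.
have P3 : mu * lam <= mu * lam' by rewrite ler_wpM2l.
have P4 : eta * mu <= 1 / 64 * mu by rewrite ler_wpM2r.
have P5 : eta' * mu <= 1 / 64 * mu.
  by rewrite ler_wpM2r//; exact: le_trans eta64.
have main : `|- lp' * kp + lp * kp' + lam * lam'| <= 21 / 10 * (mu * lam').
  have -> : - lp' * kp + lp * kp' + lam * lam' =
     lp * kp' - ((lp' - lam') * kp + lam' * (kp - lam)) by ring.
  have l'l' : `|lam'| <= lam' by rewrite ger0_norm// ltW.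
  apply: le_trans (BN _ _ _ _ (ler_normM lp_ kp'_)
    (B _ _ _ _ (ler_normM lp'_ kp2) (ler_normM l'l' kp_))) _.
  by move: P0 P1 P3; clear; lra.
split.
- have -> : - (kp' * lp - kp * lp') + (lo - ko - be * (lp' - kp')) *
      (al * (lp' - kp')) - lam * lam' =
     (lo - ko - be * (lp' - kp')) * (al * (lp' - kp')) -
     (- lp' * kp + lp * kp' + lam * lam') by ring.
  apply: le_trans (BN _ _ _ _ (ler_normM (BN _ _ _ _ (BN _ _ _ _ lo_ ko_) b2) a2) main) _.
  by move: P0 P1 P2; clear; lra.
- have -> : - lp' * kp + lp * kp' + (lo - ko - al * (lp - kp)) * - (be * (lp - kp))
     + lam * lam' = (- lp' * kp + lp * kp' + lam * lam') -
     (lo - ko - al * (lp - kp)) * (be * (lp - kp)) by ring.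
  apply: le_trans (BN _ _ _ _ main (ler_normM (BN _ _ _ _ (BN _ _ _ _ lo_ ko_) a1) b1)) _.
  by move: P0 P1 P2; clear; lra.
- have -> : - ((lo - al * lp) * - (be * (lp - kp))) + (ko - be * kp') * (al * (lp' - kp'))
    = (lo - al * lp) * (be * (lp - kp)) + (ko - be * kp') * (al * (lp' - kp')) by ring.
  have c1 : `|lo - al * lp| <= 2 * mu.
    by apply: le_trans (BN _ _ _ _ lo_ (ler_normM al_ lp_)) _; move: P4 mu0; clear; lra.
  have c2 : `|ko - be * kp'| <= 2 * mu.
    by apply: le_trans (BN _ _ _ _ ko_ (ler_normM be_ kp'_)) _; move: P5 mu0; clear; lra.
  apply: le_trans (B _ _ _ _ (ler_normM c1 b1) (ler_normM c2 a2)) _.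
  by move: P0 P1 P2; clear; lra.
- apply: le_trans (ler_normM al_ al_) _.
  have : eta * eta <= 1 / 64 * eta by rewrite ler_wpM2r.
  by move: eta0; clear; lra.
- apply: le_trans (ler_normM be_ be_) _.
  have h1 : eta' * eta' <= eta * eta by rewrite ler_pM.
  have : eta * eta <= 1 / 64 * eta by rewrite ler_wpM2r.
  by move: h1 eta0; clear; lra.
Qed.

Section three_families.
Variables (o p p' : 'I_d).
Hypotheses (op : o != p) (op' : o != p') (pp' : p != p').
Variables (lam lam' mu : R).
Hypotheses (lam0 : 0 < lam) (mu0 : 0 <= mu) (mulam : 64 * mu <= lam)
  (lamlam' : lam <= lam').
Variables (I J K : finType) (kA : I -> F) (kB : J -> F) (kC : K -> F).
Variable tau : I -> J -> K.
Hypotheses (tauE : forall i j, kC (tau i j) = kB j - kA i)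
  (injA : injective kA) (injB : injective kB) (injC : injective kC).
Hypotheses
  (A_p : forall i, near_int lam mu 1 (kA i 0 p))
  (A_r : forall i r, r != p -> `|(kA i 0 r)%:~R : R| <= mu)
  (B_p : forall j, near_int lam' mu 1 (kB j 0 p'))
  (B_r : forall j r, r != p' -> `|(kB j 0 r)%:~R : R| <= mu)
  (C_p : forall m, near_int lam mu (-1) (kC m 0 p))
  (C_p' : forall m, near_int lam' mu 1 (kC m 0 p'))
  (C_r : forall m r, r != p -> r != p' -> `|(kC m 0 r)%:~R : R| <= mu).

(** A slab mode points along the axis o; the small component along [q] makes
    it divergence-free. *)
Definition slab_vec (q : 'I_d) (k : F) : E :=
  unit_vec o - ((k 0 o)%:~R / (k 0 q)%:~R) *: unit_vec q.
(** The shear lies in the plane of p and p', orthogonally to its frequency. *)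
Definition shear_vec (m : F) : E :=
  - (m 0 p')%:~R *: unit_vec p + (m 0 p)%:~R *: unit_vec p'.

Definition famA := family kA 0 (fun i => slab_vec p (kA i)).
Definition famB := family kB 0 (fun j => slab_vec p' (kB j)).
(** The shear modes are sines: in a triad of two cosines and a sine, the
    derivative in the transport term leaves an even number of sines, and only
    such products have a nonzero mean. *)
Definition famC := family kC (- (pi / 2)) (fun m => shear_vec (kC m)).

Let lam'0 : 0 < lam'. Proof. exact: lt_le_trans lamlam'. Qed.
Let mulam' : 64 * mu <= lam'. Proof. exact: le_trans lamlam'. Qed.

Lemma nearA : all_near lam mu p 1 famA /\ all_near lam' mu p' 0 famA.
Proof.
split=> a /mapP[i _ ->] //=.
by rewrite /near_int mul0r subr0; apply: A_r; rewrite eq_sym.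
Qed.

Lemma nearB : all_near lam mu p 0 famB /\ all_near lam' mu p' 1 famB.
Proof.
split=> a /mapP[j _ ->] //=.
by rewrite /near_int mul0r subr0; apply: B_r.
Qed.

Lemma nearC : all_near lam mu p (-1) famC /\ all_near lam' mu p' 1 famC.
Proof. by split=> a /mapP[m _ ->] /=. Qed.

(** Only triads with one member in each family interact: in all others the
    labels along p or along p' do not cancel. *)
Lemma trilinear_three s (x y z : R) :
  let U := map (scale_mode x) famA ++ map (scale_mode y) famB
           ++ map (scale_mode z) famC in
  trilinear s U U U = x * y * z *
    (trilinear s famB famA famC + trilinear s famB famC famA
   + trilinear s famA famB famC + trilinear s famA famC famB
   + trilinear s famC famB famA + trilinear s famC famA famB).
Proof.
move=> U; rewrite /U !(trilinear_cat1, trilinear_cat2, trilinear_cat3).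
rewrite !trilinear_scale.
have [a1 a2] := nearA; have [b1 b2] := nearB; have [c1 c2] := nearC.
have Z := trilinear_near0 lam0 mu0 mulam s.
have Z' := trilinear_near0 lam'0 mu0 mulam' s.
rewrite (Z _ _ _ _ _ _ _ a1 a1 a1)//; try lra.
rewrite (Z _ _ _ _ _ _ _ a1 b1 b1)//; try lra.
rewrite (Z _ _ _ _ _ _ _ b1 a1 b1)//; try lra.
rewrite (Z _ _ _ _ _ _ _ b1 b1 a1)//; try lra.
rewrite (Z _ _ _ _ _ _ _ a1 c1 c1)//; try lra.
rewrite (Z _ _ _ _ _ _ _ c1 a1 c1)//; try lra.
rewrite (Z _ _ _ _ _ _ _ c1 c1 a1)//; try lra.
rewrite (Z _ _ _ _ _ _ _ c1 c1 c1)//; try lra.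
rewrite (Z _ _ _ _ _ _ _ c1 b1 b1)//; try lra.
rewrite (Z _ _ _ _ _ _ _ b1 c1 b1)//; try lra.
rewrite (Z _ _ _ _ _ _ _ b1 b1 c1)//; try lra.
rewrite (Z' _ _ _ _ _ _ _ b2 b2 b2)//; try lra.
rewrite (Z' _ _ _ _ _ _ _ a2 a2 b2)//; try lra.
rewrite (Z' _ _ _ _ _ _ _ a2 b2 a2)//; try lra.
rewrite (Z' _ _ _ _ _ _ _ b2 a2 a2)//; try lra.
rewrite (Z' _ _ _ _ _ _ _ a2 a2 c2)//; try lra.
rewrite (Z' _ _ _ _ _ _ _ a2 c2 a2)//; try lra.
rewrite (Z' _ _ _ _ _ _ _ c2 a2 a2)//; try lra.
rewrite (Z' _ _ _ _ _ _ _ b2 c2 c2)//; try lra.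
rewrite (Z' _ _ _ _ _ _ _ c2 b2 c2)//; try lra.
rewrite (Z' _ _ _ _ _ _ _ c2 c2 b2)//; try lra.
Qed.

(** Labels leave one way for the three frequencies to cancel. *)
Lemma mean3_triad i j m (qa qb qc : R) (va vb vc : E) :
  mean3 (Mode (kB j) qb vb) (Mode (kA i) qa va) (Mode (kC m) qc vc) =
  if kC m == kB j - kA i then vol R d / 4 * cos (qb - qa - qc) else 0.
Proof.
have A1 := A_p i; have B2 := B_p j; have C1 := C_p m; have C2 := C_p' m.
have A2 : near_int lam' mu 0 (kA i 0 p').
  by rewrite /near_int mul0r subr0; apply: A_r; rewrite eq_sym.
have B1 : near_int lam mu 0 (kB j 0 p).
  by rewrite /near_int mul0r subr0; apply: B_r.
have NC1 := near_intN C1; have NA2 := near_intN A2.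
rewrite /mean3 /=.
rewrite (mean_wave_ne0 (r := p') (k := kB j + kA i + kC m)); last first.
  by rewrite !mxE; apply: (near_sum3 lam'0 mu0 mulam' B2 A2 C2); lra.
rewrite (mean_wave_ne0 (r := p) (k := kB j + kA i - kC m)); last first.
  by rewrite !mxE; apply: (near_sum3 lam0 mu0 mulam B1 A1 NC1); lra.
rewrite (mean_wave_ne0 (r := p') (k := kB j - kA i + kC m)); last first.
  by rewrite !mxE; apply: (near_sum3 lam'0 mu0 mulam' B2 NA2 C2); lra.
rewrite /mean_wave subr_eq0 eq_sym; case: ifP => _; by field.
Qed.

(** Each pair of slab frequencies is completed to a triad by exactly one shear
    frequency. *)
Lemma sum_triad (G : I -> J -> K -> R) :
  \sum_i \sum_j \sum_m (if kC m == kB j - kA i then G i j m else 0) =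
  \sum_i \sum_j G i j (tau i j).
Proof.
apply: eq_bigr => i _; apply: eq_bigr => j _.
rewrite (bigD1 (tau i j))//= tauE eqxx big1 ?addr0// => m mt.
by rewrite -tauE (inj_eq injC) (negbTE mt).
Qed.

Lemma dot_slab q k (y : E) :
  dot (slab_vec q k) y = y 0 o - (k 0 o)%:~R / (k 0 q)%:~R * y 0 q.
Proof. by rewrite /slab_vec dotDl dotNl dotZl !(dotC (unit_vec _)) !dot_unit. Qed.

Lemma dot_shear m (y : E) :
  dot (shear_vec m) y = - (m 0 p')%:~R * y 0 p + (m 0 p)%:~R * y 0 p'.
Proof. by rewrite /shear_vec dotDl !dotZl !(dotC (unit_vec _)) !dot_unit. Qed.

Lemma slab_coord q k r : (slab_vec q k) 0 r =
  (r == o)%:R - (k 0 o)%:~R / (k 0 q)%:~R * (r == q)%:R.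
Proof. by rewrite !mxE. Qed.

Lemma shear_coord m r : (shear_vec m) 0 r =
  - (m 0 p')%:~R * (r == p)%:R + (m 0 p)%:~R * (r == p')%:R.
Proof. by rewrite !mxE. Qed.

(** The energy that the mode of the first family gives up to the transport in
    one triad; similarly for the second and the third family. *)
Definition lossA i j : R :=
  - (dot (shear_vec (kC (tau i j))) (freq (kB j))
     * dot (slab_vec p (kA i)) (slab_vec p' (kB j)))
  + dot (slab_vec p' (kB j)) (freq (kC (tau i j)))
    * dot (shear_vec (kC (tau i j))) (slab_vec p (kA i)).
Definition lossB i j : R :=
  dot (shear_vec (kC (tau i j))) (freq (kA i))
     * dot (slab_vec p (kA i)) (slab_vec p' (kB j))
  + dot (slab_vec p (kA i)) (freq (kC (tau i j)))
    * dot (shear_vec (kC (tau i j))) (slab_vec p' (kB j)).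
Definition lossC i j : R :=
  - (dot (slab_vec p (kA i)) (freq (kB j))
     * dot (shear_vec (kC (tau i j))) (slab_vec p' (kB j)))
  + dot (slab_vec p' (kB j)) (freq (kA i))
    * dot (shear_vec (kC (tau i j))) (slab_vec p (kA i)).

Lemma trilinear_six s :
  trilinear s famB famA famC + trilinear s famB famC famA
   + trilinear s famA famB famC + trilinear s famA famC famB
   + trilinear s famC famB famA + trilinear s famC famA famB =
  vol R d / 4 * \sum_i \sum_j (s (freq (kB j)) * lossB i j
     + s (freq (kA i)) * lossA i j + s (freq (kC (tau i j))) * lossC i j).
Proof.
pose a i := slab_vec p (kA i); pose b j := slab_vec p' (kB j).
pose c m := shear_vec (kC m).
pose v4 := vol R d / 4.
have phase0 : cos (0 - (0 + pi / 2) - - (pi / 2)) = 1 :> R.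
  by rewrite (_ : _ - _ = 0) ?cos0//; ring.
have phase1 : cos (0 - 0 - (- (pi / 2) + pi / 2)) = 1 :> R.
  by rewrite (_ : _ - _ = 0) ?cos0//; ring.
have phase2 : cos (0 + pi / 2 - 0 - - (pi / 2)) = -1 :> R.
  by rewrite (_ : _ - _ = pi) ?cospi//; field.
have T1 : trilinear s famB famA famC = v4 * \sum_i \sum_j
    s (freq (kB j)) * (dot (c (tau i j)) (freq (kA i)) * dot (a i) (b j)).
  rewrite mulr_sumr; under [RHS]eq_bigr do rewrite mulr_sumr.
  rewrite -(sum_triad (fun i j m => v4 * (s (freq (kB j)) *
    (dot (c m) (freq (kA i)) * dot (a i) (b j))))).
  rewrite /trilinear big_family exchange_big/= big_family.
  apply: eq_bigr => i _; apply: eq_bigr => j _; rewrite big_family.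
  apply: eq_bigr => m _; rewrite /shift_mode /= mean3_triad phase0.
  by case: ifP => _; rewrite ?mulr0// dotC /v4 /a /b /c; ring.
have T2 : trilinear s famB famC famA = v4 * \sum_i \sum_j
    s (freq (kB j)) * (dot (a i) (freq (kC (tau i j))) * dot (c (tau i j)) (b j)).
  rewrite mulr_sumr; under [RHS]eq_bigr do rewrite mulr_sumr.
  rewrite -(sum_triad (fun i j m => v4 * (s (freq (kB j)) *
    (dot (a i) (freq (kC m)) * dot (c m) (b j))))).
  rewrite /trilinear big_family; under eq_bigr do rewrite exchange_big/=.
  rewrite exchange_big/= big_family.
  apply: eq_bigr => i _; apply: eq_bigr => j _; rewrite big_family.
  apply: eq_bigr => m _; rewrite /shift_mode /= mean3_swap23 mean3_triad phase1.
  by case: ifP => _; rewrite ?mulr0// (dotC (c m)) /v4 /a /b /c; ring.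
have T3 : trilinear s famA famB famC = v4 * \sum_i \sum_j
    s (freq (kA i)) * (- (dot (c (tau i j)) (freq (kB j)) * dot (a i) (b j))).
  rewrite mulr_sumr; under [RHS]eq_bigr do rewrite mulr_sumr.
  rewrite -(sum_triad (fun i j m => v4 * (s (freq (kA i)) *
    (- (dot (c m) (freq (kB j)) * dot (a i) (b j)))))).
  rewrite /trilinear big_family.
  apply: eq_bigr => i _; rewrite big_family; apply: eq_bigr => j _.
  rewrite big_family; apply: eq_bigr => m _.
  rewrite /shift_mode /= mean3_swap12 mean3_triad phase2.
  by case: ifP => _; rewrite ?mulr0// /v4 /a /b /c; ring.
have T4 : trilinear s famA famC famB = v4 * \sum_i \sum_j
    s (freq (kA i)) * (dot (b j) (freq (kC (tau i j))) * dot (c (tau i j)) (a i)).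
  rewrite mulr_sumr; under [RHS]eq_bigr do rewrite mulr_sumr.
  rewrite -(sum_triad (fun i j m => v4 * (s (freq (kA i)) *
    (dot (b j) (freq (kC m)) * dot (c m) (a i))))).
  rewrite /trilinear big_family.
  apply: eq_bigr => i _; rewrite exchange_big/= big_family; apply: eq_bigr => j _.
  rewrite big_family; apply: eq_bigr => m _.
  rewrite /shift_mode /= mean3_swap23 mean3_swap12 mean3_triad phase1.
  by case: ifP => _; rewrite ?mulr0// (dotC (c m)) /v4 /a /b /c; ring.
have T5 : trilinear s famC famB famA = v4 * \sum_i \sum_j
    s (freq (kC (tau i j))) * (- (dot (a i) (freq (kB j)) * dot (c (tau i j)) (b j))).
  rewrite mulr_sumr; under [RHS]eq_bigr do rewrite mulr_sumr.
  rewrite -(sum_triad (fun i j m => v4 * (s (freq (kC m)) *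
    (- (dot (a i) (freq (kB j)) * dot (c m) (b j)))))).
  rewrite /trilinear; under eq_bigr do rewrite exchange_big/=.
  rewrite exchange_big/= big_family.
  apply: eq_bigr => i _; rewrite exchange_big/= big_family; apply: eq_bigr => j _.
  rewrite big_family; apply: eq_bigr => m _.
  rewrite /shift_mode /= mean3_swap12 mean3_swap23 mean3_triad phase2.
  by case: ifP => _; rewrite ?mulr0// /v4 /a /b /c; ring.
have T6 : trilinear s famC famA famB = v4 * \sum_i \sum_j
    s (freq (kC (tau i j))) * (dot (b j) (freq (kA i)) * dot (c (tau i j)) (a i)).
  rewrite mulr_sumr; under [RHS]eq_bigr do rewrite mulr_sumr.
  rewrite -(sum_triad (fun i j m => v4 * (s (freq (kC m)) *
    (dot (b j) (freq (kA i)) * dot (c m) (a i))))).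
  rewrite /trilinear exchange_big/= big_family.
  apply: eq_bigr => i _; rewrite exchange_big/= big_family; apply: eq_bigr => j _.
  rewrite big_family; apply: eq_bigr => m _.
  rewrite /shift_mode /= mean3_swap12 mean3_swap23 mean3_swap12 mean3_triad phase0.
  by case: ifP => _; rewrite ?mulr0// /v4 /a /b /c; ring.
rewrite T1 T2 T3 T4 T5 T6 -!mulrDr; congr (_ * _).
rewrite -!big_split; apply: eq_bigr => i _; rewrite -!big_split.
by apply: eq_bigr => j _ /=; rewrite /lossA /lossB /lossC /a /b /c; ring.
Qed.

Let eta := mu / lam.

(** The transport takes from the first family what it gives to the second, and
    the shear takes part only at lower order. *)
Lemma loss_estimates i j :
  [/\ `|lossA i j - lam * lam'| <= 4 * mu * lam',
      `|lossB i j + lam * lam'| <= 4 * mu * lam',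
      `|lossC i j| <= mu * lam',
      `|dot (slab_vec p (kA i)) (slab_vec p (kA i)) - 1| <= eta &
      `|dot (slab_vec p' (kB j)) (slab_vec p' (kB j)) - 1| <= eta].
Proof.
have H0 := lam0; have H1 := mu0; have H2 := mulam; have H3 := lamlam'.
have H0' := lam'0; have H2' := mulam'.
have mE r : (kC (tau i j) 0 r)%:~R = (kB j 0 r)%:~R - (kA i 0 r)%:~R :> R.
  by rewrite tauE !mxE rmorphB.
have eop : (o == p) = false := negbTE op.
have eop' : (o == p') = false := negbTE op'.
have epo : (p == o) = false by rewrite eq_sym.
have ep'o : (p' == o) = false by rewrite eq_sym.
have epp' : (p == p') = false := negbTE pp'.
have ep'p : (p' == p) = false by rewrite eq_sym.
have kp_ := A_p i; have kp'_ := @A_r i p' ltac:(by rewrite eq_sym).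
have ko_ := @A_r i o op.
have lp'_ := B_p j; have lp_ := @B_r j p pp'; have lo_ := @B_r j o op'.
rewrite /near_int !mul1r in kp_ lp'_.
have al_ := quotient_bound H0 H1 H2 kp_ ko_.
have be_ := quotient_bound H0' H1 H2' lp'_ lo_.
have [t1 t2 t3 t4 t5] :=
  triad_arith H0 H1 H2 H3 kp_ kp'_ ko_ lp'_ lp_ lo_ al_ be_.
rewrite /lossA /lossB /lossC !dot_shear !dot_slab !slab_coord !freqE !mE.
rewrite !eqxx ?(eop, eop', epo, ep'o, epp', ep'p) /=.
move: al_ be_ t1 t2 t3 t4 t5; set al := _ / _; set be := _ / _.
move=> al_ be_ t1 t2 t3 t4 t5; split.
- by move: t1; congr (`|_| <= _); ring.
- by move: t2; congr (`|_| <= _); ring.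
- by move: t3; congr (`|_| <= _); ring.
- by move: t4; congr (`|_| <= _); ring.
- by move: t5; congr (`|_| <= _); ring.
Qed.

Lemma sum_cst (I0 : finType) (c : R) : \sum_(i : I0) c = #|I0|%:R * c.
Proof.
by transitivity (\sum_(i in I0) c); [exact: eq_bigl|rewrite sumr_const mulr_natl].
Qed.

Definition stage_modes (x y z : R) : seq mode :=
  map (scale_mode x) famA ++ map (scale_mode y) famB ++ map (scale_mode z) famC.

Lemma mult_scale s c (U : seq mode) :
  map (mult_mode s) (map (scale_mode c) U) = map (scale_mode c) (map (mult_mode s) U).
Proof.
rewrite -!map_comp; apply: eq_map => m; rewrite /mult_mode /scale_mode /=.
by congr Mode; rewrite !scalerA mulrC.
Qed.

Let sumA s := \sum_i s (freq (kA i)) * dot (slab_vec p (kA i)) (slab_vec p (kA i)).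
Let sumB s := \sum_j s (freq (kB j)) * dot (slab_vec p' (kB j)) (slab_vec p' (kB j)).
Let sumC s := \sum_m s (freq (kC m)) * dot (shear_vec (kC m)) (shear_vec (kC m)).

Lemma pairing_stage s (x y z x' y' z' : R) :
  pairing (map (mult_mode s) (stage_modes x y z)) (stage_modes x' y' z') =
  vol R d / 2 * (x * x' * sumA s + y * y' * sumB s + z * z' * sumC s).
Proof.
rewrite /stage_modes !map_cat !mult_scale !(pairing_catl, pairing_catr).
rewrite !(pairing_scalel, pairing_scaler).
have [a1 a2] := nearA; have [b1 b2] := nearB; have [c1 c2] := nearC.
have ma2 := all_near_mult (s := s) a2; have mb1 := all_near_mult (s := s) b1.
have mb2 := all_near_mult (s := s) b2; have mc2 := all_near_mult (s := s) c2.
have mc1 := all_near_mult (s := s) c1.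
have Z := pairing_near0 lam0 mu0 mulam.
have Z' := pairing_near0 lam'0 mu0 mulam'.
rewrite (Z' _ _ _ _ _ ma2 b2); try lra.
rewrite (Z' _ _ _ _ _ ma2 c2); try lra.
rewrite (Z' _ _ _ _ _ mb2 a2); try lra.
rewrite (Z _ _ _ _ _ mb1 c1); try lra.
rewrite (Z' _ _ _ _ _ mc2 a2); try lra.
rewrite (Z _ _ _ _ _ mc1 b1); try lra.
have PA' := pairing_family 0 (fun i => slab_vec p (kA i)) s lam0 mu0 mulam A_p injA.
have PB' := pairing_family 0 (fun j => slab_vec p' (kB j)) s lam'0 mu0 mulam' B_p injB.
have PC' := pairing_family (- (pi / 2)) (fun m => shear_vec (kC m)) s lam'0 mu0 mulam' C_p' injC.
rewrite -/famA in PA'; rewrite -/famB in PB'; rewrite -/famC in PC'.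
rewrite PA' PB' PC' /sumA /sumB /sumC; ring.
Qed.

Lemma coord_C m : `|(kC m 0 p)%:~R : R| <= 65 / 64 * lam'
  /\ `|(kC m 0 p')%:~R : R| <= 65 / 64 * lam'.
Proof.
have H1 := mu0; have H2 := mulam; have H3 := lamlam'.
move: (C_p m) (C_p' m); rewrite /near_int !ler_norml => /andP[? ?] /andP[? ?].
by split; apply/andP; split; lra.
Qed.

Lemma dot_shear_le m : dot (shear_vec (kC m)) (shear_vec (kC m)) <= 3 * lam' ^+ 2.
Proof.
have epp' : (p == p') = false := negbTE pp'.
have ep'p : (p' == p) = false by rewrite eq_sym.
have [c1 c2] := coord_C m.
rewrite dot_shear !shear_coord !eqxx epp' ep'p /=.
move: c1 c2; set u := _%:~R; set v := _%:~R => c1 c2.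
have := ler_normM c1 c1; have := ler_normM c2 c2.
rewrite !ger0_norm -?expr2 ?sqr_ge0// => h1 h2.
have := sqr_ge0 lam'; lra.
Qed.

Lemma sumC_bound s (S : R) : (forall m, 0 <= s (freq (kC m)) <= S) ->
  0 <= sumC s <= S * (#|K|%:R * (3 * lam' ^+ 2)).
Proof.
move=> hs; apply/andP; split.
  by apply: sumr_ge0 => m _; case/andP: (hs m) => *; rewrite mulr_ge0// dot_ge0.
have -> : S * (#|K|%:R * (3 * lam' ^+ 2)) = \sum_(m in K) S * (3 * lam' ^+ 2).
  by rewrite sumr_const -mulr_natr; ring.
apply: ler_sum => m _; have /andP[s0 s1] := hs m.
by apply: ler_pM => //; [exact: dot_ge0|exact: dot_shear_le].
Qed.

(** The bracket of each triad cancels up to the relative width of the slabs,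
    whatever the values of the symbol at the three frequencies; this is why
    no low-pass filter can see the energy that passes from the first family
    to the second. *)
Lemma triad_balance s i j : (forall k, 0 <= s k <= 1) ->
  `|s (freq (kB j)) * (dot (slab_vec p' (kB j)) (slab_vec p' (kB j)) + lossB i j / (lam * lam'))
  + s (freq (kA i)) * (lossA i j / (lam * lam') - dot (slab_vec p (kA i)) (slab_vec p (kA i)))
  + s (freq (kC (tau i j))) * (lossC i j / (lam * lam'))| <= 11 * (mu / lam).
Proof.
move=> hs; have [hA hB hC ha hb] := loss_estimates i j.
have s1 k : `|s k| <= 1 by have /andP[h0 h1] := hs k; rewrite ger0_norm.
have ll : 0 < lam * lam' by rewrite mulr_gt0.
have div_le (g X : R) : `|g| <= X * mu * lam' -> `|g / (lam * lam')| <= X * (mu / lam).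
  move=> h; rewrite normrM normfV (gtr0_norm ll) ler_pdivrMr//.
  have -> : X * (mu / lam) * (lam * lam') = X * mu * lam' by field; rewrite gt_eqF.
  exact: h.
have dB := div_le _ 4 hB; have dA := div_le _ 4 hA.
have dC : `|lossC i j / (lam * lam')| <= 1 * (mu / lam) by apply: div_le; rewrite mul1r.
have llV : lam * lam' / (lam * lam') = 1 by rewrite divff// gt_eqF.
rewrite mulrBl llV in dA; rewrite mulrDl llV in dB.
have t1 := ler_normM (s1 (freq (kB j))) (le_trans (ler_normD _ _) (lerD hb dB)).
have t2 := ler_normM (s1 (freq (kA i))) (le_trans (ler_normB _ _) (lerD dA ha)).
have t3 := ler_normM (s1 (freq (kC (tau i j)))) dC.
have T := le_trans (ler_normD _ _) (lerD (le_trans (ler_normD _ _) (lerD t1 t2)) t3).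
apply: (le_trans _ (le_trans T _)); first last.
  by rewrite /eta; lra.
rewrite le_eqVlt; apply/orP; left; apply/eqP; congr (`|_|); congr (_ + _).
by congr (_ + _); congr (_ * _); ring.
Qed.

(** The amplitudes x and y of the two slabs have time derivatives x' and y'
    that move energy from the first slab to the second at the rate g; the
    third equation gives the shear just the amplitude for which the transport
    moves it at that rate. Averaging over the pairs of slab frequencies
    distributes the change of each slab mode over its triads, where
    [triad_balance] applies; what remains is the energy of the shear. *)
Lemma stage_work s (x y z x' y' z' g : R) : (forall k, 0 <= s k <= 1) ->
  (0 < #|I|)%N -> (0 < #|J|)%N ->
  x * x' * #|I|%:R = - g -> y * y' * #|J|%:R = g ->
  x * y * z * (#|I|%:R * #|J|%:R * (lam * lam')) = 2 * g ->
  `|pairing (map (mult_mode s) (stage_modes x y z)) (stage_modes x' y' z')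
    + trilinear s (stage_modes x y z) (stage_modes x y z) (stage_modes x y z)|
  <= vol R d / 2 * (`|g| * (11 * (mu / lam)) + `|z * z'| * (#|K|%:R * (3 * lam' ^+ 2))).
Proof.
move=> hs I0 J0 hx hy hz.
have i0 : #|I|%:R != 0 :> R by rewrite pnatr_eq0 -lt0n.
have j0 : #|J|%:R != 0 :> R by rewrite pnatr_eq0 -lt0n.
have ll : lam * lam' != 0 by rewrite gt_eqF// mulr_gt0.
have l0 : lam != 0 by rewrite gt_eqF.
have l0' : lam' != 0 by rewrite gt_eqF.
rewrite pairing_stage trilinear_three trilinear_six.
pose T i j := s (freq (kB j)) * (dot (slab_vec p' (kB j)) (slab_vec p' (kB j)) + lossB i j / (lam * lam'))
  + s (freq (kA i)) * (lossA i j / (lam * lam') - dot (slab_vec p (kA i)) (slab_vec p (kA i)))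
  + s (freq (kC (tau i j))) * (lossC i j / (lam * lam')).
pose S3 := \sum_i \sum_j (s (freq (kB j)) * lossB i j
     + s (freq (kA i)) * lossA i j + s (freq (kC (tau i j))) * lossC i j).
have TE : \sum_i \sum_j T i j = #|I|%:R * sumB s - #|J|%:R * sumA s + S3 / (lam * lam').
  rewrite -sum_cst.
  rewrite /sumA mulr_sumr -sumrB /S3 mulr_suml -big_split /=; apply: eq_bigr => i _.
  rewrite /sumB mulr_suml -sum_cst.
  rewrite -sumrB -big_split /=; apply: eq_bigr => j _; rewrite /T; ring.
rewrite -/S3.
have -> : vol R d / 2 * (x * x' * sumA s + y * y' * sumB s + z * z' * sumC s) +
  x * y * z * (vol R d / 4 * S3) =
  vol R d / 2 * (g * ((#|I|%:R * #|J|%:R)^-1 * (\sum_i \sum_j T i j)) + z * z' * sumC s).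
  have -> : x * x' = - g / #|I|%:R by rewrite -hx mulfK.
  have -> : y * y' = g / #|J|%:R by rewrite -hy mulfK.
  have -> : x * y * z = 2 * g / (#|I|%:R * #|J|%:R * (lam * lam')).
    by rewrite -hz mulfK// !mulf_neq0.
  rewrite TE; field; by rewrite l0 l0' i0 j0.
rewrite normrM ger0_norm; last by have := vol_gt0 R d; lra.
apply: ler_wpM2l; first by have := vol_gt0 R d; lra.
apply: le_trans (ler_normD _ _) _; apply: lerD; last first.
  rewrite normrM ler_wpM2l//.
  have /andP[c0 c1] := @sumC_bound s 1 (fun m => hs _).
  by rewrite ger0_norm//; move: c1; rewrite mul1r.
rewrite normrM ler_wpM2l// normrM ger0_norm ?invr_ge0 ?mulr_ge0//.
rewrite mulrC ler_pdivrMr; last by rewrite mulr_gt0// lt0r ?i0 ?j0 ler0n.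
apply: le_trans (ler_norm_sum _ _ _) _.
have -> : 11 * (mu / lam) * (#|I|%:R * #|J|%:R) = \sum_(i : I) \sum_(j : J) 11 * (mu / lam).
  by rewrite !sum_cst; ring.
apply: ler_sum => i _; apply: le_trans (ler_norm_sum _ _ _) _.
by apply: ler_sum => j _; exact: triad_balance.
Qed.

Lemma mult_mode1 (U : seq mode) : map (mult_mode (fun=> 1)) U = U.
Proof. by rewrite -[RHS]map_id; apply: eq_map => -[k q a]; rewrite /mult_mode /= scale1r. Qed.

Lemma slab_energy (T : finType) (k : T -> F) q :
  (forall i, `|dot (slab_vec q (k i)) (slab_vec q (k i)) - 1| <= eta) ->
  `|\sum_i 1 * dot (slab_vec q (k i)) (slab_vec q (k i)) - #|T|%:R| <= #|T|%:R * eta.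
Proof.
move=> h.
have -> : #|T|%:R = \sum_(i : T) 1 :> R by rewrite sum_cst mulr1.
rewrite mulr_suml -sumrB; apply: le_trans (ler_norm_sum _ _ _) _.
by apply: ler_sum => i _; rewrite !mul1r.
Qed.

(** The slab vectors have almost unit length. *)
Lemma stage_energy (x y z : R) : (0 < #|I|)%N -> (0 < #|J|)%N ->
  `|pairing (stage_modes x y z) (stage_modes x y z)
    - vol R d / 2 * (x ^+ 2 * #|I|%:R + y ^+ 2 * #|J|%:R)|
  <= vol R d / 2 * ((x ^+ 2 * #|I|%:R + y ^+ 2 * #|J|%:R) * (mu / lam)
      + z ^+ 2 * (#|K|%:R * (3 * lam' ^+ 2))).
Proof.
move=> /card_gt0P[i0 _] /card_gt0P[j0 _].
have hA : `|sumA (fun=> 1) - #|I|%:R| <= #|I|%:R * eta.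
  by apply: slab_energy => i; have [] := loss_estimates i j0.
have hB : `|sumB (fun=> 1) - #|J|%:R| <= #|J|%:R * eta.
  by apply: slab_energy => j; have [] := loss_estimates i0 j.
have /andP[c0 c1] := @sumC_bound (fun=> 1) 1 (fun m => ltac:(by rewrite ler01 lexx)).
rewrite mul1r in c1.
have := pairing_stage (fun=> 1) x y z x y z; rewrite mult_mode1 => ->.
rewrite -mulrBr normrM ger0_norm; last by have := vol_gt0 R d; lra.
apply: ler_wpM2l; first by have := vol_gt0 R d; lra.
have -> : x * x * sumA (fun=> 1) + y * y * sumB (fun=> 1) + z * z * sumC (fun=> 1)
  - (x ^+ 2 * #|I|%:R + y ^+ 2 * #|J|%:R) = x ^+ 2 * (sumA (fun=> 1) - #|I|%:R)
   + y ^+ 2 * (sumB (fun=> 1) - #|J|%:R) + z ^+ 2 * sumC (fun=> 1) by ring.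
apply: le_trans (ler_normD _ _) _; apply: lerD.
  apply: le_trans (ler_normD _ _) _; rewrite mulrDl; apply: lerD.
    by rewrite normrM ger0_norm ?sqr_ge0// -mulrA ler_wpM2l// sqr_ge0.
  by rewrite normrM ger0_norm ?sqr_ge0// -mulrA ler_wpM2l// sqr_ge0.
by rewrite normrM ger0_norm ?sqr_ge0// (ger0_norm c0) ler_wpM2l// sqr_ge0.
Qed.

Lemma mem_stage x y z m : m \in stage_modes x y z ->
  [\/ exists c i, m = Mode (kA i) 0 (c *: slab_vec p (kA i)),
      exists c j, m = Mode (kB j) 0 (c *: slab_vec p' (kB j)) |
      exists c l, m = Mode (kC l) (- (pi / 2)) (c *: shear_vec (kC l))].
Proof.
rewrite /stage_modes !mem_cat => /or3P[] /mapP[m' /mapP[i _ ->] ->].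
- by apply: Or31; exists x, i.
- by apply: Or32; exists y, i.
- by apply: Or33; exists z, i.
Qed.

Lemma near_ne0 (l : R) (k : int) (r : R) : 64 * mu <= l -> 0 < l -> r ^+ 2 = 1 ->
  near_int l mu r k -> (k%:~R : R) != 0.
Proof.
move=> h l0 r1 hk; apply/eqP => k0; move: hk; rewrite /near_int k0 sub0r normrN.
rewrite normrM (gtr0_norm l0).
have -> : `|r| = 1 by apply/eqP; rewrite -(@eqrXn2 _ 2)// real_normK ?num_real ?r1 ?expr1n.
by have := mu0; lra.
Qed.

Lemma stage_div_free x y z : div_free (stage_modes x y z).
Proof.
move=> m /mem_stage[] [c [i ->]] /=; rewrite dotZl ?dot_slab ?dot_shear !freqE.
- by rewrite divfK ?subrr ?mulr0// (near_ne0 mulam lam0 _ (A_p i))// expr1n.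
- by rewrite divfK ?subrr ?mulr0// (near_ne0 mulam' lam'0 _ (B_p i))// expr1n.
- by rewrite [X in _ + X]mulrC mulNr addNr mulr0.
Qed.

Lemma stage_coord x y z m r : m \in stage_modes x y z ->
  `|(fr m 0 r)%:~R : R| <= 2 * lam'.
Proof.
have H1 := mu0; have H2 := mulam; have H3 := lamlam'; have H4 := lam0.
have mul : mu <= 2 * lam' by lra.
have near l e k : near_int l mu e k -> e ^+ 2 = 1 -> 0 < l <= lam' -> `|k%:~R : R| <= 2 * lam'.
  move=> hk /eqP; rewrite sqrf_eq1 => e1 /andP[l0 l1].
  by move: hk; rewrite /near_int !ler_norml => /andP[? ?];
     case/orP: e1 => /eqP e1; subst e; apply/andP; split; lra.
case/mem_stage => [] [c [i ->]] /=.
- case: (eqVneq r p) => [->|rp]; last exact: le_trans (A_r _ rp) mul.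
  by apply: near (A_p i) _ _; rewrite ?expr1n// H4.
- case: (eqVneq r p') => [->|rp]; last exact: le_trans (B_r _ rp) mul.
  by apply: near (B_p i) _ _; rewrite ?expr1n// lexx lam'0.
- case: (eqVneq r p) => [->|rp].
    by apply: near (C_p i) _ _; rewrite ?sqrrN ?expr1n// H4.
  case: (eqVneq r p') => [->|rp']; last exact: le_trans (C_r _ rp rp') mul.
  by apply: near (C_p' i) _ _; rewrite ?expr1n// lexx lam'0.
Qed.

Lemma stage_freq_le x y z m : m \in stage_modes x y z ->
  dot (freq (fr m)) (freq (fr m)) <= d%:R * (4 * lam' ^+ 2).
Proof.
move=> mU; have -> : (d%:R : R) = #|'I_d|%:R by rewrite card_ord.
rewrite -sum_cst /dot; apply: ler_sum => r _; rewrite freqE -expr2 -real_normK ?num_real//.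
have := stage_coord r mU; set u := `|_| => h.
have -> : 4 * lam' ^+ 2 = (2 * lam') ^+ 2 by ring.
by rewrite ler_pXn2r ?nnegrE// ?normr_ge0//; have := lam'0; lra.
Qed.

Lemma stage_freq_ge x y z m : m \in stage_modes x y z ->
  lam ^+ 2 / 4 <= dot (freq (fr m)) (freq (fr m)).
Proof.
have H1 := mu0; have H2 := mulam; have H3 := lamlam'; have H4 := lam0.
have dotge (k : E) r : k 0 r ^+ 2 <= dot k k.
  rewrite /dot (bigD1 r)//= -expr2 lerDl; apply: sumr_ge0 => i _.
  by rewrite -expr2 sqr_ge0.
have big (k : F) r : lam / 2 <= `|(k 0 r)%:~R : R| -> lam ^+ 2 / 4 <= dot (freq k) (freq k).
  move=> h; apply: le_trans (dotge _ r); rewrite freqE -[leRHS]real_normK ?num_real//.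
  have -> : lam ^+ 2 / 4 = (lam / 2) ^+ 2 by field.
  by rewrite ler_pXn2r ?nnegrE ?normr_ge0//; lra.
case/mem_stage => [] [c [i ->]] /=.
- apply: (big _ p); move: (A_p i); rewrite /near_int ler_norml ler_normr => /andP[? ?].
  by apply/orP; left; lra.
- apply: (big _ p'); move: (B_p i); rewrite /near_int ler_norml ler_normr => /andP[? ?].
  by apply/orP; left; lra.
- apply: (big _ p); move: (C_p i); rewrite /near_int ler_norml ler_normr => /andP[? ?].
  by apply/orP; right; lra.
Qed.

Lemma stage_l1 x y z : (0 < #|I|)%N -> (0 < #|J|)%N ->
  l1 (stage_modes x y z) <= 2 * (`|x| * #|I|%:R + `|y| * #|J|%:R + `|z| * #|K|%:R * lam').
Proof.
move=> /card_gt0P[i0 _] /card_gt0P[j0 _].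
have eta1 : eta <= 1.
  by rewrite /eta ler_pdivrMr// mul1r; have := mu0; have := mulam; lra.
have en (v : E) (c : R) : 0 <= c -> dot v v <= c ^+ 2 -> enorm v <= c.
  by move=> c0 h; rewrite -(@ler_pXn2r _ 2) ?nnegrE ?enorm_ge0// enorm_sqr.
have s2 (t : R) : `|t - 1| <= eta -> t <= 2 ^+ 2.
  by rewrite ler_norml => /andP[_ ?]; lra.
have l1f (T : finType) (k : T -> F) q (a : T -> E) c :
    l1 (map (scale_mode c) (family k q a)) = \sum_i enorm (c *: a i).
  by rewrite /l1 big_map big_family.
rewrite {1}/l1 !big_cat -!/(l1 _) /famA /famB /famC !l1f !mulrDr -!addrA.
apply: lerD; last apply: lerD.
- rewrite mulrA -mulrC -sum_cst; apply: ler_sum => i _.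
  rewrite enormZ mulrC ler_wpM2r//.
  by apply: en => //; apply: s2; have [] := loss_estimates i j0.
- rewrite mulrA -mulrC -sum_cst; apply: ler_sum => j _.
  rewrite enormZ mulrC ler_wpM2r//.
  by apply: en => //; apply: s2; have [] := loss_estimates i0 j.
- have -> : 2 * (`|z| * #|K|%:R * lam') = #|K|%:R * (2 * lam' * `|z|) by ring.
  rewrite -sum_cst; apply: ler_sum => l _.
  rewrite enormZ mulrC ler_wpM2r//; apply: en; first by rewrite mulr_ge0// ltW.
  apply: le_trans (dot_shear_le l) _; have := sqr_ge0 lam'; lra.
Qed.

(** Distinct modes of a stage are orthogonal, so a symbol acts on the energy
    as on a sum of squares. *)
Lemma stage_symbol s (S : R) x y z :
  (forall m, m \in stage_modes x y z -> 0 <= s (freq (fr m)) <= S) ->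
  0 <= pairing (map (mult_mode s) (stage_modes x y z)) (stage_modes x y z)
    <= S * pairing (stage_modes x y z) (stage_modes x y z).
Proof.
move=> hs.
have hsA i : 0 <= s (freq (kA i)) <= S.
  apply: (hs (Mode (kA i) 0 (x *: slab_vec p (kA i)))).
  rewrite /stage_modes !mem_cat; apply/orP; left; rewrite -map_comp.
  by apply/mapP; exists i => //; rewrite mem_enum.
have hsB i : 0 <= s (freq (kB i)) <= S.
  apply: (hs (Mode (kB i) 0 (y *: slab_vec p' (kB i)))).
  rewrite /stage_modes !mem_cat; apply/orP; right; apply/orP; left.
  by rewrite -map_comp; apply/mapP; exists i => //; rewrite mem_enum.
have hsC i : 0 <= s (freq (kC i)) <= S.
  apply: (hs (Mode (kC i) (- (pi / 2)) (z *: shear_vec (kC i)))).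
  rewrite /stage_modes !mem_cat; apply/orP; right; apply/orP; right.
  by rewrite -map_comp; apply/mapP; exists i => //; rewrite mem_enum.
have := pairing_stage (fun=> 1) x y z x y z; rewrite mult_mode1 => ->.
rewrite pairing_stage.
have v0 : 0 <= vol R d / 2 by have := vol_gt0 R d; lra.
have sum_le (I0 : finType) (k : I0 -> F) (a : I0 -> E) (c : R) :
    (forall i, 0 <= s (freq (k i)) <= S) ->
  0 <= c * c * (\sum_i s (freq (k i)) * dot (a i) (a i)) <=
    S * (c * c * (\sum_i 1 * dot (a i) (a i))).
  move=> h; apply/andP; split.
    rewrite mulr_ge0 -?expr2 ?sqr_ge0// sumr_ge0// => i _.
    by case/andP: (h i) => *; rewrite mulr_ge0 ?dot_ge0.
  rewrite mulrCA ler_wpM2l -?expr2 ?sqr_ge0// mulr_sumr ler_sum// => i _.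
  by case/andP: (h i) => *; rewrite mul1r ler_wpM2r ?dot_ge0.
have /andP[a0 a1] := sum_le _ _ (fun i => slab_vec p (kA i)) x hsA.
have /andP[b0 b1] := sum_le _ _ (fun i => slab_vec p' (kB i)) y hsB.
have /andP[c0 c1] := sum_le _ _ (fun i => shear_vec (kC i)) z hsC.
apply/andP; split; first by rewrite mulr_ge0// !addr_ge0.
by rewrite mulrCA ler_wpM2l// !mulrDr; apply: lerD c1; apply: lerD a1 b1.
Qed.

End three_families.
End stage.

(** * Amplitudes and scales of the cascade *)

(** Positivity and nonvanishing side conditions, from the signs in the
    context. *)
Ltac pos :=
  lazymatch goal with
  | |- is_true (_ && _) => apply/andP; split; pos
  | |- is_true (0 <= _ * _) => apply: mulr_ge0; pos
  | |- is_true (0 <= _ ^+ _) => first [exact: sqr_ge0 | apply: exprn_ge0; pos]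
  | |- is_true (0 <= _ ^-1) => rewrite invr_ge0; pos
  | |- is_true (0 <= _ + _) => apply: addr_ge0; pos
  | |- is_true (0 <= `|_|) => exact: normr_ge0
  | |- is_true (0 <= _%:R) => exact: ler0n
  | |- is_true (0 < _ * _) => apply: mulr_gt0; pos
  | |- is_true (0 < _ ^+ _) => apply: exprn_gt0; pos
  | |- is_true (0 < _ ^-1) => rewrite invr_gt0; pos
  | |- is_true (0 < _ + _) => apply: addr_gt0; pos
  | |- is_true (_ != 0) => apply: lt0r_neq0; pos
  | |- _ => first [done | exact: ltW | lra]
  end.

Section ramps.
Context {R : realType}.
Implicit Types a : @amplitude R.

Lemma derive1_is (f : R -> R) (t df : R) : is_derive t 1 f df -> derive1 f t = df.
Proof. by move=> h; rewrite derive1E; case: h. Qed.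

Lemma amp_deriv_scale (c : R) a t : amp_deriv (amp_scale c a) t = c * amp_deriv a t.
Proof.
apply: derive1_is; apply: (@is_deriveZ _ _ _ a); exact: (smooth1_is_derive _ (aP a)).
Qed.

Lemma derive1_chain (g f : R -> R) t dg df : is_derive (f t) 1 g dg -> is_derive t 1 f df ->
  derive1 (fun s => g (f s)) t = df * dg.
Proof.
move=> sg sf; apply: derive1_is.
by have := @is_derive1_comp R g f t dg df sg sf; rewrite mulrC.
Qed.

Lemma is_derive_affine (k c t : R) : is_derive t 1 (fun x : R => k * x + c) k.
Proof.
have -> : (fun x : R => k * x + c) = (k \*: @id R) + cst c by [].
rewrite -[X in is_derive _ _ _ X]addr0 -[X in is_derive _ _ _ (X + _)]mulr1.
exact: is_deriveD.
Qed.

(** The rotation angle of a turnover, run at speed [k]. *)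
Definition amp_ramp (k c : R) : amplitude :=
  Amplitude (smooth1_comp (@smooth1_angle R) (smooth1_affine k c)).
Definition amp_cos a := Amplitude (smooth1_comp (@smooth1_cos R) (aP a)).
Definition amp_sin a := Amplitude (smooth1_comp (@smooth1_sin R) (aP a)).

Lemma amp_deriv_cos a t : amp_deriv (amp_cos a) t = amp_deriv a t * - sin (a t).
Proof. by apply: (@derive1_chain cos a); exact: (smooth1_is_derive _ (aP a)). Qed.

Lemma amp_deriv_sin a t : amp_deriv (amp_sin a) t = amp_deriv a t * cos (a t).
Proof. by apply: (@derive1_chain sin a); exact: (smooth1_is_derive _ (aP a)). Qed.

Lemma amp_deriv_ramp k c t : amp_deriv (amp_ramp k c) t = k * derive1 angle (k * t + c).
Proof.
have -> : amp_deriv (amp_ramp k c) t = derive1 (fun s => angle (k * s + c)) t by [].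
apply: (@derive1_chain angle (fun t => k * t + c) t (derive1 angle (k * t + c)) k).
  exact: (smooth1_is_derive _ (@smooth1_angle R)).
exact: is_derive_affine.
Qed.

Lemma amp_deriv2_ramp k c t : amp_deriv (amp_deriv (amp_ramp k c)) t =
  k ^+ 2 * derive1 (derive1 angle) (k * t + c).
Proof.
have sa := smooth1_derive1 (@smooth1_angle R).
have E : aval (amp_deriv (amp_ramp k c)) = aval (amp_scale k
    (Amplitude (smooth1_comp sa (smooth1_affine k c)))).
  by apply/funext => s; rewrite amp_deriv_ramp.
have -> : amp_deriv (amp_deriv (amp_ramp k c)) t = derive1 (aval (amp_deriv (amp_ramp k c))) t by [].
rewrite E -[LHS]/(amp_deriv (amp_scale _ _) t) amp_deriv_scale expr2 -mulrA; congr (_ * _).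
apply: (@derive1_chain (derive1 angle) (fun t => k * t + c)).
  exact: (smooth1_is_derive _ sa).
exact: is_derive_affine.
Qed.

Lemma angle_derivs_bounded : exists2 G : R, 1 <= G &
  forall t, `|derive1 angle t| <= G /\ `|derive1 (derive1 angle) t| <= G.
Proof.
have s1 := smooth1_derive1 (@smooth1_angle R).
have [C1 C10 h1] := smooth1_supp_bounded s1 (@angle'_out R).
have [C2 C20 h2] := smooth1_supp_bounded (smooth1_derive1 s1) (@angle''_out R).
exists (1 + C1 + C2); first lra.
by move=> t; split; [apply: le_trans (h1 t) _|apply: le_trans (h2 t) _]; lra.
Qed.

Lemma freeze_scale (d : nat) t a (U : seq (@mode R d)) : freeze t (tscale a U) = map (scale_mode (a t)) U.
Proof. by rewrite /freeze /tscale -map_comp. Qed.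

Lemma tderiv_scale (d : nat) a (U : seq (@mode R d)) : tderiv (tscale a U) = tscale (amp_deriv a) U.
Proof. by rewrite /tderiv /tscale -map_comp. Qed.

End ramps.

Section scales.
Context {R : realType}.
Variables (D : nat) (T : R).

(** The shift by 6 makes the first step 64, which is the room that
    [triad_arith] asks for. *)
Definition step (n : nat) : nat := 2 ^ (n + 6).
Definition stepR n : R := (step n)%:R.
(** Up to a constant, the maximum of the velocity in the n-th stage. *)
Definition peak n : R := stepR n ^+ D.

Lemma stepS n : step n.+1 = (2 * step n)%N.
Proof. by rewrite /step addSn expnS. Qed.

Lemma step_gt0 n : (0 < step n)%N. Proof. by rewrite expn_gt0. Qed.

Lemma step64 n : (64 <= step n)%N.
Proof. by rewrite /step expnD (leq_trans _ (leq_pmull _ _)) ?expn_gt0. Qed.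

Lemma b_gt0 n : 0 < stepR n. Proof. by rewrite ltr0n step_gt0. Qed.
Lemma b_ge1 n : 1 <= stepR n. Proof. by rewrite ler1n step_gt0. Qed.
Lemma X_gt0 n : 0 < peak n. Proof. by rewrite exprn_gt0 ?b_gt0. Qed.
Lemma bS n : stepR n.+1 = 2 * stepR n. Proof. by rewrite /stepR stepS natrM. Qed.
Lemma XS n : peak n.+1 = 2 ^+ D * peak n. Proof. by rewrite /peak bS exprMn. Qed.

Lemma pow_bV n k : 0 <= (stepR n ^+ k)^-1 <= 1.
Proof.
have b1 := b_ge1 n; rewrite invr_ge0 exprn_ge0 ?(le_trans _ b1)//=.
by rewrite invf_le1 ?exprn_gt0 ?(lt_le_trans _ b1)// exprn_ege1.
Qed.

(** Normalisation: the first stage begins when half of the time is left. *)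
Definition kap : R := stepR 0 ^+ 5 / peak 0 ^+ 2.
(** Remaining time at the beginning of a stage; it is proportional to the
    turnover time of the shear that is active in that stage. *)
Definition rem n : R := T / 2 * (stepR n ^+ 5 / peak n ^+ 2) / kap.
Definition t_ n : R := T - rem n.

Hypothesis T0 : 0 < T.

Lemma kap_gt0 : 0 < kap.
Proof. by rewrite divr_gt0// exprn_gt0// ?b_gt0 ?X_gt0. Qed.
Lemma rem_gt0 n : 0 < rem n.
Proof. by rewrite divr_gt0 ?kap_gt0// mulr_gt0 ?divr_gt0// exprn_gt0// ?b_gt0 ?X_gt0. Qed.
Lemma rem0 : rem 0 = T / 2.
Proof. by rewrite /rem -/kap mulfK// gt_eqF// kap_gt0. Qed.
Lemma remS n : (27 <= D)%N -> rem n.+1 <= rem n / 4.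
Proof.
move=> D27; have X0 := X_gt0 n; have B0 := b_gt0 n.
have -> : rem n.+1 = (32 / (2 ^+ D) ^+ 2) * rem n.
  rewrite /rem bS XS; field; rewrite gt_eqF ?kap_gt0//= gt_eqF//= gt_eqF//.
rewrite mulrC ler_pM2l ?rem_gt0// ler_pdivrMr ?exprn_gt0//.
have h : 2 ^+ 4 <= 2 ^+ D :> R by rewrite ler_weXn2l ?ler1n//; lia.
have : (2 ^+ 4) ^+ 2 <= (2 ^+ D) ^+ 2 :> R.
  by rewrite ler_pXn2r ?nnegrE// ?exprn_ge0.
lra.
Qed.

End scales.

(** * The stages of the cascade *)

Section cascade_modes.
Context {R : realType} {d : nat}.
Local Notation E := 'rV[R]_d.
Local Notation F := 'rV[int]_d.
Local Notation mode := (@mode R d).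
Variables (e : nat) (o p0 p1 : 'I_d).
Hypotheses (e3 : (3 <= e)%N) (d3 : (3 <= d)%N)
  (op0 : o != p0) (op1 : o != p1) (p01 : p0 != p1).

Let D := (3 * d * e)%N.
Local Notation stepR := (@stepR R).
Definition axis (n : nat) := if odd n then p1 else p0.
(** With b = [step n], a slab has b^(6 e) points in each direction, at mutual
    distance b, and starts at distance b^(D - 3) from the origin along its
    axis. So it has b^(6 d e) = (b^D)^2 points, and its thickness b^(6 e + 1)
    is negligible. *)
Definition width (n : nat) : nat := 2 ^ ((n + 6) * (6 * e)).
Definition dist (n : nat) : nat := 2 ^ ((n + 6) * (D - 3)).
Definition slab n : finType := {ffun 'I_d -> 'I_(width n)}.
Definition shear n : finType := {ffun 'I_d -> 'I_(width n + 2 * width n.+1)}.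

Definition slab_freq n (i : slab n) : F :=
  \row_r ((dist n)%:Z * (r == axis n)%:R + (step n)%:Z * (i r)%:Z).
Definition shear_freq n (m : shear n) : F :=
  \row_r ((dist n.+1)%:Z * (r == axis n.+1)%:R - (dist n)%:Z * (r == axis n)%:R
          + (step n)%:Z * ((m r)%:Z - (width n)%:Z)).

Lemma tau_ltn n (i : 'I_(width n)) (j : 'I_(width n.+1)) :
  (2 * j + (width n - i) < width n + 2 * width n.+1)%N.
Proof. have := ltn_ord i; have := ltn_ord j; lia. Qed.

(** The lattice of a slab refines that of the next one, as steps double; the
    box of shear indices is large enough for all the differences. *)
Definition tau n (i : slab n) (j : slab n.+1) : shear n :=
  [ffun r => Ordinal (tau_ltn (i r) (j r))].

Lemma width_gt0 n : (0 < width n)%N. Proof. by rewrite expn_gt0. Qed.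

Lemma tauE n (i : slab n) (j : slab n.+1) : shear_freq (tau i j) = slab_freq j - slab_freq i :> F.
Proof.
apply/rowP => r; rewrite !mxE ffunE /= stepS; have := ltn_ord (i r).
move: (i r) (j r) => a b; set x := _ * _%:R; set y := _ * _%:R; lia.
Qed.

Lemma slab_freq_inj n : injective (@slab_freq n).
Proof.
move=> i j /rowP h; apply/ffunP => r; apply/val_inj => /=.
move: (h r); rewrite !mxE => /addrI /mulfI h'.
have s0 : (step n)%:Z != 0 by rewrite eqz_nat; have := step_gt0 n; lia.
by have := h' s0; case.
Qed.

Lemma shear_freq_inj n : injective (@shear_freq n).
Proof.
move=> i j /rowP h; apply/ffunP => r; apply/val_inj => /=.
move: (h r); rewrite !mxE => /addrI /mulfI h'.
have s0 : (step n)%:Z != 0 by rewrite eqz_nat; have := step_gt0 n; lia.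
by have /addIr := h' s0; case.
Qed.

Lemma axisS n : axis n != axis n.+1 /\ (o != axis n).
Proof.
rewrite /axis /=; case: odd => /=; split => //; by rewrite eq_sym.
Qed.

Definition lamR n : R := (dist n)%:R.
Definition muR n : R := (step n.+1 * width n.+1)%:R.

(** Even the thickness of the next slab, relative to the distance of this one,
    is at most the inverse of the step. *)
Lemma mu_lam_nat n : (step n * (step n.+1 * width n.+1) <= dist n)%N.
Proof.
rewrite /step /width /dist -!expnD leq_exp2l// /D.
have : (9 * e <= 3 * d * e)%N by nia.
nia.
Qed.

Lemma lam_le_nat n : (dist n <= dist n.+1)%N.
Proof. by rewrite /dist leq_exp2l// leq_mul2r; apply/orP; right; lia. Qed.

Lemma lam_gt0 n : 0 < lamR n. Proof. by rewrite /lamR ltr0n expn_gt0. Qed.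
Lemma mu_ge0 n : 0 <= muR n. Proof. by rewrite ler0n. Qed.

Lemma mu_lam n : 64 * muR n <= lamR n.
Proof.
rewrite -natrM ler_nat; apply: leq_trans (mu_lam_nat n).
by rewrite leq_mul2r step64 orbT.
Qed.

Lemma lam_le n : lamR n <= lamR n.+1. Proof. by rewrite ler_nat lam_le_nat. Qed.

Lemma width_le n : (step n * width n <= step n.+1 * width n.+1)%N.
Proof.
apply: leq_mul; rewrite leq_exp2l//; lia.
Qed.

Lemma slab_coordE n (i : slab n) r : exists2 v : R, `|v| <= (step n * width n)%:R &
  (slab_freq i 0 r)%:~R = lamR n * (r == axis n)%:R + v.
Proof.
exists ((step n * i r)%:R).
  by rewrite ger0_norm ?ler0n// ler_nat leq_mul2l (ltnW (ltn_ord _)) orbT.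
have -> : (step n * i r)%:R = (step n)%:R * (i r)%:R :> R by exact: natrM.
by rewrite mxE rmorphD/= !rmorphM/=; case: eqP.
Qed.

Lemma shear_coordE n (m : shear n) r : exists2 v : R, `|v| <= muR n &
  (shear_freq m 0 r)%:~R = lamR n.+1 * (r == axis n.+1)%:R
    - lamR n * (r == axis n)%:R + v.
Proof.
exists ((step n)%:R * ((m r)%:R - (width n)%:R)).
  have -> : muR n = (step n)%:R * (2 * width n.+1)%:R by rewrite /muR stepS !natrM; ring.
  rewrite normrM ger0_norm ?ler0n//.
  rewrite ler_wpM2l ?ler0n// ler_norml.
  have := ltn_ord (m r); move/ltnW; rewrite -(ler_nat R) natrD natrM => h.
  have w1 : (width n)%:R <= (width n.+1)%:R :> R.
    by rewrite ler_nat leq_exp2l// leq_mul2r; apply/orP; right; lia.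
  have m0 : 0 <= (m r)%:R :> R by rewrite ler0n.
  have w0 : 0 <= (width n)%:R :> R by rewrite ler0n.
  apply/andP; split; lra.
by rewrite mxE !rmorphD/= rmorphN/= !rmorphM/= rmorphB/=;
  congr (_ * _ - _ * _ + _); case: eqP.
Qed.

Lemma slab_near n (i : slab n) : near_int (lamR n) (step n * width n)%:R 1 (slab_freq i 0 (axis n)).
Proof.
have [v hv vE] := slab_coordE i (axis n).
by rewrite /near_int vE eqxx mulr1 mul1r addrC addKr.
Qed.

Lemma slab_out n (i : slab n) r : r != axis n ->
  `|(slab_freq i 0 r)%:~R : R| <= (step n * width n)%:R.
Proof.
by move=> /negbTE h; have [v hv ->] := slab_coordE i r; rewrite h mulr0 add0r.
Qed.

Lemma near_le (l m m' : R) c k : m <= m' -> near_int l m c k -> near_int l m' c k.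
Proof. by move=> mm h; exact: le_trans h mm. Qed.

Let A_p n (i : slab n) : near_int (lamR n) (muR n) 1 (slab_freq i 0 (axis n)).
Proof. by apply: near_le (slab_near i); rewrite ler_nat width_le. Qed.

Let A_r n (i : slab n) r : r != axis n -> `|(slab_freq i 0 r)%:~R : R| <= muR n.
Proof. by move/(slab_out i) => h; apply: le_trans h _; rewrite ler_nat width_le. Qed.

Let B_p n (i : slab n.+1) : near_int (lamR n.+1) (muR n) 1 (slab_freq i 0 (axis n.+1)).
Proof. exact: slab_near. Qed.

Let B_r n (i : slab n.+1) r : r != axis n.+1 -> `|(slab_freq i 0 r)%:~R : R| <= muR n.
Proof. exact: slab_out. Qed.

Let C_p n (m : shear n) : near_int (lamR n) (muR n) (-1) (shear_freq m 0 (axis n)).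
Proof.
have [v hv vE] := shear_coordE m (axis n); have [/negbTE h _] := axisS n.
by rewrite /near_int vE h eqxx mulr0 mulr1 mulN1r opprK add0r addrC addrA subrr add0r.
Qed.

Let C_p' n (m : shear n) : near_int (lamR n.+1) (muR n) 1 (shear_freq m 0 (axis n.+1)).
Proof.
have [v hv vE] := shear_coordE m (axis n.+1); have [/negbTE h _] := axisS n.
by rewrite /near_int vE eqxx eq_sym h mulr0 mulr1 mul1r subr0 addrC addKr.
Qed.

Let C_r n (m : shear n) r : r != axis n -> r != axis n.+1 ->
  `|(shear_freq m 0 r)%:~R : R| <= muR n.
Proof.
move=> /negbTE h /negbTE h'; have [v hv ->] := shear_coordE m r.
by rewrite h h' !mulr0 subr0 add0r.
Qed.

Definition smodes n x y z : seq mode :=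
  stage_modes o (axis n) (axis n.+1) (@slab_freq n) (@slab_freq n.+1) (@shear_freq n) x y z.

Let pp n := (axisS n).1.
Let op n := (axisS n).2.

Lemma card_slab n : #|slab n|%:R = stepR n ^+ D ^+ 2 :> R.
Proof.
rewrite card_ffun !card_ord /stepR -!natrX; congr (_%:R).
rewrite /width /step -!expnM; congr (2 ^ _)%N; rewrite /D; lia.
Qed.

Lemma slab_card_gt0 n : (0 < #|slab n|)%N.
Proof. by rewrite card_ffun !card_ord expn_gt0 width_gt0. Qed.

Lemma shear_card n : #|shear n|%:R <= 3 ^+ d * (stepR n.+1 ^+ D ^+ 2) :> R.
Proof.
rewrite -card_slab !card_ffun !card_ord -natrX -natrM ler_nat -expnMn leq_exp2r; last lia.
have : (width n <= width n.+1)%N.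
  by rewrite leq_exp2l// leq_mul2r; apply/orP; right; lia.
lia.
Qed.

Lemma smodes_div_free n x y z : div_free (smodes n x y z).
Proof.
exact: (stage_div_free (lam_gt0 n) (mu_ge0 n) (mu_lam n) (lam_le n) (@A_p n) (@B_p n)).
Qed.

Lemma smodes_freq_le n x y z m : m \in smodes n x y z ->
  dot (freq (fr m)) (freq (fr m)) <= d%:R * (4 * lamR n.+1 ^+ 2).
Proof.
exact: (stage_freq_le (lam_gt0 n) (mu_ge0 n) (mu_lam n) (lam_le n) (@A_p n) (@A_r n)
  (@B_p n) (@B_r n) (@C_p n) (@C_p' n) (@C_r n)).
Qed.

Lemma smodes_freq_ge n x y z m : m \in smodes n x y z ->
  lamR n ^+ 2 / 4 <= dot (freq (fr m)) (freq (fr m)).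
Proof.
exact: (stage_freq_ge (lam_gt0 n) (mu_ge0 n) (mu_lam n) (lam_le n) (@A_p n) (@B_p n) (@C_p n)).
Qed.

Lemma smodes_l1 n x y z : l1 (smodes n x y z) <=
  2 * (`|x| * #|slab n|%:R + `|y| * #|slab n.+1|%:R + `|z| * #|shear n|%:R * lamR n.+1).
Proof.
exact: (stage_l1 (op n) (op n.+1) (pp n) (lam_gt0 n) (mu_ge0 n) (mu_lam n) (lam_le n)
 (@tauE n) (@A_p n) (@A_r n) (@B_p n) (@B_r n) (@C_p n) (@C_p' n) x y z
 (slab_card_gt0 n) (slab_card_gt0 n.+1)).
Qed.

Lemma smodes_symbol n s (S : R) x y z :
  (forall m, m \in smodes n x y z -> 0 <= s (freq (fr m)) <= S) ->
  0 <= pairing (map (mult_mode s) (smodes n x y z)) (smodes n x y z)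
    <= S * pairing (smodes n x y z) (smodes n x y z).
Proof.
exact: (stage_symbol (pp n) (lam_gt0 n) (mu_ge0 n) (mu_lam n) (lam_le n)
  (@slab_freq_inj n) (@slab_freq_inj n.+1) (@shear_freq_inj n) (@A_p n) (@A_r n)
  (@B_p n) (@B_r n) (@C_p n) (@C_p' n)).
Qed.

(** The distances of the slabs are multiples of the step, and so is the next
    step. *)
Lemma smodes_lattice n x y z m r : m \in smodes n x y z ->
  exists q : int, fr m 0 r = (step n)%:Z * q.
Proof.
have D3 : (1 <= D - 3)%N.
  have : (9 * e <= 3 * d * e)%N by nia.
  rewrite /D; lia.
have dv j : (n <= j)%N -> exists q : nat, dist j = (step n * q)%N.
  move=> nj; exists (2 ^ ((j + 6) * (D - 3) - (n + 6)))%N.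
  by rewrite /dist /step -expnD; congr (2 ^ _)%N; nia.
have [q1 e1] := dv n (leqnn n); have [q2 e2] := dv n.+1 (leqnSn n).
case/mem_stage => [] [c [i ->]] /=; rewrite mxE.
- by rewrite e1 PoszM -mulrA -mulrDr; eexists.
- have -> : Posz (step n.+1) = (step n)%:Z * 2 by rewrite stepS PoszM mulrC.
  by rewrite e2 PoszM -!mulrA -mulrDr; eexists.
- by rewrite e1 e2 !PoszM -!mulrA -mulrBr -mulrDr; eexists.
Qed.

Definition smodes_work n := stage_work (op n) (op n.+1) (pp n) (lam_gt0 n) (mu_ge0 n)
  (mu_lam n) (lam_le n) (@tauE n) (@slab_freq_inj n) (@slab_freq_inj n.+1)
  (@shear_freq_inj n) (@A_p n) (@A_r n) (@B_p n) (@B_r n) (@C_p n) (@C_p' n).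
Definition smodes_energy n := stage_energy (op n) (op n.+1) (pp n) (lam_gt0 n) (mu_ge0 n)
  (mu_lam n) (lam_le n) (@tauE n) (@slab_freq_inj n) (@slab_freq_inj n.+1)
  (@shear_freq_inj n) (@A_p n) (@A_r n) (@B_p n) (@B_r n) (@C_p n) (@C_p' n).

Local Notation b := stepR.
Local Notation X := (@peak R D).
Local Notation X_gt0 := (@X_gt0 R D).
Local Notation b_gt0 := (@b_gt0 R).
Local Notation b_ge1 := (@b_ge1 R).
Local Notation XS := (@XS R D).

Lemma D27 : (27 <= D)%N.
Proof. have : (9 * e <= 3 * d * e)%N by nia. rewrite /D; nia. Qed.
Lemma lamE n : lamR n = X n / b n ^+ 3.
Proof.
apply: (canRL (mulfK _)); first by rewrite expf_neq0 ?gt_eqF ?b_gt0.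
rewrite /lamR /peak /stepR -!natrX -natrM; congr (_%:R).
rewrite /dist /step -!expnM -expnD; congr (2 ^ _)%N; have := D27; nia.
Qed.
Lemma lamS n : lamR n.+1 <= 2 ^+ D * (X n / b n ^+ 3).
Proof.
rewrite lamE XS bS exprMn invfM -!mulrA ler_wpM2l ?exprn_ge0//.
rewrite ler_pM2l ?X_gt0// ler_piMl ?invr_ge0 ?exprn_ge0 ?(ltW (b_gt0 _))//.
by rewrite invf_le1; lra.
Qed.
Lemma mu_lamE n : muR n / lamR n <= (b n)^-1.
Proof.
rewrite ler_pdivrMr ?lam_gt0// mulrC ler_pdivlMr ?b_gt0//.
by rewrite mulrC -natrM ler_nat mu_lam_nat.
Qed.

Variable (T : R) (T0 : 0 < T).
Local Notation rem := (rem D T).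
Local Notation t_ := (t_ D T).
Local Notation kap := (@kap R D).
Local Notation rem_gt0 := (@rem_gt0 R D T T0).
Local Notation kap_gt0 := (@kap_gt0 R D).

Definition amp_angle n : amplitude := amp_ramp (2 / rem n) (- (2 / rem n * t_ n)).

(** This factor solves the third equation of [stage_work], when the rate of
    the transfer is the product of the sine, the cosine and the derivative of
    the angle. *)
Definition zcoef n : R := 2 / (X n * X n.+1 * (lamR n * lamR n.+1)).
Definition amp_old n := amp_scale (X n)^-1 (amp_cos (amp_angle n)).
Definition amp_new n := amp_scale (X n.+1)^-1 (amp_sin (amp_angle n)).
Definition amp_shear n := amp_scale (zcoef n) (amp_deriv (amp_angle n)).

Definition stage n : tfield :=
  tscale (amp_old n) (famA o (axis n) (@slab_freq n)) ++
  tscale (amp_new n) (famB o (axis n.+1) (@slab_freq n.+1)) ++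
  tscale (amp_shear n) (famC (axis n) (axis n.+1) (@shear_freq n)).

Lemma freeze_stage n t : freeze t (stage n) =
  smodes n (amp_old n t) (amp_new n t) (amp_shear n t).
Proof. by rewrite /stage !freeze_cat !freeze_scale. Qed.

Lemma freeze_dstage n t : freeze t (tderiv (stage n)) =
  smodes n (amp_deriv (amp_old n) t) (amp_deriv (amp_new n) t) (amp_deriv (amp_shear n) t).
Proof.
have tderiv_cat l l' : tderiv (l ++ l') = tderiv l ++ tderiv l' by exact: map_cat.
by rewrite /stage !tderiv_cat !tderiv_scale !freeze_cat !freeze_scale.
Qed.

Local Notation dth n := (amp_deriv (amp_angle n)).
Local Notation ddth n := (amp_deriv (amp_deriv (amp_angle n))).

Lemma amp_deriv_old n t : amp_deriv (amp_old n) t =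
  - ((X n)^-1 * (dth n t * sin (amp_angle n t))).
Proof. by rewrite amp_deriv_scale amp_deriv_cos !mulrN. Qed.

Lemma amp_deriv_new n t : amp_deriv (amp_new n) t = (X n.+1)^-1 * (dth n t * cos (amp_angle n t)).
Proof. by rewrite amp_deriv_scale amp_deriv_sin. Qed.

Lemma ramp_arg n t : 2 / rem n * t + - (2 / rem n * t_ n) = 2 / rem n * (t - t_ n).
Proof. ring. Qed.

Lemma angle_before n t : t <= t_ n -> amp_angle n t = 0.
Proof.
move=> h; apply: angle_le0; rewrite ramp_arg pmulr_rle0 ?subr_le0//.
by rewrite divr_gt0// rem_gt0.
Qed.

Lemma angle_after n t : t_ n + rem n / 2 <= t -> amp_angle n t = pi / 2.
Proof.
move=> h; apply: angle_ge1; rewrite ramp_arg mulrAC ler_pdivlMr ?rem_gt0//.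
by have := rem_gt0 n; lra.
Qed.

Lemma angle_deriv_out n t : t < t_ n \/ t_ n + rem n / 2 < t -> dth n t = 0.
Proof.
move=> h; rewrite amp_deriv_ramp ramp_arg angle'_out ?mulr0//.
have r0 := rem_gt0 n; case: h => h; [left|right].
  by rewrite pmulr_rlt0 ?subr_lt0// divr_gt0.
by rewrite mulrAC ltr_pdivlMr//; lra.
Qed.

Lemma sqr_le (x y : R) : 0 <= x -> x <= y -> x ^+ 2 <= y ^+ 2.
Proof. by move=> x0 xy; rewrite ler_pXn2r ?nnegrE//; exact: le_trans xy. Qed.

Lemma norm_sqr_le (x y : R) : `|x| <= y -> x ^+ 2 <= y ^+ 2.
Proof. by move=> xy; rewrite -real_normK ?num_real//; exact: sqr_le. Qed.

Lemma oldE n t : amp_old n t = (X n)^-1 * cos (amp_angle n t). Proof. by []. Qed.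
Lemma newE n t : amp_new n t = (X n.+1)^-1 * sin (amp_angle n t). Proof. by []. Qed.
Lemma shearE n t : amp_shear n t = zcoef n * dth n t. Proof. by []. Qed.

Section bounds.
Variable G : R.
Hypotheses (G1 : 1 <= G)
  (hG : forall t : R, `|derive1 angle t| <= G /\ `|derive1 (derive1 angle) t| <= G).

(** A bound for the first two derivatives of the angle, in units of the
    turnover rate X^2 / b^5 and of its square. *)
Definition Gam : R := G * (1 + 4 / T * kap) ^+ 2.
(** A bound for the number of shear modes in units of X^2. *)
Definition K0 : R := 3 ^+ d * (2 ^+ D) ^+ 2.

Let k0 := 1 + 4 / T * kap.
Let k01 : 1 <= k0.
Proof. by have := kap_gt0; rewrite /k0 lerDl => ?; pos. Qed.

Lemma Gam1 : 1 <= Gam.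
Proof.
have h : 1 <= k0 ^+ 2 by exact: exprn_ege1.
by rewrite /Gam -/k0 -[X in X <= _]mulr1; apply: ler_pM.
Qed.
Lemma K01 : 1 <= K0.
Proof.
have h1 : 1 <= 3 ^+ d :> R by rewrite exprn_ege1// ler1n.
have h2 : 1 <= (2 ^+ D) ^+ 2 :> R by rewrite !exprn_ege1// ler1n.
by rewrite /K0 -[X in X <= _]mulr1; apply: ler_pM.
Qed.
Lemma L01 : 1 <= 2 ^+ D :> R. Proof. by rewrite exprn_ege1// ler1n. Qed.

Lemma speedE n : 2 / rem n = 4 / T * kap * (X n ^+ 2 / b n ^+ 5).
Proof.
have k1 := kap_gt0; have X1 := X_gt0 n; have b1 := b_gt0 n.
have T1 := T0; rewrite /rem; field; pos.
Qed.

Lemma angle_deriv_le n t : `|dth n t| <= Gam * (X n ^+ 2 / b n ^+ 5).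
Proof.
have X1 := X_gt0 n; have b1 := b_gt0 n.
have q0 : 0 <= X n ^+ 2 / b n ^+ 5 by pos.
rewrite amp_deriv_ramp speedE normrM ger0_norm; last first.
  by have := kap_gt0; have := T0 => ? ?; pos.
rewrite mulrAC ler_wpM2r// /Gam mulrC.
have kk : 0 <= 4 / T * kap by have := kap_gt0; have := T0 => ? ?; pos.
apply: ler_pM => //; first exact: (hG _).1.
rewrite -/k0 expr2 -[X in X <= _]mulr1; apply: ler_pM => //.
by rewrite /k0 lerDr.
Qed.

Lemma angle_deriv2_le n t : `|ddth n t| <= Gam * (X n ^+ 4 / b n ^+ 10).
Proof.
have X1 := X_gt0 n; have b1 := b_gt0 n.
rewrite amp_deriv2_ramp normrM ger0_norm ?sqr_ge0// speedE.
have -> : (4 / T * kap * (X n ^+ 2 / b n ^+ 5)) ^+ 2 =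
   (4 / T * kap) ^+ 2 * (X n ^+ 4 / b n ^+ 10) by have T1 := T0; field; pos.
rewrite mulrAC; apply: ler_wpM2r; first by pos.
rewrite /Gam mulrC.
have kk : 0 <= 4 / T * kap by have := kap_gt0; have := T0 => ? ?; pos.
apply: ler_pM; [exact: normr_ge0|exact: sqr_ge0|by case: (hG (2 / rem n * t + - (2 / rem n * t_ n))); rewrite speedE|].
by rewrite ler_pXn2r ?nnegrE ?lerDr//; lra.
Qed.

Lemma zcoef_le n : 0 <= zcoef n <= b n ^+ 6 / X n ^+ 4.
Proof.
have X1 := X_gt0 n; have b1 := b_gt0 n; have l1' := L01.
have P (x : R) : 1 <= x -> x != 0 by move=> h; rewrite gt_eqF//; lra.
have D3 : (3 <= D)%N by have := D27; set D' := D; lia.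
rewrite /zcoef !lamE XS bS; apply/andP; split.
  by pos.
have -> : 2 / (X n * (2 ^+ D * X n) * (X n / b n ^+ 3 * (2 ^+ D * X n / (2 * b n) ^+ 3))) =
  b n ^+ 6 / X n ^+ 4 * (16 / (2 ^+ D) ^+ 2).
  by field; pos.
rewrite ger_pMr; last by pos.
rewrite ler_pdivrMr; last by pos.
rewrite mul1r.
have h : 2 ^+ 3 <= 2 ^+ D :> R by rewrite ler_weXn2l ?ler1n.
have : (2 ^+ 3) ^+ 2 <= (2 ^+ D) ^+ 2 :> R by rewrite ler_pXn2r ?nnegrE// ?exprn_ge0.
lra.
Qed.

Lemma shear_le n t : `|amp_shear n t| <= Gam * (b n / X n ^+ 2).
Proof.
have X1 := X_gt0 n; have b1 := b_gt0 n; have /andP[z0 z1] := zcoef_le n.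
rewrite normrM (ger0_norm z0).
have -> : Gam * (b n / X n ^+ 2) = b n ^+ 6 / X n ^+ 4 * (Gam * (X n ^+ 2 / b n ^+ 5)).
  by field; pos.
by apply: ler_pM => //; exact: angle_deriv_le.
Qed.

Lemma dshear_le n t : `|amp_deriv (amp_shear n) t| <= Gam * (b n ^+ 4)^-1.
Proof.
have X1 := X_gt0 n; have b1 := b_gt0 n; have /andP[z0 z1] := zcoef_le n.
rewrite amp_deriv_scale normrM (ger0_norm z0).
have -> : Gam * (b n ^+ 4)^-1 = b n ^+ 6 / X n ^+ 4 * (Gam * (X n ^+ 4 / b n ^+ 10)).
  by field; pos.
by apply: ler_pM => //; exact: angle_deriv2_le.
Qed.

Lemma old_sqr n t : amp_old n t ^+ 2 * #|slab n|%:R = cos (amp_angle n t) ^+ 2.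
Proof.
rewrite card_slab -/(X n) oldE exprMn mulrAC exprVn mulVf ?mul1r//.
by rewrite expf_neq0// gt_eqF// X_gt0.
Qed.

Lemma new_sqr n t : amp_new n t ^+ 2 * #|slab n.+1|%:R = sin (amp_angle n t) ^+ 2.
Proof.
rewrite card_slab -/(X n.+1) newE exprMn mulrAC exprVn mulVf ?mul1r//.
by rewrite expf_neq0// gt_eqF// X_gt0.
Qed.

(** The energy of the shear for unit amplitude, up to a constant. *)
Lemma unit_shear_energy_le n : #|shear n|%:R * (3 * lamR n.+1 ^+ 2) <=
  3 * K0 ^+ 3 * (X n ^+ 4 / b n ^+ 6).
Proof.
have X1 := X_gt0 n; have b1 := b_gt0 n; have h := L01; have k1 := K01.
have LK : 2 ^+ D <= K0.
  rewrite /K0; have -> : 3 ^+ d * 2 ^+ D ^+ 2 = (3 ^+ d * 2 ^+ D) * 2 ^+ D :> R by ring.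
  rewrite -[X in X <= _]mul1r ler_wpM2r ?exprn_ge0// -[X in X <= _]mulr1.
  by apply: ler_pM => //; rewrite exprn_ege1// ler1n.
have c := shear_card n; rewrite -/(X n.+1) XS exprMn mulrA -/K0 in c.
have l := lamS n.
have l0 := lam_gt0 n.+1.
have -> : 3 * K0 ^+ 3 * (X n ^+ 4 / b n ^+ 6) =
   K0 * X n ^+ 2 * (3 * (K0 * (X n / b n ^+ 3)) ^+ 2) by field; pos.
have q0 : 0 <= X n / b n ^+ 3 by rewrite divr_ge0 ?exprn_ge0 ?ltW.
apply: ler_pM => //; first by rewrite mulr_ge0 ?sqr_ge0.
rewrite ler_pM2l//; apply: sqr_le; first exact: ltW.
by apply: le_trans l _; rewrite ler_wpM2r.
Qed.

Lemma vol2_ge0 : 0 <= vol R d / 2. Proof. by rewrite divr_ge0// ltW// vol_gt0. Qed.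

(** The constant in the bounds for the energy of the shear. *)
Definition CK : R := 3 * Gam ^+ 2 * K0 ^+ 3.

Lemma CK_ge0 : 0 <= CK.
Proof. by have := Gam1; have := K01; rewrite /CK => ? ?; pos. Qed.

(** The turnover rate X^2 / b^5 times the relative thickness 1 / b of the
    slabs: filters barely see the turnover of a stage. *)
Lemma work_bound n t s : (forall k, 0 <= s k <= 1) ->
  `|pairing (map (mult_mode s) (freeze t (stage n))) (freeze t (tderiv (stage n)))
   + trilinear s (freeze t (stage n)) (freeze t (stage n)) (freeze t (stage n))|
  <= vol R d / 2 * (11 * Gam + CK) * (X n ^+ 2 / b n ^+ 6).
Proof.
move=> hs; have X1 := X_gt0 n; have b1 := b_gt0 n; have X2 := X_gt0 n.+1.
have l0 := lam_gt0 n; have l1 := lam_gt0 n.+1.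
pose g := dth n t * sin (amp_angle n t) * cos (amp_angle n t).
rewrite freeze_stage freeze_dstage.
have ln : 0 < b n by [].
apply: le_trans (@smodes_work n s _ _ _ _ _ _ g hs (slab_card_gt0 n) (slab_card_gt0 n.+1) _ _ _) _.
- by rewrite amp_deriv_old card_slab -/(X n) oldE /g; field; pos.
- by rewrite amp_deriv_new card_slab -/(X n.+1) newE /g; field; pos.
- by rewrite !card_slab -/(X n) -/(X n.+1) oldE newE shearE /zcoef /g; field; pos.
rewrite -[leRHS]mulrA; apply: ler_wpM2l; first exact: vol2_ge0.
rewrite [leRHS]mulrDl; apply: lerD.
  have -> : 11 * Gam * (X n ^+ 2 / b n ^+ 6) = Gam * (X n ^+ 2 / b n ^+ 5) * (11 * (b n)^-1).
    by field; pos.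
  apply: ler_pM => //.
  - by rewrite mulr_ge0// divr_ge0 ?mu_ge0// ltW.
  - rewrite /g -mulrA normrM -[leRHS]mulr1; apply: ler_pM => //; first exact: angle_deriv_le.
    rewrite normrM -[X in _ <= X]mulr1; apply: ler_pM => //.
      by rewrite ler_norml sin_geN1 sin_le1.
    by rewrite ler_norml cos_geN1 cos_le1.
  - by rewrite ler_wpM2l// mu_lamE.
have -> : CK * (X n ^+ 2 / b n ^+ 6) = Gam * (b n / X n ^+ 2) * (Gam * (b n ^+ 3 / b n ^+ 4))
   * (3 * K0 ^+ 3 * (X n ^+ 4 / b n ^+ 6)) / 1 by rewrite /CK; field; pos.
rewrite divr1.
apply: ler_pM => //; last exact: unit_shear_energy_le.
  by rewrite mulr_ge0// mulr_ge0 ?sqr_ge0.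
rewrite normrM; apply: ler_pM => //; first exact: shear_le.
apply: le_trans (dshear_le n t) _; rewrite ler_wpM2l//; first by have := Gam1; lra.
rewrite ler_peMl ?exprn_ege1 ?b_ge1//.
by have /andP[] := @pow_bV R n 4.
Qed.

Lemma shear_energy_le n t : amp_shear n t ^+ 2 * (#|shear n|%:R * (3 * lamR n.+1 ^+ 2))
   <= CK * (b n)^-1.
Proof.
have X1 := X_gt0 n; have b1 := b_gt0 n.
have -> : CK * (b n)^-1 = (Gam * (b n / X n ^+ 2)) ^+ 2 * (3 * K0 ^+ 3 * (X n ^+ 4 / b n ^+ 6))
   * (b n ^+ 3) by rewrite /CK; field; pos.
rewrite -[X in X <= _]mulr1; apply: ler_pM => //.
- by rewrite mulr_ge0 ?sqr_ge0// mulr_ge0// mulr_ge0 ?sqr_ge0.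
- apply: ler_pM => //; first exact: sqr_ge0.
  + by rewrite mulr_ge0// mulr_ge0 ?sqr_ge0.
  + exact/norm_sqr_le/shear_le.
  + exact: unit_shear_energy_le.
- by rewrite exprn_ege1// b_ge1.
Qed.

Lemma energy_near n t :
  `|pairing (freeze t (stage n)) (freeze t (stage n)) - vol R d / 2|
  <= vol R d / 2 * (1 + CK) * (b n)^-1.
Proof.
have := @smodes_energy n (amp_old n t) (amp_new n t) (amp_shear n t)
  (slab_card_gt0 n) (slab_card_gt0 n.+1).
rewrite old_sqr new_sqr cos2Dsin2 mulr1 freeze_stage => h.
apply: le_trans h _; rewrite -[leRHS]mulrA; apply: ler_wpM2l; first exact: vol2_ge0.
rewrite mul1r [leRHS]mulrDl mul1r.
by apply: lerD; [exact: mu_lamE|exact: shear_energy_le].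
Qed.

Lemma old_deriv_sqr n t : amp_deriv (amp_old n) t ^+ 2 * #|slab n|%:R
  + amp_deriv (amp_new n) t ^+ 2 * #|slab n.+1|%:R = dth n t ^+ 2.
Proof.
have X1 := X_gt0 n; have X2 := X_gt0 n.+1.
rewrite amp_deriv_old amp_deriv_new !card_slab -/(X n) -/(X n.+1).
rewrite -[RHS]mulr1 -(cos2Dsin2 (amp_angle n t)); field; pos.
Qed.

Lemma dt_energy n t :
  pairing (freeze t (tderiv (stage n))) (freeze t (tderiv (stage n)))
  <= vol R d / 2 * (2 * Gam ^+ 2 + CK) * (X n ^+ 4 / b n ^+ 10).
Proof.
have X1 := X_gt0 n; have b1 := b_gt0 n.
have := @smodes_energy n (amp_deriv (amp_old n) t) (amp_deriv (amp_new n) t)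
  (amp_deriv (amp_shear n) t) (slab_card_gt0 n) (slab_card_gt0 n.+1).
rewrite old_deriv_sqr freeze_dstage ler_norml lerBlDl => /andP[_ h].
apply: le_trans h _; rewrite -mulrDr -[leRHS]mulrA; apply: ler_wpM2l; first exact: vol2_ge0.
rewrite addrA [leRHS]mulrDl.
have q1 : dth n t ^+ 2 <= Gam ^+ 2 * (X n ^+ 4 / b n ^+ 10).
  have -> : Gam ^+ 2 * (X n ^+ 4 / b n ^+ 10) = (Gam * (X n ^+ 2 / b n ^+ 5)) ^+ 2.
    by field; pos.
  exact/norm_sqr_le/angle_deriv_le.
have ml : muR n / lamR n <= 1.
  by apply: le_trans (mu_lamE n) _; have /andP[_] := @pow_bV R n 1.
apply: lerD.
  rewrite mulr_natl mulr2n [leRHS]mulrDl; apply: lerD => //.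
  by apply: le_trans q1; rewrite ler_piMr ?sqr_ge0.
have -> : CK * (X n ^+ 4 / b n ^+ 10) = (Gam * (b n ^+ 4)^-1) ^+ 2 *
   (3 * K0 ^+ 3 * (X n ^+ 4 / b n ^+ 6)) * b n ^+ 4 by rewrite /CK; field; pos.
rewrite -[X in X <= _]mulr1; apply: ler_pM => //.
- by rewrite mulr_ge0 ?sqr_ge0// mulr_ge0// mulr_ge0 ?sqr_ge0.
- apply: ler_pM => //; first exact: sqr_ge0.
  + by rewrite mulr_ge0// mulr_ge0 ?sqr_ge0.
  + exact/norm_sqr_le/dshear_le.
  + exact: unit_shear_energy_le.
- by rewrite exprn_ege1// b_ge1.
Qed.

Lemma unit_shear_l1_le n : #|shear n|%:R * lamR n.+1 <= K0 ^+ 2 * (X n ^+ 3 / b n ^+ 3).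
Proof.
have X1 := X_gt0 n; have b1 := b_gt0 n; have h := L01; have k1 := K01.
have c := shear_card n; rewrite -/(X n.+1) XS exprMn mulrA -/K0 in c.
have LK : 2 ^+ D <= K0.
  rewrite /K0; have -> : 3 ^+ d * 2 ^+ D ^+ 2 = (3 ^+ d * 2 ^+ D) * 2 ^+ D :> R by ring.
  rewrite -[X in X <= _]mul1r ler_wpM2r ?exprn_ge0// -[X in X <= _]mulr1.
  by apply: ler_pM => //; rewrite exprn_ege1// ler1n.
have -> : K0 ^+ 2 * (X n ^+ 3 / b n ^+ 3) = K0 * X n ^+ 2 * (K0 * (X n / b n ^+ 3)).
  by field; pos.
apply: ler_pM; [exact: ler0n|exact/ltW/lam_gt0|exact: c|].
apply: le_trans (lamS n) _; apply: ler_pM => //; by pos.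
Qed.

Lemma l1_bound n t : l1 (freeze t (stage n)) <= 2 * (1 + 2 ^+ D + Gam * K0 ^+ 2) * X n.
Proof.
have X1 := X_gt0 n; have b1 := b_gt0 n; have X2 := X_gt0 n.+1.
rewrite freeze_stage; apply: le_trans (smodes_l1 n _ _ _) _.
rewrite -[leRHS]mulrA ler_pM2l// !card_slab -/(X n) -/(X n.+1) !mulrDl mul1r -XS.
have nV (x y : R) : 0 < x -> `|y| <= 1 -> `|x^-1 * y| * x ^+ 2 <= x.
  move=> x0 y1; have xV : 0 <= x^-1 by rewrite invr_ge0 ltW.
  rewrite normrM (ger0_norm xV).
  have -> : x^-1 * `|y| * x ^+ 2 = `|y| * x by field; pos.
  by rewrite ler_piMl// ltW.
apply: lerD; first apply: lerD.
- by apply: nV => //; rewrite ler_norml cos_geN1 cos_le1.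
- by apply: nV => //; rewrite ler_norml sin_geN1 sin_le1.
rewrite -mulrA; apply: le_trans (ler_pM _ _ (shear_le n t) (unit_shear_l1_le n)) _ => //.
  by rewrite mulr_ge0// ltW// lam_gt0.
have -> : Gam * (b n / X n ^+ 2) * (K0 ^+ 2 * (X n ^+ 3 / b n ^+ 3)) =
   Gam * K0 ^+ 2 * X n * (b n ^+ 2)^-1 by field; pos.
have /andP[_ h] := @pow_bV R n 2.
by rewrite ler_piMr//; have := Gam1 => ?; pos.
Qed.

Lemma dt_l1_bound n t : l1 (freeze t (tderiv (stage n))) <=
  2 * (Gam * (1 + 2 ^+ D) + Gam * K0 ^+ 2) * X n ^+ 3.
Proof.
have X1 := X_gt0 n; have b1 := b_gt0 n; have X2 := X_gt0 n.+1; have g1 := Gam1.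
rewrite freeze_dstage; apply: le_trans (smodes_l1 n _ _ _) _.
rewrite -[leRHS]mulrA ler_pM2l// !card_slab -/(X n) -/(X n.+1) !mulrDl.
have th : `|dth n t| <= Gam * X n ^+ 2.
  apply: le_trans (angle_deriv_le n t) _; rewrite ler_wpM2l//; first lra.
  by have /andP[_ h] := @pow_bV R n 5; rewrite ler_piMr// sqr_ge0.
have nV (x c : R) : 0 < x -> `|c| <= 1 ->
   `|x^-1 * (dth n t * c)| * x ^+ 2 <= Gam * X n ^+ 2 * x.
  move=> x0 y1; have xV : 0 <= x^-1 by rewrite invr_ge0 ltW.
  rewrite normrM (ger0_norm xV).
  have -> : x^-1 * `|dth n t * c| * x ^+ 2 = `|dth n t * c| * x by field; pos.
  rewrite ler_pM2r// normrM -[leRHS]mulr1; exact: ler_pM.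
have -> : Gam * (1 + 2 ^+ D) * X n ^+ 3 = Gam * X n ^+ 2 * X n + Gam * X n ^+ 2 * X n.+1.
  by rewrite XS; ring.
apply: lerD; first apply: lerD.
- by rewrite amp_deriv_old normrN; apply: nV => //; rewrite ler_norml sin_geN1 sin_le1.
- by rewrite amp_deriv_new; apply: nV => //; rewrite ler_norml cos_geN1 cos_le1.
rewrite -mulrA; apply: le_trans (ler_pM _ _ (dshear_le n t) (unit_shear_l1_le n)) _ => //.
  by rewrite mulr_ge0// ltW// lam_gt0.
have -> : Gam * (b n ^+ 4)^-1 * (K0 ^+ 2 * (X n ^+ 3 / b n ^+ 3)) =
   Gam * K0 ^+ 2 * X n ^+ 3 * (b n ^+ 7)^-1 by field; pos.
have /andP[_ h] := @pow_bV R n 7.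
by rewrite ler_piMr//; pos.
Qed.

Lemma freq_bound n x y z m : m \in smodes n x y z ->
  dot (freq (fr m)) (freq (fr m)) <= d%:R * 4 * (2 ^+ D) ^+ 2 * (X n ^+ 2 / b n ^+ 6).
Proof.
have X1 := X_gt0 n; have b1 := b_gt0 n.
move=> h; apply: le_trans (smodes_freq_le h) _.
have -> : d%:R * 4 * (2 ^+ D) ^+ 2 * (X n ^+ 2 / b n ^+ 6) =
  d%:R * (4 * (2 ^+ D * (X n / b n ^+ 3)) ^+ 2) by field; pos.
rewrite ler_wpM2l// ler_pM2l//; apply: sqr_le; first exact/ltW/lam_gt0.
exact: lamS.
Qed.

End bounds.

Definition slab_field n : E -> E :=
  fun x => (X n)^-1 *: ev (famA o (axis n) (@slab_freq n)) x.

(** Before and after its turnover a stage consists of a single slab, at rest.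
    *)
Lemma stage_old n t : t < t_ n -> tev (stage n) t = slab_field n.
Proof.
move=> h; apply/funext => x; rewrite /tev freeze_stage.
rewrite /smodes /stage_modes !ev_cat !ev_scale oldE newE shearE.
rewrite (angle_before (ltW h)) angle_deriv_out; last by left.
by rewrite cos0 sin0 !mulr0 mulr1 !scale0r !addr0.
Qed.

Lemma stage_new n t : t_ n + rem n / 2 < t -> tev (stage n) t = slab_field n.+1.
Proof.
move=> h; apply/funext => x; rewrite /tev freeze_stage.
rewrite /smodes /stage_modes !ev_cat !ev_scale oldE newE shearE.
rewrite (angle_after (ltW h)) angle_deriv_out; last by right.
by rewrite cos_pihalf sin_pihalf !mulr0 mulr1 !scale0r add0r addr0.
Qed.

Lemma stage_support n : [seq z.2 | z : amplitude * mode <- stage n] = smodes n 1 1 1.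
Proof.
have map2 a (U : seq mode) : [seq z.2 | z : amplitude * mode <- tscale a U] = U.
  by rewrite /tscale -map_comp map_id.
have s1 (U : seq mode) : map (scale_mode 1) U = U.
  by rewrite -[RHS]map_id; apply: eq_map => -[k q a]; rewrite /scale_mode /= scale1r.
by rewrite /stage !map_cat !map2 /smodes /stage_modes !s1.
Qed.

End cascade_modes.

(** * Existence of the cascade *)

Section cascade_interface.
Context {R : realType} {d : nat}.
Local Notation E := 'rV[R]_d.
Local Notation mode := (@mode R d).

(** What the construction of the solution uses of its stages; all the bounds
    are in terms of the step and the peak. *)
Record cascade (D : nat) (T C : R) (st : nat -> @tfield R d) (sl : nat -> E -> E)
    : Prop := Cascade {
  cas_div : forall n, tdiv_free (st n);
  cas_old : forall n t, t < t_ D T n -> tev (st n) t = sl n;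
  cas_new : forall n t, t_ D T n + rem D T n / 2 < t -> tev (st n) t = sl n.+1;
  cas_work : forall n t s, (forall k, 0 <= s k <= 1) ->
    `|pairing (map (mult_mode s) (freeze t (st n))) (freeze t (tderiv (st n)))
     + trilinear s (freeze t (st n)) (freeze t (st n)) (freeze t (st n))|
    <= C * (peak D n ^+ 2 / stepR n ^+ 6);
  cas_energy : forall n t,
    `|pairing (freeze t (st n)) (freeze t (st n)) - vol R d / 2| <= C * (stepR n)^-1;
  cas_dt_energy : forall n t,
    pairing (freeze t (tderiv (st n))) (freeze t (tderiv (st n)))
    <= C * (peak D n ^+ 4 / stepR n ^+ 10);
  cas_l1 : forall n t, l1 (freeze t (st n)) <= C * peak D n;
  cas_dt_l1 : forall n t, l1 (freeze t (tderiv (st n))) <= C * peak D n ^+ 3;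
  cas_symbol : forall n t s S,
    (forall m, m \in [seq z.2 | z : amplitude * mode <- st n] -> 0 <= s (freq (fr m)) <= S) ->
    0 <= pairing (map (mult_mode s) (freeze t (st n))) (freeze t (st n))
      <= S * pairing (freeze t (st n)) (freeze t (st n));
  cas_freq_le : forall n m, m \in [seq z.2 | z : amplitude * mode <- st n] ->
    dot (freq (fr m)) (freq (fr m)) <= C * (peak D n ^+ 2 / stepR n ^+ 6);
  cas_freq_ge : forall n m, m \in [seq z.2 | z : amplitude * mode <- st n] ->
    peak D n ^+ 2 / stepR n ^+ 6 / 4 <= dot (freq (fr m) : E) (freq (fr m));
  cas_lattice : forall n m r, m \in [seq z.2 | z : amplitude * mode <- st n] ->
    exists q : int, fr m 0 r = (step n)%:Z * q }.

Lemma cascade_exists (T : R) (e : nat) : (3 <= d)%N -> (3 <= e)%N -> 0 < T ->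
  exists C st sl, 1 <= C /\ cascade (3 * d * e) T C st sl.
Proof.
move=> d3 e3 T0.
pose o : 'I_d := Ordinal (leq_trans (isT : (0 < 3)%N) d3).
pose p0 : 'I_d := Ordinal (leq_trans (isT : (1 < 3)%N) d3).
pose p1 : 'I_d := Ordinal (leq_trans (isT : (2 < 3)%N) d3).
have op0 : o != p0 by []. have op1 : o != p1 by []. have p01 : p0 != p1 by [].
have [G G1 hG] := @angle_derivs_bounded R.
pose D := (3 * d * e)%N; pose g := @Gam R d e T G; pose ck := @CK R d e T G.
have g1 : 1 <= g := @Gam1 R d e T T0 G G1.
have ck0 : 0 <= ck . by apply: CK_ge0.
have v0 := vol2_ge0 (R := R) (d := d).
pose k0 := @K0 R d e.
have k1 : 1 <= k0 := @K01 R d e.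
have q2 : 1 <= 2 ^+ D :> R by rewrite exprn_ege1// ler1n.
pose C1 := vol R d / 2 * (11 * g + ck).
pose C2 := vol R d / 2 * (1 + ck).
pose C3 := vol R d / 2 * (2 * g ^+ 2 + ck).
pose C4 := 2 * (1 + 2 ^+ D + g * k0 ^+ 2).
pose C5 := 2 * (g * (1 + 2 ^+ D) + g * k0 ^+ 2).
pose C6 : R := d%:R * 4 * (2 ^+ D) ^+ 2.
have C10 : 0 <= C1 by rewrite /C1; pos.
have C20 : 0 <= C2 by rewrite /C2; pos.
have C30 : 0 <= C3 by rewrite /C3; pos.
have C40 : 0 <= C4 by rewrite /C4; pos.
have C50 : 0 <= C5 by rewrite /C5; pos.
have C60 : 0 <= C6 by rewrite /C6; pos.
pose C := 1 + C1 + C2 + C3 + C4 + C5 + C6.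
have w (c x y : R) : 0 <= y -> 0 <= c <= C -> x <= c * y -> x <= C * y.
  by move=> y0 /andP[c0 cC] h; apply: le_trans h _; exact: ler_wpM2r.
exists C, (stage e o p0 p1 T), (slab_field e o p0 p1).
split; first by rewrite /C; lra.
have X0 n := @X_gt0 R D n; have b0 n := @b_gt0 R n.
have pb n : 0 <= peak D n ^+ 2 / stepR n ^+ 6 :> R.
  by have := X0 n; have := b0 n => ? ?; pos.
have pb4 n : 0 <= peak D n ^+ 4 / stepR n ^+ 10 :> R.
  by have := X0 n; have := b0 n => ? ?; pos.
have bV n : 0 <= (stepR n)^-1 :> R by have := b0 n => ?; pos.
have p0' n : 0 <= peak D n :> R by exact/ltW.
have p3 n : 0 <= peak D n ^+ 3 :> R by exact/exprn_ge0/ltW.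
split.
- move=> n; rewrite /tdiv_free stage_support; exact: smodes_div_free.
- move=> n t h; exact: stage_old.
- move=> n t h; exact: stage_new.
- move=> n t s hs; apply: (w C1) => //; first by rewrite C10 /C; lra.
  exact: work_bound.
- move=> n t; apply: (w C2) => //; first by rewrite C20 /C; lra.
  exact: energy_near.
- move=> n t; apply: (w C3) => //; first by rewrite C30 /C; lra.
  exact: dt_energy.
- move=> n t; apply: (w C4) => //; first by rewrite C40 /C; lra.
  exact: l1_bound.
- move=> n t; apply: (w C5) => //; first by rewrite C50 /C; lra.
  exact: dt_l1_bound.
- move=> n t s S; rewrite stage_support freeze_stage => hs; apply: smodes_symbol => // m.
  case/mem_stage => [] [c [i ->]] /=.
  + apply: (hs (Mode (slab_freq p0 p1 i) 0 (1 *: slab_vec o (axis p0 p1 n) (slab_freq p0 p1 i)))).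
    by rewrite /smodes /stage_modes !mem_cat; apply/orP; left; rewrite -map_comp;
      apply/mapP; exists i => //; rewrite mem_enum.
  + apply: (hs (Mode (slab_freq p0 p1 i) 0 (1 *: slab_vec o (axis p0 p1 n.+1) (slab_freq p0 p1 i)))).
    by rewrite /smodes /stage_modes !mem_cat; apply/orP; right; apply/orP; left;
      rewrite -map_comp; apply/mapP; exists i => //; rewrite mem_enum.
  + apply: (hs (Mode (shear_freq p0 p1 i) (- (pi / 2)) (1 *: shear_vec (axis p0 p1 n) (axis p0 p1 n.+1) (shear_freq p0 p1 i)))).
    by rewrite /smodes /stage_modes !mem_cat; apply/orP; right; apply/orP; right;
      rewrite -map_comp; apply/mapP; exists i => //; rewrite mem_enum.
- move=> n m; rewrite stage_support => hm.
  apply: (w C6) => //; first by rewrite C60 /C; lra.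
  exact: (freq_bound e3 d3 op0 op1 p01 hm).
- move=> n m; rewrite stage_support => hm.
  have := smodes_freq_ge e3 d3 op0 op1 p01 hm; rewrite lamE//.
  have bn := b0 n; congr (_ <= _); rewrite /D; field; pos.
- move=> n m r; rewrite stage_support => hm; exact: (smodes_lattice e3 d3 _ hm).
Qed.

End cascade_interface.

(** * Integrals over the time interval *)

Section limit_integrals.
Context {R : realType}.
Local Notation leb := (@lebesgue_measure R).
Implicit Types (g : R -> R) (a b : R).

Lemma near_fst (F G : set_system R) (P : R -> Prop) : Filter F -> Filter G ->
  (\forall x \near F, P x) -> \forall z \near filter_prod F G, P z.1.
Proof. by move=> FF FG h; exists ([set x | P x], setT) => [|z []//]; split=> //; exact: filterT. Qed.

Lemma near_snd (F G : set_system R) (P : R -> Prop) : Filter F -> Filter G ->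
  (\forall x \near G, P x) -> \forall z \near filter_prod F G, P z.2.
Proof. by move=> FF FG h; exists (setT, [set x | P x]) => [|z []//]; split=> //; exact: filterT. Qed.

(** Both ends are governed by the continuity of the integral of an integrable
    function with respect to its endpoints. *)
Lemma limit_integral_integrable g a b : a < b ->
  leb.-integrable `]a, b[ (EFin \o g) ->
  limit_integral g a b (\int[leb]_(t in `]a, b[) g t).
Proof.
move=> ab ig; split; first by apply: open_integrable_locally => //; exact: interval_open.
pose h : R -> R := g \_ `]a, b[.
have ih : leb.-integrable `[a, b] (EFin \o h).
  have : leb.-integrable setT (EFin \o h).
    have -> : EFin \o h = ((EFin \o g) \_ `]a, b[)%E.
      by apply/funext => x /=; rewrite /h !patchE; case: ifP.
    by rewrite -integrable_mkcond.
  by apply: integrableS.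
pose P x := parameterized_integral leb a x h.
have PE x : P x = \int[leb]_(t in `[a, x]) h t by [].
have Pb : P b = \int[leb]_(t in `]a, b[) g t.
  rewrite PE [LHS]Rintegral_mkcond [RHS]Rintegral_mkcond; congr fine.
  apply: eq_integral => x _; congr EFin; rewrite /h !patchE.
  case: ifPn => // /negP xab; case: ifPn => // xab'; exfalso; apply: xab.
  by move: xab'; rewrite !inE /= !in_itv/= => /andP[? ?]; rewrite !ltW.
have Pa : P x @[x --> a^'+] --> 0.
  by apply: cvg_at_right_filter; exact: parameterized_integral_cvg_left ab ih.
have Pb' : P x @[x --> b^'-] --> P b.
  exact: parameterized_integral_cvg_at_left ab ih.
rewrite -Pb -[P b]subr0.
have C : (fun z : R * R => P z.2 - P z.1) @ filter_prod (a^'+) (b^'-) --> P b - 0.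
  apply: cvgB.
    exact: (cvg_comp _ _ (@cvg_snd _ _ (a^'+) (b^'-) _)).
  exact: (cvg_comp _ _ (@cvg_fst _ _ (a^'+) (b^'-) _)).
apply: cvg_trans C; apply: near_eq_cvg.
(* Keeping the two ends on either side of the midpoint makes the interval
   nonempty. *)
pose c := (a + b) / 2.
have ac : a < c by rewrite /c; lra.
have cb : c < b by rewrite /c; lra.
have N1 : \forall z \near filter_prod (a^'+) (b^'-), a < z.1 < c.
  apply: (@near_fst _ _ (fun x => a < x < c)).
  by apply: filterS2 (nbhs_right_gt a) (nbhs_right_lt ac) => x -> ->.
have N2 : \forall z \near filter_prod (a^'+) (b^'-), c < z.2 < b.
  apply: (@near_snd _ _ (fun x => c < x < b)).
  by apply: filterS2 (nbhs_left_gt cb) (nbhs_left_lt b) => x -> ->.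
near=> z.
have /andP[z1a z1c] : a < z.1 < c by near: z; exact: N1.
have /andP[z2c z2b] : c < z.2 < b by near: z; exact: N2.
have z12 : z.1 <= z.2 by lra.
have i1 : leb.-integrable `[a, z.2] (EFin \o h).
  apply: integrableS ih => // x /=; rewrite !in_itv/= => /andP[-> h2] /=.
  exact: le_trans h2 (ltW z2b).
have := @Rintegral_itvB R h (BLeft a) (BRight z.2) z.1 i1.
rewrite !bnd_simp => /(_ (ltW z1a) z12); rewrite /P /parameterized_integral => ->.
rewrite Rintegral_itv_obnd_cbnd; last first.
  apply: integrableS i1 => // x /=; rewrite !in_itv/= => /andP[h1 ->]; rewrite andbT.
  exact: le_trans (ltW z1a) (ltW h1).
apply: eq_Rintegral => x; rewrite inE/= in_itv/= => /andP[x1 x2].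
by rewrite /h patchE ifT// inE/= in_itv/= (lt_le_trans z1a x1) (le_lt_trans x2 z2b).
Unshelve. all: by end_near. Qed.

Lemma limit_integral_point g a : limit_integral g a a 0.
Proof.
split.
  rewrite set_itv_ge ?bnd_simp ?ltxx//; split; [exact: measurable_fun_set0|exact: open0|].
  by move=> K; rewrite subset0 => -> _; rewrite integral_set0 ltry.
have N1 := @near_fst (a^'+) (a^'-) (fun x => a < x) _ _ (nbhs_right_gt a).
have N2 := @near_snd (a^'+) (a^'-) (fun x => x < a) _ _ (nbhs_left_lt a).
apply: cvg_near_cst; near=> z.
have z1 : a < z.1 by near: z; exact: N1.
have z2 : z.2 < a by near: z; exact: N2.
rewrite set_itv_ge ?Rintegral_set0// bnd_simp -ltNge; exact: lt_trans z1.
Unshelve. all: by end_near. Qed.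

End limit_integrals.

Section time_slots.
Context {R : realType}.
Local Notation leb := (@lebesgue_measure R).
Variables (D : nat) (T : R).
Hypotheses (D27 : (27 <= D)%N) (T0 : 0 < T).
Local Notation X := (@peak R D).
Local Notation b := (@stepR R).
Local Notation rem := (rem D T).
Local Notation t_ := (t_ D T).

Let rem0' n : 0 < rem n. Proof. exact: rem_gt0. Qed.
Let remS' n : rem n.+1 <= rem n / 4. Proof. exact: remS. Qed.

Lemma tE n : t_ n = T - rem n. Proof. by []. Qed.
Lemma remE n : rem n = T / 2 * (b n ^+ 5 / X n ^+ 2) / kap D. Proof. by []. Qed.

Definition turn_end n : R := t_ n + rem n / 2.

Lemma turn_lt n : t_ n < turn_end n /\ turn_end n < t_ n.+1.
Proof.
have r0 := rem0' n; have r1 := rem0' n.+1; have rS := remS' n.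
by rewrite /turn_end (tE n) (tE n.+1); split; lra.
Qed.

Lemma t_lt n : t_ n < t_ n.+1. Proof. by have [h1 h2] := turn_lt n; exact: lt_trans h2. Qed.

Lemma t_mono m n : (m <= n)%N -> t_ m <= t_ n.
Proof.
move=> /subnK <-; elim: (n - m)%N => [//|k IH]; rewrite addSn.
exact: le_trans IH (ltW (t_lt _)).
Qed.

Lemma t_ltT n : t_ n < T. Proof. by rewrite ltrBlDr ltrDl. Qed.
Lemma t0E : t_ 0 = T / 2.
Proof. by rewrite tE rem0; field. Qed.

Lemma rem_le n : rem n * n.+1%:R <= T.
Proof.
have : rem n * n.+1%:R <= T / 2.
  elim: n => [|n IH]; first by rewrite rem0 mulr1.
  apply: le_trans IH; apply: le_trans (ler_wpM2r (ler0n _ _) (remS' n)) _.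
  rewrite -mulrA ler_pM2l// mulrC ler_pdivrMr// -natrM ler_nat; lia.
have := T0; lra.
Qed.

(** The remaining times tend to 0. *)
Lemma slot_exists t : t < T -> exists n, t < t_ n.+1.
Proof.
move=> tT; pose n := Num.truncn (T / (T - t)).
exists n; have d0 : 0 < T - t by rewrite subr_gt0.
have nP : T / (T - t) < n.+1%:R by rewrite /n truncnS_gt// divr_ge0// ltW.
have h : T < n.+1%:R * (T - t) by rewrite -ltr_pdivrMr.
have r1 := rem_le n; have r0 := rem0' n; have rS := remS' n.
have n1 : 0 < n.+1%:R :> R by rewrite ltr0n.
have : rem n < T - t.
  rewrite -(ltr_pM2r n1) [ltRHS]mulrC; exact: le_lt_trans r1 h.
rewrite (tE n.+1); lra.
Qed.

Definition idx t : nat :=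
  if pselect (exists n, t < t_ n.+1) is left ex then ex_minn ex else 0%N.

Lemma idxP t : t < T -> t < t_ (idx t).+1 /\ (forall m, (m < idx t)%N -> t_ m.+1 <= t).
Proof.
move=> tT; rewrite /idx; case: pselect => [ex|/(_ (slot_exists tT))//].
case: ex_minnP => n tn nm; split=> // m mn; rewrite leNgt; apply/negP => /nm.
by rewrite leqNgt mn.
Qed.

(** Description number n.+1 is valid as soon as the turnover of stage n is
    over. These open intervals overlap, so that regularity can be read off
    from a single stage, while the slots partition the time interval. *)
Definition valid n : set R :=
  if n is n'.+1 then `]turn_end n', t_ n.+1[%classic else `]-oo, t_ 1[%classic.
Definition slot n : set R :=
  if n is n'.+1 then `[t_ n, t_ n.+1[%classic else `]0, t_ 1[%classic.

Lemma open_valid n : open (valid n).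
Proof. by case: n => [|n]; exact: interval_open. Qed.
Lemma measurable_slot n : measurable (slot n).
Proof. by case: n => [|n]; exact: measurable_itv. Qed.

Lemma slot_valid n : slot n `<=` valid n.
Proof.
case: n => [|n] t; rewrite /slot /valid /= !in_itv/= => /andP[h1 h2]; first by [].
by rewrite h2 andbT; have [_ h] := turn_lt n; exact: lt_le_trans h1.
Qed.

Lemma valid_idx t : t < T -> valid (idx t) t.
Proof.
move=> /idxP[]; case: (idx t) => [|n] /= h1 h2; rewrite in_itv//= h1 andbT.
by have [_ h] := turn_lt n; apply: lt_le_trans h _; exact: h2.
Qed.

Lemma slot_idx t : 0 < t < T -> slot (idx t) t.
Proof.
move=> /andP[t0] /idxP[]; case: (idx t) => [|n] /= h1 h2; rewrite in_itv/= h1 ?t0//.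
by rewrite andbT; exact: h2.
Qed.

Lemma valid_lt n t : valid n t -> t < t_ n.+1.
Proof. by case: n => [|n]; rewrite /valid /= in_itv/= => // /andP[]. Qed.

Lemma valid_ltT n t : valid n t -> t < T.
Proof. by move=> /valid_lt h; exact: lt_trans h (t_ltT _). Qed.

(** In the overlap the turnover of the preceding stage is over. *)
Lemma valid_cases n t : valid n t ->
  idx t = n \/ exists2 m, n = m.+1 & idx t = m /\ turn_end m < t < t_ n.
Proof.
move=> v; have tT := valid_ltT v; have [i1 i2] := idxP tT.
have le_n : (idx t <= n)%N.
  by rewrite leqNgt; apply/negP => /i2; rewrite leNgt (valid_lt v).
move: le_n; rewrite leq_eqVlt => /orP[/eqP|lt_n]; first by left.
right; case: n v lt_n => [//|m]; rewrite /valid /= in_itv/= => /andP[v1 v2].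
rewrite ltnS leq_eqVlt => /orP[/eqP im|im].
  by exists m => //; split=> //; rewrite v1 -{1}im.
exfalso; have := lt_le_trans i1 (t_mono im).
have [h _] := turn_lt m; have := lt_trans h v1; lra.
Qed.

Lemma bigcup_slot : `]0, T[%classic = \bigcup_n slot n.
Proof.
apply/seteqP; split=> [t /=|t [n _]].
  by rewrite in_itv/= => h; exists (idx t) => //; exact: slot_idx.
move=> sl; have v := slot_valid sl; rewrite /= in_itv/= (valid_ltT v) andbT.
case: n sl {v} => [|n]; rewrite /slot /= in_itv/= => /andP[h _] //.
apply: lt_le_trans h; apply: lt_le_trans (t_mono (leq0n n.+1)).
by rewrite t0E; have := T0; lra.
Qed.

Lemma slot_uniq n t : slot n t -> idx t = n.
Proof.
move=> sl; have := valid_cases (slot_valid sl); case=> // -[m nm [_ /andP[_ h]]].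
by exfalso; move: sl h; rewrite nm /slot /= in_itv/= => /andP[h1 _]; rewrite ltNge h1.
Qed.

Lemma trivIset_slot : trivIset setT slot.
Proof.
apply/trivIsetP => i j _ _ ij; apply/seteqP; split=> // t [/slot_uniq E1 /slot_uniq E2].
by move: ij; rewrite -E1 -E2 eqxx.
Qed.

Lemma slot_measure n : (leb (slot n) <= (2 * rem n)%:E)%E.
Proof.
have r0 := rem0' n; have r1 := rem0' n.+1.
case: n r0 r1 => [|n] r0 r1; rewrite /slot lebesgue_measure_itv /= lte_fin.
  case: ifP => _; last by rewrite lee_fin; lra.
  by rewrite -EFinD lee_fin rem0 subr0 (tE 1); lra.
case: ifP => _; last by rewrite lee_fin; lra.
by rewrite -EFinD lee_fin (tE n.+2) (tE n.+1); lra.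
Qed.

(** A stage lasts about b^5 / X^2, so a quantity of size X^2 / b^6 contributes
    1 / b to an integral over time, which is summable. *)
Lemma slot_weight n : 2 * rem n * (X n ^+ 2 / b n ^+ 6) <= (2 * T / @kap R D) / (2 ^ n.+1)%:R.
Proof.
have X1 := X_gt0 D n (R := R); have b1 := b_gt0 n (R := R); have k1 := kap_gt0 D (R := R).
have -> : 2 * rem n * (X n ^+ 2 / b n ^+ 6) = T / kap D / b n.
  by rewrite remE; field; pos.
have T1 := T0.
apply: (@le_trans _ _ (T / kap D / (2 ^ n.+1)%:R)).
  rewrite ler_wpM2l//; first by pos.
  rewrite lef_pV2 ?posrE ?ltr0n ?expn_gt0//.
  by rewrite ler_nat leq_exp2l//; lia.
apply: ler_wpM2r; first by rewrite invr_ge0.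
by apply: ler_wpM2r; [rewrite invr_ge0 ltW|lra].
Qed.

Lemma stage_dominated (N : R -> \bar R) (C : R) : 0 <= C ->
  measurable_fun `]0, T[ N ->
  (forall t, 0 < t < T -> (0 <= N t)%E) ->
  (forall n t, slot n t -> (N t <= (C * (X n ^+ 2 / b n ^+ 6))%:E)%E) ->
  (\int[leb]_(t in `]0%R, T[) N t < +oo)%E.
Proof.
move=> C0 mN N0 hN; rewrite bigcup_slot ge0_integral_bigcup//; first last.
- exact: trivIset_slot.
- by move=> t; rewrite -bigcup_slot /= in_itv/=; exact: N0.
- by rewrite -bigcup_slot.
- exact: measurable_slot.
have sub n : slot n `<=` `]0, T[%classic by rewrite bigcup_slot; exact: bigcup_sup.
pose K := C * (2 * T / kap D).
have K0 : 0 <= K by have := kap_gt0 D (R := R); have := T0; rewrite /K => ? ?; pos.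
apply: le_lt_trans (ltry K).
apply: le_trans (epsilon_trick0 xpredT K0).
apply: lee_nneseries => n _ *.
  by apply: integral_ge0 => t /sub /=; rewrite in_itv/=; exact: N0.
have X1 := X_gt0 D n (R := R); have b1 := b_gt0 n (R := R).
have c0 : 0 <= C * (X n ^+ 2 / b n ^+ 6) by pos.
apply: (@le_trans _ _ (\int[leb]_(t in slot n) (C * (X n ^+ 2 / b n ^+ 6))%:E)%E).
  apply: ge0_le_integral => //; first exact: measurable_slot.
  - by move=> t /sub /=; rewrite in_itv/=; exact: N0.
  - by apply: measurable_funS mN => //; exact: measurable_itv.
  - exact: hN.
rewrite integral_cst; last exact: measurable_slot.
apply: le_trans (lee_wpmul2l _ (slot_measure n)) _; first by rewrite lee_fin.
rewrite -EFinM lee_fin /K -[leRHS]mulrA.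
have -> : C * (X n ^+ 2 / b n ^+ 6) * (2 * rem n) = C * (2 * rem n * (X n ^+ 2 / b n ^+ 6)).
  by ring.
by apply: ler_wpM2l => //; exact: slot_weight.
Qed.

Lemma measurable_valid_pieces (N : R -> \bar R) :
  (forall n, exists2 g : R -> R, continuous g & forall t, valid n t -> N t = (g t)%:E) ->
  measurable_fun `]0, T[ N.
Proof.
move=> h; have -> : `]0, T[%classic = \bigcup_n (slot n) := bigcup_slot.
apply/measurable_fun_bigcup => [|n]; first exact: measurable_slot.
have [g cg gN] := h n.
apply: (eq_measurable_fun (EFin \o g)) => [t|].
  by rewrite inE => /slot_valid /gN ->.
by apply/measurable_EFinP; apply: measurable_funTS; exact: continuous_measurable_fun.
Qed.

Lemma measurable_valid_real (N : R -> R) :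
  (forall n, exists2 g : R -> R, continuous g & forall t, valid n t -> N t = g t) ->
  measurable_fun `]0, T[ N.
Proof.
move=> h; apply/measurable_EFinP; apply: measurable_valid_pieces => n.
by have [g cg gN] := h n; exists g => // t /gN /= ->.
Qed.

Lemma stage_integrable (g : R -> R) (C : R) : 0 <= C ->
  measurable_fun `]0, T[ g ->
  (forall n t, slot n t -> `|g t| <= C * (X n ^+ 2 / b n ^+ 6)) ->
  leb.-integrable `]0, T[ (EFin \o g).
Proof.
move=> C0 mg hg; apply/integrableP; split; first exact/measurable_EFinP.
apply: (stage_dominated C0); rewrite /comp/=.
- apply/measurable_EFinP; exact: measurableT_comp.
- by move=> t _; rewrite lee_fin.
- by move=> n t /hg; rewrite lee_fin.
Qed.

End time_slots.

(** * Work and dissipation of trigonometric fields *)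

Section quadratic_identities.
Context {R : realType} {d : nat}.
Local Notation E := 'rV[R]_d.
Local Notation F := 'rV[int]_d.
Local Notation mode := (@mode R d).
Implicit Types (U V W : seq mode) (s q : E -> R).

Lemma pairing_multr q V W : (forall x, q (- x) = q x) ->
  pairing V (map (mult_mode q) W) = pairing (map (mult_mode q) V) W.
Proof.
move=> qN; rewrite /pairing big_map; apply: eq_bigr => m _; rewrite big_map.
apply: eq_bigr => n _; rewrite /= dotZl dotZr /mean2 /mean_wave /=.
case: (eqVneq (fr m + fr n) 0) => [h|_].
  have -> : fr m = - fr n by apply/eqP; rewrite -addr_eq0 h.
  by rewrite freqN qN.
case: (eqVneq (fr m - fr n) 0) => [/eqP|_]; last by rewrite !(mulr0, addr0).
by rewrite subr_eq0 => /eqP ->.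
Qed.

Lemma mult_mult s q U :
  map (mult_mode q) (map (mult_mode s) U) = map (mult_mode (fun x => q x * s x)) U.
Proof. by rewrite -map_comp; apply: eq_map => m; rewrite /mult_mode /= scalerA. Qed.

Lemma dotNN (x : E) : dot (- x) (- x) = dot x x.
Proof. by rewrite dotNl dotNr opprK. Qed.

Lemma ev_mult s U x : ev (map (mult_mode s) U) x =
  \sum_(m <- U) s (freq (fr m)) *: (wave (fr m) (ph m) x *: amp m).
Proof.
by rewrite /ev big_map; apply: eq_bigr => m _; rewrite /= !scalerA mulrC.
Qed.

Lemma pairing_lap s U W :
  pairing (map (mult_mode s) U) (map (@lap_mode R d) W) =
  pairing (map (mult_mode (fun x => dot x x * s x)) U) W.
Proof.
rewrite -[map (@lap_mode R d) W]/(map (mult_mode (fun x : E => dot x x)) W).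
by rewrite pairing_multr ?mult_mult// => x; exact: dotNN.
Qed.

(** Mode by mode, the squares of the partial derivatives add up to the square
    of the frequency. *)
Lemma sqnorm2_grad_ev U : sqnorm2_grad (ev U) = pairing U (map (@lap_mode R d) U).
Proof.
have -> : sqnorm2_grad (ev U) = \sum_j pairing (map (deriv_mode (unit_vec j)) U)
    (map (deriv_mode (unit_vec j)) U).
  rewrite /sqnorm2_grad -(eq_torus_int (g := fun x => \sum_j dot
      (ev (map (deriv_mode (unit_vec j)) U) x) (ev (map (deriv_mode (unit_vec j)) U) x))).
    rewrite torus_int_sum => [|j _]; last exact: tint_dot_ev.
    by apply: eq_bigr => j _; rewrite -inner_ev.
  move=> x; rewrite exchange_big /=; apply: eq_bigr => j _.
  by apply: eq_bigr => i _; rewrite partial_ev -expr2.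
rewrite /pairing; under eq_bigr do rewrite big_map.
rewrite exchange_big; apply: eq_bigr => m _ /=.
under eq_bigr do rewrite big_map.
rewrite exchange_big big_map; apply: eq_bigr => n _ /=.
have -> : dot (amp m) (dot (freq (fr n)) (freq (fr n)) *: amp n) * mean2 m (lap_mode n) =
  \sum_j dot (amp m) (amp n) * (freq (fr n) : E) 0 j ^+ 2 * mean2 m n.
  transitivity (dot (amp m) (amp n) * mean2 m n * dot (freq (fr n) : E) (freq (fr n))).
    by rewrite dotZr /mean2 /=; ring.
  rewrite [X in _ * X = _]/dot mulr_sumr; apply: eq_bigr => j _; ring.
apply: eq_bigr => j _; rewrite dotZl dotZr !dot_unit /mean2 /mean_wave /=.
have -> : ph m + pi / 2 + (ph n + pi / 2) = ph m + ph n + pi by field.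
have -> : ph m + pi / 2 - (ph n + pi / 2) = ph m - ph n by ring.
rewrite cosDpi; case: (eqVneq (fr m + fr n) 0) => [h|_].
  have -> : fr m = - fr n by apply/eqP; rewrite -addr_eq0 h.
  have -> : (freq (- fr n) : E) 0 j = - (freq (fr n) : E) 0 j by rewrite freqN mxE.
  case: eqVneq => [h'|_]; last by ring.
  have f0 : (freq (fr n) : E) 0 j = 0.
    have : (fr n) 0 j = 0 by move/rowP : h' => /(_ j); rewrite !mxE; move: (fr n 0 j) => z; lia.
    by rewrite freqE => ->.
  by rewrite f0; ring.
case: (eqVneq (fr m - fr n) 0) => [/eqP|_]; last by rewrite !(mulr0, addr0).
by rewrite subr_eq0 => /eqP ->; ring.
Qed.

Lemma is_derive_ev_line U i j x (s : R) :
  is_derive s 1 (fun s : R => ev U (x + s *: unit_vec j) 0 i)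
    (ev (map (deriv_mode (unit_vec j)) U) (x + s *: unit_vec j) 0 i).
Proof.
have -> : (fun s : R => ev U (x + s *: unit_vec j) 0 i) = (fun s : R =>
   \sum_(m <- U) wave (fr m) (ph m) (x + s *: unit_vec j) *: amp m 0 i).
  by apply/funext => s'; rewrite evE.
have -> : ev (map (deriv_mode (unit_vec j)) U) (x + s *: unit_vec j) 0 i =
  \sum_(m <- U) ((fr m 0 j)%:~R * wave (fr m) (ph m + pi / 2) (x + s *: unit_vec j)) *: amp m 0 i.
  rewrite evE big_map; apply: eq_bigr => m _ /=.
  by rewrite mxE dot_unit freqE /GRing.scale /=; ring.
apply: is_derive_bigsum => m; apply: (@is_derive_scal R R); exact: is_derive_wave.
Qed.

Lemma continuous_ev_coord U i : continuous (fun x : E => ev U x 0 i).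
Proof.
move=> x; apply: (@continuous_comp E E R (ev U) (fun y => y 0 i)); first exact: continuous_ev.
exact: continuous_coord.
Qed.

Lemma ev_coord_le U i x : `|ev U x 0 i| <= l1 U.
Proof. exact: le_trans (coord_le_enorm _ _) (enorm_ev _ _). Qed.

(** The product of the field with its own transport is half the divergence of
    |u|^2 u. *)
Lemma pairing_transport U : div_free U -> pairing U (conv U U) = 0.
Proof.
move=> dU; rewrite -inner_ev.
pose v i x := ev U x 0 i; pose dv j i x := ev (map (deriv_mode (unit_vec j)) U) x 0 i.
pose G' j x := \sum_i (dv j j x * v i x ^+ 2 + v j x * (2 * (v i x * dv j i x))).
have c2 i x : {for x, continuous (v i)} by exact: continuous_ev_coord.
have c3 j i x : {for x, continuous (dv j i)} by exact: continuous_ev_coord.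
have cG j : continuous (G' j).
  apply: continuous_bigsum => i x.
  have cM (f g : E -> R) : {for x, continuous f} -> {for x, continuous g} ->
      {for x, continuous (fun y => f y * g y)} by move=> cf cg; exact: (@cvgM R E (nbhs x)).
  have cc : {for x, continuous (fun _ : E => 2 : R)} by rewrite /prop_for; exact: cst_continuous.
  have cD (f g : E -> R) : {for x, continuous f} -> {for x, continuous g} ->
      {for x, continuous (fun y => f y + g y)} by move=> cf cg; exact: (@cvgD R R E (nbhs x)).
  apply: (cD _ _).
    apply: (cM _ _); first exact: c3.
    by rewrite (_ : (fun y => v i y ^+ 2) = (fun y => v i y * v i y))//; exact: (cM _ _).
  apply: (cM _ _); first exact: c2.
  by apply: (cM _ _) => //; exact: (cM _ _).
have bG j x : `|G' j x| <= \sum_(i < d) (l1 (map (deriv_mode (unit_vec j)) U) * (l1 U * l1 U)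
     + l1 U * (2 * (l1 U * l1 (map (deriv_mode (unit_vec j)) U)))).
  apply: le_trans (ler_norm_sum _ _ _) _; apply: ler_sum => i _.
  apply: le_trans (ler_normD _ _) _; apply: lerD.
    rewrite expr2; apply: ler_normM; first exact: ev_coord_le.
    by apply: ler_normM; exact: ev_coord_le.
  apply: ler_normM; first exact: ev_coord_le.
  rewrite normrM ger0_norm// ler_wpM2l//; apply: ler_normM; exact: ev_coord_le.
have Z j : torus_int (G' j) = 0.
  apply: (@torus_int_deriv0 R d (fun x => \sum_i v j x * v i x ^+ 2) _ j _ (cG j) (bG j)).
    by move=> x i; apply: eq_bigr => k _; rewrite /v !torus_fun_ev.
  move=> x s; rewrite /G'; apply: is_derive_bigsum => i.
  have d1 k := is_derive_ev_line U k j x s.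
  pose A (s : R) : R := v j (x + s *: unit_vec j).
  pose B (s : R) : R := v i (x + s *: unit_vec j).
  pose dA (s : R) : R := dv j j (x + s *: unit_vec j).
  pose dB (s : R) : R := dv j i (x + s *: unit_vec j).
  have h : is_derive s 1 (fun y : R => A y * (B y * B y))
      (A s * (B s * dB s + B s * dB s) + (B s * B s) * dA s).
    exact: is_deriveM (d1 j) (is_deriveM (d1 i) (d1 i)).
  by apply: is_derive_eq h _; rewrite /A /B /dA /dB; ring.
have tG j : tint (G' j) by apply: tint_bounded (bG j); exact: tmeas_cont.
have S0 : torus_int (fun x => \sum_j G' j x) = 0.
  by rewrite torus_int_sum => [|j _]; rewrite ?big1// => j _.
have E2 x : dot (ev U x) (ev (conv U U) x) = 2^-1 * \sum_j G' j x.
  have div0 : \sum_j dv j j x = 0.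
    transitivity (divergence (ev U) x); last exact: divergence_ev.
    by apply: eq_bigr => j _; rewrite partial_ev.
  have -> : \sum_j G' j x = (\sum_j dv j j x) * (\sum_i v i x ^+ 2) +
     2 * \sum_i v i x * (\sum_j v j x * dv j i x).
    rewrite mulr_suml mulr_sumr.
    under [X in _ = _ + X]eq_bigr do rewrite mulr_sumr mulr_sumr.
    rewrite [X in _ = _ + X]exchange_big -big_split; apply: eq_bigr => j _.
    rewrite mulr_sumr -big_split; apply: eq_bigr => i _ /=; ring.
  rewrite div0 mul0r add0r mulrA mulVf// mul1r /dot.
  by apply: eq_bigr => i _; rewrite ev_conv.
have tS : tint (fun x => \sum_j G' j x) by apply: tint_sum => j _; exact: tG.
by rewrite /inner (eq_torus_int E2) torus_intZ// S0 mulr0.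
Qed.

Lemma freeze_lap t (l : @tfield R d) :
  freeze t (tmap (@lap_mode R d) l) = map (@lap_mode R d) (freeze t l).
Proof.
rewrite /freeze /tmap -!map_comp; apply: eq_map => z /=.
by rewrite /lap_mode /scale_mode /=; congr Mode; rewrite !scalerA mulrC.
Qed.

Lemma pairing_force t (l : @tfield R d) s :
  pairing (map (mult_mode s) (freeze t l)) (freeze t (force l)) =
  (pairing (map (mult_mode s) (freeze t l)) (freeze t (tderiv l))
    + trilinear s (freeze t l) (freeze t l) (freeze t l))
  + pairing (map (mult_mode (fun x => dot x x * s x)) (freeze t l)) (freeze t l).
Proof.
rewrite /force !freeze_cat !pairing_catr freeze_lap pairing_lap freeze_tconv pairing_conv.
ring.
Qed.

Lemma pairing_force1 t (l : @tfield R d) : tdiv_free l ->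
  pairing (freeze t l) (freeze t (force l)) =
  pairing (freeze t l) (freeze t (tderiv l)) + sqnorm2_grad (tev l t).
Proof.
move=> dl; rewrite [X in sqnorm2_grad X]/(tev l t) /tev sqnorm2_grad_ev.
rewrite /force !freeze_cat !pairing_catr freeze_lap freeze_tconv.
by rewrite pairing_transport ?addr0//; exact: div_free_freeze.
Qed.

End quadratic_identities.

(** * Consequences of the Bessel inequality *)

Section fourier_estimates.
Context {R : realType} {d : nat}.
Local Notation E := 'rV[R]_d.
Local Notation F := 'rV[int]_d.
Local Notation mode := (@mode R d).

Lemma esum_list (I : choiceType) (a : I -> R) (r : seq I) : uniq r ->
  (forall i, 0 <= a i) -> (forall i, i \notin r -> a i = 0) ->
  esum [set: I] (fun i => (a i)%:E) = (\sum_(i <- r) a i)%:E.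
Proof.
move=> ur a0 ar.
have -> : esum [set: I] (fun i => (a i)%:E) = esum [set` r] (fun i => (a i)%:E).
  rewrite [RHS]esum_mkcond; apply: eq_esum => i _; case: ifPn => //.
  by rewrite notin_setE /= => /negP/ar ->.
rewrite esum_fset; [|exact: finite_seq|by move=> i _; rewrite lee_fin].
by rewrite -fsbig_seq// sumEFin.
Qed.

Definition coef2 (g : E -> R) (k : F) : R := coef g k 0 ^+ 2 + coef g k (- (pi / 2)) ^+ 2.

Lemma coef2_ge0 g k : 0 <= coef2 g k.
Proof. by rewrite addr_ge0 ?sqr_ge0. Qed.

Lemma sq_abs_fourier g k : sq_abs (fourier_coef g k) = (vol R d)^-1 ^+ 2 * coef2 g k.
Proof. by rewrite fourier_coefE /sq_abs /= /coef2; ring. Qed.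

Lemma tint_cont_bounded (g : E -> R) (K : R) : continuous g -> (forall x, `|g x| <= K) -> tint g.
Proof. by move=> cg bg; apply: tint_bounded bg; exact: tmeas_cont. Qed.

Lemma tint_ev (W : seq mode) i : tint (coord_fun (ev W) i) /\ tint (fun x => coord_fun (ev W) i x ^+ 2).
Proof.
have c : continuous (coord_fun (ev W) i) by exact: continuous_ev_coord.
split; first by apply: (tint_cont_bounded c) => x; exact: ev_coord_le.
apply: (@tint_cont_bounded _ (l1 W * l1 W)) => [x|x].
  by apply: (@cvgM R E (nbhs x)); exact: c.
by rewrite expr2; apply: ler_normM; exact: ev_coord_le.
Qed.

Lemma bessel_ev (W : seq mode) r : uniq r ->
  \sum_(k <- r) \sum_i coef2 (coord_fun (ev W) i) k <= vol R d * pairing W W.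
Proof.
move=> ur; rewrite exchange_big /= -inner_ev /inner /dot.
rewrite torus_int_sum => [|i _]; last by have [_] := tint_ev W i.
rewrite mulr_sumr; apply: ler_sum => i _.
by have [t1 t2] := tint_ev W i; exact: bessel.
Qed.

Definition weight (k : F) : R := (1 + dot (freq k) (freq k))^-1.

Lemma weight_ge0 k : 0 <= weight k <= 1.
Proof.
have h := dot_ge0 (freq k : E); rewrite /weight invr_ge0 addr_ge0//=.
by rewrite invf_le1; lra.
Qed.

(** One derivative is gained at frequencies of size at least the square root
    of [Y]. *)
Lemma weighted_bessel (W : seq mode) r (Y : R) : uniq r -> 0 < Y ->
  (forall m, m \in W -> Y <= dot (freq (fr m)) (freq (fr m))) ->
  \sum_(k <- r) weight k * \sum_i coef2 (coord_fun (ev W) i) k <= Y^-1 * (vol R d * pairing W W).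
Proof.
move=> ur Y0 hY; apply: le_trans (ler_wpM2l _ (bessel_ev W ur)); last by rewrite invr_ge0 ltW.
rewrite mulr_sumr; apply: ler_sum => k _.
have c0 : 0 <= \sum_i coef2 (coord_fun (ev W) i) k by apply: sumr_ge0 => i _; exact: coef2_ge0.
have [kS|kS] := boolP (k \in supp W); last first.
  by rewrite big1 ?mulr0// => i _; rewrite /coef2 !coef_supp// expr0n/= addr0.
apply: ler_wpM2r => //; rewrite /weight lef_pV2 ?posrE//; last first.
  by have := dot_ge0 (freq k : E); lra.
have : Y <= dot (freq k) (freq k).
  move: kS; rewrite mem_undup mem_cat => /orP[] /mapP[m mW ->]; first exact: hY.
  by rewrite freqN dotNN; exact: hY.
lra.
Qed.

Lemma wave_opp k p (x : E) : wave k (p + pi) x = - wave k p x :> R.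
Proof. by rewrite /wave addrA cosDpi. Qed.

Lemma coef_opp (g : E -> R) k p : tint g -> coef g k (p + pi) = - coef g k p.
Proof.
move=> tg; rewrite /coef -mulN1r -torus_intZ; last exact: tint_mulwave.
by apply: eq_torus_int => x; rewrite wave_opp mulrN mulN1r.
Qed.

Section transport_coefficients.
Variables (W : seq mode) (dW : div_free W).
Let h i j : E -> R := fun x => ev W x 0 i * ev W x 0 j.
Let dev (j : 'I_d) := ev (map (deriv_mode (unit_vec j)) W).

Let ch i j : continuous (h i j).
Proof. by move=> x; apply: (@cvgM R E (nbhs x)); exact: continuous_ev_coord. Qed.

Let bh i j x : `|h i j x| <= l1 W * l1 W.
Proof. by apply: ler_normM; exact: ev_coord_le. Qed.

Let th i j : tint (h i j). Proof. exact: tint_cont_bounded (@ch i j) (@bh i j). Qed.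

Let dh i j x := ev W x 0 i * dev j x 0 j + ev W x 0 j * dev j x 0 i.

Let cdh i j : continuous (dh i j).
Proof.
move=> x; apply: (@cvgD R R E (nbhs x)); apply: (@cvgM R E (nbhs x)); exact: continuous_ev_coord.
Qed.

(** Integration by parts in the divergence of the stress. *)
Let coef_dh i j k p : coef (dh i j) k p = - ((k 0 j)%:~R * coef (h i j) k (p + pi / 2)).
Proof.
pose G x := h i j x * wave k p x.
pose G' x := dh i j x * wave k p x + h i j x * ((k 0 j)%:~R * wave k (p + pi / 2) x).
have cw q : continuous (wave k q : E -> R) by exact: continuous_wave.
have bd x : `|dh i j x| <= l1 W * l1 (map (deriv_mode (unit_vec j)) W)
    + l1 W * l1 (map (deriv_mode (unit_vec j)) W).
  by apply: le_trans (ler_normD _ _) _; apply: lerD; apply: ler_normM; exact: ev_coord_le.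
have td : tint (dh i j) by exact: tint_cont_bounded (@cdh i j) bd.
have Z : torus_int G' = 0.
  apply: (@torus_int_deriv0 R d G G' j ((l1 W * l1 (map (deriv_mode (unit_vec j)) W)
    + l1 W * l1 (map (deriv_mode (unit_vec j)) W)) * 1 + l1 W * l1 W * (`|(k 0 j)%:~R| * 1))).
  - move=> x; apply: (@cvgD R R E (nbhs x)); apply: (@cvgM R E (nbhs x)).
    + exact: cdh.
    + exact: cw.
    + exact: ch.
    + by apply: (@cvgM R E (nbhs x)); [exact: cvg_cst|exact: cw].
  - move=> x; apply: le_trans (ler_normD _ _) _; apply: lerD.
      by apply: ler_normM; [exact: bd|exact: wave_le1].
    apply: ler_normM; first exact: bh.
    by rewrite normrM ler_wpM2l// wave_le1.
  - by move=> x r; rewrite /G /h torus_fun_ev torus_fun_wave.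
  - move=> x s.
    have d1 := is_derive_ev_line W i j x s; have d2 := is_derive_ev_line W j j x s.
    have d3 := is_derive_wave k p j x s.
    pose a (y : R) : R := ev W (x + y *: unit_vec j) 0 i.
    pose a' (y : R) : R := dev j (x + y *: unit_vec j) 0 i.
    pose c (y : R) : R := ev W (x + y *: unit_vec j) 0 j.
    pose c' (y : R) : R := dev j (x + y *: unit_vec j) 0 j.
    pose w (y : R) : R := wave k p (x + y *: unit_vec j).
    pose w' (y : R) : R := (k 0 j)%:~R * wave k (p + pi / 2) (x + y *: unit_vec j).
    have H : is_derive s 1 (fun y : R => (a y * c y) * w y)
       ((a s * c s) * w' s + w s * (a s * c' s + c s * a' s)).
      exact: is_deriveM (is_deriveM d1 d2) d3.
    by apply: is_derive_eq H _; rewrite /G' /dh /h /a /a' /c /c' /w /w'; ring.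
have t1 : tint (fun x => dh i j x * wave k p x) by exact: tint_mulwave.
have t2 : tint (fun x => h i j x * wave k (p + pi / 2) x) by exact: tint_mulwave.
have : coef (dh i j) k p + (k 0 j)%:~R * coef (h i j) k (p + pi / 2) = 0.
  rewrite -[RHS]Z /coef -torus_intZ// -torus_intD//; last exact: tintZ.
  by apply: eq_torus_int => x; rewrite /G'; ring.
by move/eqP; rewrite addr_eq0 => /eqP.
Qed.

Let conv_dh i x : ev (conv W W) x 0 i = \sum_j dh i j x.
Proof.
rewrite ev_conv /dh big_split /=.
have -> : \sum_(j < d) ev W x 0 i * dev j x 0 j = 0.
  rewrite -mulr_sumr (_ : \sum_(j < d) _ = 0) ?mulr0//.
  transitivity (divergence (ev W) x); last exact: divergence_ev.
  by apply: eq_bigr => j _; rewrite partial_ev.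
by rewrite add0r.
Qed.

Let sum_CS (x y : E) : (\sum_j x 0 j * y 0 j) ^+ 2 <= dot x x * dot y y.
Proof. exact: dot_CS. Qed.

Lemma conv_coef2 i k : coef2 (coord_fun (ev (conv W W)) i) k <=
  dot (freq k) (freq k) * \sum_j coef2 (h i j) k.
Proof.
have tdh j : tint (dh i j).
  apply: (@tint_cont_bounded _ (l1 W * l1 (map (deriv_mode (unit_vec j)) W)
    + l1 W * l1 (map (deriv_mode (unit_vec j)) W)) (@cdh i j)) => x.
  by apply: le_trans (ler_normD _ _) _; apply: lerD; apply: ler_normM; exact: ev_coord_le.
have cE p : coef (coord_fun (ev (conv W W)) i) k p =
    - \sum_j (freq k : E) 0 j * (\row_j coef (h i j) k (p + pi / 2) : E) 0 j.
  rewrite /coef (eq_torus_int (h := fun x => \sum_j dh i j x * wave k p x)); last first.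
    by move=> x; rewrite /coord_fun conv_dh mulr_suml.
  rewrite torus_int_sum => [|j _]; last exact: tint_mulwave.
  by rewrite -sumrN; apply: eq_bigr => j _; rewrite -/(coef (dh i j) k p) coef_dh freqE mxE.
have sq p : coef (coord_fun (ev (conv W W)) i) k p ^+ 2 <=
    dot (freq k) (freq k) * \sum_j coef (h i j) k (p + pi / 2) ^+ 2.
  rewrite cE sqrrN; apply: le_trans (sum_CS _ _) _.
  rewrite [X in _ * X]/dot le_eqVlt; apply/orP; left; apply/eqP; congr (_ * _).
  by apply: eq_bigr => j _; rewrite mxE expr2.
rewrite /coef2; apply: le_trans (lerD (sq 0) (sq (- (pi / 2)))) _.
rewrite -mulrDr -big_split /= ler_wpM2l ?dot_ge0//; apply: ler_sum => j _.
rewrite add0r addNr addrC lerD2l.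
have {1}-> : pi / 2 = - (pi / 2) + pi :> R by field.
by rewrite coef_opp// sqrrN.
Qed.

(** The transport term is the divergence of the stress: the weight of H^-1
    absorbs this derivative, and the size of the stress is at most the maximum
    of the field times its size. *)
Lemma conv_bessel r : uniq r ->
  \sum_(k <- r) weight k * \sum_i coef2 (coord_fun (ev (conv W W)) i) k <=
  vol R d * (l1 W ^+ 2 * pairing W W).
Proof.
move=> ur.
have step1 k : weight k * \sum_i coef2 (coord_fun (ev (conv W W)) i) k <=
    \sum_i \sum_j coef2 (h i j) k.
  have h0 : 0 <= \sum_i \sum_j coef2 (h i j) k.
    by apply: sumr_ge0 => i _; apply: sumr_ge0 => j _; exact: coef2_ge0.
  have w0 : 0 <= dot (freq k) (freq k) :> R by exact: dot_ge0.
  rewrite /weight mulrC ler_pdivrMr; last by lra.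
  apply: (@le_trans _ _ (dot (freq k) (freq k) * \sum_i \sum_j coef2 (h i j) k)).
    by rewrite mulr_sumr; apply: ler_sum => i _; exact: conv_coef2.
  by rewrite mulrC; apply: ler_wpM2l => //; lra.
apply: le_trans (ler_sum _ (fun k _ => step1 k)) _.
rewrite exchange_big /=; under eq_bigr do rewrite exchange_big /=.
have t2 i j : tint (fun x => h i j x ^+ 2).
  apply: (@tint_cont_bounded _ ((l1 W * l1 W) * (l1 W * l1 W))) => x.
    by apply: (@cvgM R E (nbhs x)); exact: ch.
  by rewrite expr2; apply: ler_normM; exact: bh.
apply: (@le_trans _ _ (\sum_i \sum_j vol R d * torus_int (fun x => h i j x ^+ 2))).
  by apply: ler_sum => i _; apply: ler_sum => j _; exact: bessel (th i j) (t2 i j) ur.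
under eq_bigr do rewrite -mulr_sumr.
rewrite -mulr_sumr ler_wpM2l ?(ltW (vol_gt0 _ _))//.
under eq_bigr => i _ do rewrite -torus_int_sum//.
rewrite -torus_int_sum => [|i _]; last exact: tint_sum.
rewrite -inner_ev /inner -torus_intZ; last exact: tint_dot_ev.
apply: torus_int_le.
- by apply: tint_sum => i _; exact: tint_sum.
- by apply: tintZ; exact: tint_dot_ev.
move=> x; have -> : \sum_i \sum_j h i j x ^+ 2 = dot (ev W x) (ev W x) * dot (ev W x) (ev W x).
  rewrite /dot mulr_suml; apply: eq_bigr => i _; rewrite mulr_sumr; apply: eq_bigr => j _.
  by rewrite /h; ring.
by apply: ler_wpM2r; [exact: dot_ge0|rewrite -enorm_sqr; apply: sqr_le; [exact: enorm_ge0|exact: enorm_ev]].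
Qed.

End transport_coefficients.

Definition hm1_sum (W : seq mode) (r : seq F) : R :=
  \sum_(k <- r) weight k * \sum_i sq_abs (fourier_coef (coord_fun (ev W) i) k).

(** The sum over all frequencies is a finite one over any list that contains
    the support. *)
Lemma Hm1_ev (W : seq mode) r : uniq r -> {subset supp W <= r} ->
  Hm1_norm (ev W) = ((hm1_sum W r)%:E `^ 2^-1)%E.
Proof.
move=> ur sr; rewrite /Hm1_norm; congr (_ `^ _)%E; apply: esum_list => //.
  move=> k; have /andP[w0 _] := weight_ge0 k; apply: mulr_ge0 => //.
  by apply: sumr_ge0 => i _; rewrite sq_abs_fourier mulr_ge0 ?sqr_ge0// coef2_ge0.
move=> k kr; rewrite big1 ?mulr0// => i _; rewrite sq_abs_fourier /coef2 !coef_supp ?expr0n ?addr0 ?mulr0//=.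
all: by apply: contra kr; exact: sr.
Qed.

(** Parseval's identity, with one of the two fields a trigonometric
    polynomial: only its frequencies count. *)
Lemma inner_fourier (W : seq mode) (phi : E -> E) r :
  (forall i, tint (coord_fun phi i)) -> uniq r -> {subset supp W <= r} ->
  inner (ev W) phi = (vol R d)^-1 * \sum_(k <- r) \sum_i
    (coef (coord_fun (ev W) i) k 0 * coef (coord_fun phi i) k 0 +
     coef (coord_fun (ev W) i) k (- (pi / 2)) * coef (coord_fun phi i) k (- (pi / 2))).
Proof.
move=> tphi ur sub; have v0 := vol_gt0 R d.
pose A i k p := coef (coord_fun (ev W) i) k p.
pose g i k x := A i k 0 * (coord_fun phi i x * wave k 0 x) +
   A i k (- (pi / 2)) * (coord_fun phi i x * wave k (- (pi / 2)) x).
have tg i k : tint (g i k) by apply: tintD; apply: tintZ; exact: tint_mulwave.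
rewrite /inner (eq_torus_int (h := fun x => \sum_i \sum_(k <- r) (vol R d)^-1 * g i k x)); last first.
  move=> x; apply: eq_bigr => i _.
  have -> : ev W x 0 i = ev (map (mult_mode (fun=> 1)) W) x 0 i by rewrite mult_mode1.
  rewrite -(fourier_sum_ev (s := fun=> 1) x i _ ur sub)// mulr_suml.
  by apply: eq_bigr => k _; rewrite /g /A /coord_fun; ring.
rewrite torus_int_sum => [|i _]; last by apply: tint_sum => k _; exact: tintZ.
rewrite exchange_big /= mulr_sumr; apply: eq_bigr => i _.
rewrite torus_int_sum => [|k _]; last exact: tintZ.
rewrite mulr_sumr; apply: eq_bigr => k _; rewrite torus_intZ//; congr (_ * _).
by rewrite /g torus_intD ?torus_intZ//; try apply: tintZ; exact: tint_mulwave.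
Qed.

Lemma young (e x y : R) : 0 < e -> `|x * y| <= e * x ^+ 2 + e^-1 * y ^+ 2.
Proof.
move=> e0; rewrite normrM -[x ^+ 2]real_normK ?num_real// -[y ^+ 2]real_normK ?num_real//.
have a0 : 0 <= `|x| by []. have b0 : 0 <= `|y| by [].
move: a0 b0; move: (`|x|) (`|y|) => u v u0 v0.
have h : 0 <= e^-1 * (e * u - v) ^+ 2 by rewrite mulr_ge0 ?sqr_ge0// invr_ge0 ltW.
have -> : e * u ^+ 2 + e^-1 * v ^+ 2 = e^-1 * (e * u - v) ^+ 2 + 2 * (u * v) by field; rewrite gt_eqF.
by have := mulr_ge0 u0 v0; lra.
Qed.

Lemma inner_fourier_le (W : seq mode) (phi : E -> E) r (e : R) : 0 < e ->
  (forall i, tint (coord_fun phi i)) -> uniq r -> {subset supp W <= r} ->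
  `|inner (ev W) phi| <= (vol R d)^-1 *
    (e * \sum_(k <- r) \sum_i coef2 (coord_fun (ev W) i) k
     + e^-1 * \sum_(k <- r) \sum_i coef2 (coord_fun phi i) k).
Proof.
move=> e0 tphi ur sub; have v0 := vol_gt0 R d.
rewrite (inner_fourier tphi ur sub) normrM ger0_norm ?invr_ge0 ?(ltW v0)//.
apply: ler_wpM2l; first by rewrite invr_ge0 ltW.
rewrite !mulr_sumr -big_split; apply: le_trans (ler_norm_sum _ _ _) _.
apply: ler_sum => k _ /=; rewrite !mulr_sumr -big_split.
apply: le_trans (ler_norm_sum _ _ _) _; apply: ler_sum => i _ /=.
apply: le_trans (ler_normD _ _) _.
have h1 := young (coef (coord_fun (ev W) i) k 0) (coef (coord_fun phi i) k 0) e0.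
have h2 := young (coef (coord_fun (ev W) i) k (- (pi / 2))) (coef (coord_fun phi i) k (- (pi / 2))) e0.
by apply: le_trans (lerD h1 h2) _; rewrite /coef2 !mulrDr addrACA.
Qed.

Lemma L2_tint (phi : E -> E) i : L2_field phi ->
  tint (coord_fun phi i) /\ tint (fun x => coord_fun phi i x ^+ 2).
Proof.
move=> [_ mphi L2].
have md : measurable_fun setT (fun z : d.-tuple (measurableTypeR R) => dot (phi (pt z)) (phi (pt z))).
  by apply: measurable_sum => j; apply: measurable_funM; exact: mphi.
have me : measurable_fun setT (fun z : d.-tuple (measurableTypeR R) => enorm (phi (pt z))).
  apply: (@measurableT_comp _ _ _ _ _ _ (@Num.sqrt R)); last exact: md.
  by apply: continuous_measurable_fun; exact: sqrt_continuous.
have tdot : tint (fun x => dot (phi x) (phi x)).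
  apply/integrableP; split; first exact/measurable_EFinP.
  have -> : (\int[cube_measure d]_z `|(dot (phi (pt z)) (phi (pt z)))%:E| =
      \int[cube_measure d]_z (`|enorm (phi (pt z))| `^ 2)%:E)%E.
    apply: eq_integral => z _; rewrite /= ger0_norm ?dot_ge0//.
    by rewrite -enorm_sqr ger0_norm ?enorm_ge0// -powR_mulrn ?enorm_ge0.
  move: L2; rewrite /Lq_norm Lnorm_realE; set I := integral _ _ _.
  have I0 : (0 <= I)%E by apply: integral_ge0 => z _; rewrite lee_fin powR_ge0.
  clearbody I; case: I I0 => [y| |] // _; first by rewrite !ltry.
  by rewrite poweRyr ?ltxx// invr_eq0 pnatr_eq0.
have t2 : tint (fun x => coord_fun phi i x ^+ 2).
  apply: (le_integrable measurableT _ _ tdot) => /=.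
    by apply/measurable_EFinP; apply: measurable_funX; exact: mphi.
  move=> z _ /=; rewrite lee_fin !ger0_norm ?sqr_ge0 ?dot_ge0//.
  rewrite /dot (bigD1 i)//= expr2 lerDl; apply: sumr_ge0 => j _.
  by rewrite -expr2 sqr_ge0.
split=> //.
have t3 : tint (fun x => 1 + coord_fun phi i x ^+ 2) by apply: tintD => //; exact: tint_cst.
apply: (le_integrable measurableT _ _ t3) => /=.
  by apply/measurable_EFinP; exact: mphi.
move=> z _ /=; rewrite lee_fin [leRHS]ger0_norm ?addr_ge0 ?sqr_ge0//.
move: (coord_fun phi i (pt z)) => a; rewrite -[a ^+ 2]real_normK ?num_real//.
by have := sqr_ge0 (`|a| - 1); have : 0 <= `|a| by []; lra.
Qed.

(** A finite sum that almost attains the supremum leaves little to the other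
    terms. *)
Lemma summable_tail (I : eqType) (a : I -> R) (B e : R) : (forall i, 0 <= a i) ->
  (forall r, uniq r -> \sum_(i <- r) a i <= B) -> 0 < e ->
  exists r0 : seq I, forall r, uniq r -> (forall k, k \in r -> k \notin r0) ->
    \sum_(i <- r) a i <= e.
Proof.
move=> a0 aB e0.
pose A : set R := [set y | exists2 r : seq I, uniq r & y = \sum_(i <- r) a i].
have hsA : has_sup A.
  split; first by exists 0; exists [::]; rewrite ?big_nil.
  by exists B => _ [r ur ->]; exact: aB.
have [_ [r0 ur0 ->] h] := sup_adherent e0 hsA.
exists r0 => r ur dis.
have : \sum_(i <- r0 ++ r) a i <= sup A.
  apply: (sup_upper_bound hsA); exists (r0 ++ r) => //.
  rewrite cat_uniq ur0 ur andbT /=; apply/hasPn => k kr.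
  exact: dis.
by rewrite big_cat /=; lra.
Qed.

Lemma L2_ev (W : seq mode) : L2_field (ev W).
Proof.
split; first exact: torus_fun_ev.
  by move=> i; apply: tmeas_cont; exact: continuous_ev_coord.
apply: le_lt_trans (Lq_norm_bounded _ _ (enorm_ev W)) (ltry _).
  by apply: fmeas_cont; exact: continuous_ev.
by rewrite lee_fin; lra.
Qed.

Lemma l1_cat (W W' : seq mode) : l1 (W ++ W') = l1 W + l1 W'.
Proof. by rewrite /l1 big_cat. Qed.

End fourier_estimates.

(** * The solution *)

Section solution.
Context {R : realType} {d : nat}.
Local Notation E := 'rV[R]_d.
Local Notation F := 'rV[int]_d.
Local Notation mode := (@mode R d).
Local Notation leb := (@lebesgue_measure R).
Variables (D : nat) (T C : R) (st : nat -> @tfield R d) (sl : nat -> E -> E).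
Hypotheses (D27 : (27 <= D)%N) (T0 : 0 < T) (C1 : 1 <= C) (cas : cascade D T C st sl).
Local Notation X := (@peak R D).
Local Notation b := (@stepR R).
Local Notation rem := (rem D T).
Local Notation t_ := (t_ D T).
Local Notation turn_end := (turn_end D T).
Local Notation valid := (valid D T).
Local Notation slot := (slot D T).
Local Notation idx := (idx D T).
Local Notation U n t := (freeze t (st n)).

Definition usol (t : R) : E -> E := if t < T then tev (st (idx t)) t else fun=> 0.
Definition fsol (t : R) : E -> E := if t < T then tev (force (st (idx t))) t else fun=> 0.

Lemma cdiv n : tdiv_free (st n).
Proof. by move=> m; exact: (cas_div cas). Qed.

(** In the overlap of two stages both are the same slab at rest. *)
Lemma usolE n t : valid n t -> usol t = tev (st n) t.
Proof.
move=> v; rewrite /usol (valid_ltT T0 v).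
case: (valid_cases D27 T0 v) => [->//|[m nm [-> /andP[h1 h2]]]].
by rewrite (cas_new cas h1) nm (cas_old cas)// -nm.
Qed.

Lemma usol_near n t : valid n t -> \near t, usol t = tev (st n) t.
Proof.
move=> v; near=> s; apply: usolE; near: s.
by apply: open_nbhs_nbhs; split=> //; exact: open_valid.
Unshelve. all: by end_near. Qed.

(** The equations determine the force, so the two descriptions agree in an
    overlap without any comparison of modes. *)
Lemma fsolE n t : valid n t -> fsol t = tev (force (st n)) t.
Proof.
move=> v; rewrite /fsol (valid_ltT T0 v); have tT := valid_ltT T0 v.
apply/funext => x; apply/rowP => i.
rewrite -(force_NSE x i (@cdiv n) (usol_near v)).
by rewrite -(force_NSE x i (@cdiv (idx t)) (usol_near (valid_idx D27 T0 tT))).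
Qed.

Lemma smooth_pieces (G : R -> E -> E) (l : nat -> @tfield R d) :
  (forall n t, valid n t -> G t = tev (l n) t) ->
  (forall t, t < T -> torus_fun (G t)) -> smooth_QT T G.
Proof.
move=> h tG; split=> [vs z /andP[z0 zT]|t /andP[_ tT]]; last exact: tG.
have v := valid_idx D27 T0 zT.
pose O : set (R^o * E) := fst @^-1` (valid (idx z.1)).
have oO : open O by apply: open_comp; [move=> *; exact: cvg_fst|exact: open_valid].
by apply: (@smooth_on_tev R d O _ (l (idx z.1)) oO) => // w Ow; rewrite (h _ _ Ow).
Qed.

Lemma torus_usol t : torus_fun (usol t).
Proof. by rewrite /usol; case: ifP => _ //; exact: torus_fun_tev. Qed.
Lemma torus_fsol t : torus_fun (fsol t).
Proof. by rewrite /fsol; case: ifP => _ //; exact: torus_fun_tev. Qed.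

Lemma smooth_usol : smooth_QT T usol.
Proof. by apply: smooth_pieces usolE _ => t _; exact: torus_usol. Qed.
Lemma smooth_fsol : smooth_QT T fsol.
Proof. by apply: smooth_pieces fsolE _ => t _; exact: torus_fsol. Qed.

Lemma iter_derive_cst0 (V W : normedModType R) (vs : seq V) :
  iter_derive vs (fun _ : V => 0 : W) = fun=> 0.
Proof. by elim: vs => //= v vs ->; apply/funext => z; exact: derive_cst. Qed.

Lemma smooth_pressure : smooth_QT T ((fun _ _ => 0) : R -> E -> R^o).
Proof.
split=> // vs z _; rewrite iter_derive_cst0; split=> [v|]; first exact: derivable_cst.
exact: cst_continuous.
Qed.

Lemma usol_NSE : NSE T usol fsol (fun _ _ => 0).
Proof.
move=> t x /andP[t0 tT]; have v := valid_idx D27 T0 tT; split=> [|i].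
  rewrite (usolE v); apply: divergence_ev; exact/div_free_freeze/cdiv.
have -> : partial i (fun _ : E => 0 : R) x = 0 by exact: derive_cst.
by rewrite addr0 (fsolE v) (force_NSE _ _ (@cdiv _) (usol_near v)).
Qed.

Lemma inner_usol n t : valid n t -> sqnorm2 (usol t) = pairing (U n t) (U n t).
Proof. by move=> v; rewrite /sqnorm2 (usolE v) inner_ev. Qed.

Lemma inner_work n t : valid n t ->
  inner (usol t) (fsol t) = pairing (U n t) (freeze t (force (st n))).
Proof. by move=> v; rewrite (usolE v) (fsolE v) inner_ev. Qed.

Lemma energy_le n t : 0 <= pairing (U n t) (U n t) <= vol R d + C.
Proof.
have := cas_energy cas n t; rewrite ler_norml => /andP[h1 h2].
apply/andP; split; first by rewrite -inner_ev; apply: torus_int_ge0 => x; exact: dot_ge0.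
have v0 := vol_gt0 R d; have /andP[_ b1] := @pow_bV R n 1.
have : C * (b n)^-1 <= C by rewrite ler_piMr//; have := C1; lra.
lra.
Qed.

Lemma pb_ge0 n : 0 <= X n ^+ 2 / b n ^+ 6.
Proof. by have := X_gt0 D n (R := R); have := b_gt0 n (R := R) => ? ?; pos. Qed.

Definition work_cst : R := C + C * (vol R d + C).
Lemma work_cst_ge0 : 0 <= work_cst.
Proof. by have := C1; have := vol_gt0 R d; rewrite /work_cst => ? ?; pos. Qed.

Lemma lap_bound n t (s : E -> R) : (forall k, 0 <= s k <= 1) ->
  0 <= pairing (map (mult_mode (fun x => dot x x * s x)) (U n t)) (U n t)
    <= C * (vol R d + C) * (X n ^+ 2 / b n ^+ 6).
Proof.
move=> hs.
have /andP[h0 h1] := @cas_symbol _ _ _ _ _ _ _ cas n t (fun x => dot x x * s x)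
   (C * (X n ^+ 2 / b n ^+ 6)) (fun m hm => ltac:(
     have /andP[s0 s1] := hs (freq (fr m));
     rewrite mulr_ge0 ?dot_ge0//=; apply: le_trans (cas_freq_le cas hm);
     by rewrite ler_piMr ?dot_ge0)).
rewrite h0 /=; apply: le_trans h1 _; rewrite [leRHS]mulrAC.
have c0 : 0 <= C by have := C1; lra.
apply: ler_wpM2l; first by rewrite mulr_ge0// pb_ge0.
by have /andP[] := energy_le n t.
Qed.

(** The filtered work of the force is that of the turnover, which is small by
    cancellation, plus the dissipation. *)
Lemma filtered_work_le n t (s : E -> R) : (forall k, 0 <= s k <= 1) ->
  `|pairing (map (mult_mode s) (U n t)) (freeze t (force (st n)))|
   <= work_cst * (X n ^+ 2 / b n ^+ 6).
Proof.
move=> hs; rewrite pairing_force; apply: le_trans (ler_normD _ _) _.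
rewrite /work_cst [leRHS]mulrDl; apply: lerD; first exact: (cas_work cas).
by have /andP[h0 h1] := lap_bound n t hs; rewrite ger0_norm.
Qed.

Lemma work_le n t : valid n t -> `|inner (usol t) (fsol t)| <= work_cst * (X n ^+ 2 / b n ^+ 6).
Proof.
move=> v; rewrite (inner_work v) -{1}[U n t]mult_mode1.
by apply: filtered_work_le => k; rewrite ler01 lexx.
Qed.

Lemma measurable_work : measurable_fun `]0, T[ (fun t => inner (usol t) (fsol t)).
Proof.
apply: (measurable_valid_real D27 T0) => n.
exists (fun t => pairing (U n t) (freeze t (force (st n)))); last exact: inner_work.
exact/smooth1_continuous/smooth1_pairing.
Qed.

Lemma integrable_work : leb.-integrable `]0, T[ (EFin \o (fun t => inner (usol t) (fsol t))).
Proof.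
apply: (stage_integrable D27 T0 work_cst_ge0 measurable_work) => n t /(slot_valid D27 T0).
exact: work_le.
Qed.

Lemma classL_work : classL 0 T (fun t => inner (usol t) (fsol t)).
Proof. by eexists; exact: limit_integral_integrable integrable_work. Qed.

(** * Energy equality *)

Lemma continuous_pieces (N : R -> R) :
  (forall n, exists2 g : R -> R, continuous g & forall t, valid n t -> N t = g t) ->
  forall t, t < T -> {for t, continuous N}.
Proof.
move=> h t tT; have [g cg gN] := h (idx t).
apply: (@continuous_at_near_eq R R^o R^o g) (cg t); near=> s; rewrite gN//; near: s.
by apply: open_nbhs_nbhs; split; [exact: open_valid|exact: valid_idx].
Unshelve. all: by end_near. Qed.

Let wk t := inner (usol t) (fsol t).
Let gr t := sqnorm2_grad (usol t).

Lemma continuous_wk t : t < T -> {for t, continuous wk}.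
Proof.
apply: continuous_pieces => n; eexists; last exact: inner_work.
exact/smooth1_continuous/smooth1_pairing.
Qed.

Lemma gr_pairing n t : valid n t -> gr t = pairing (U n t) (freeze t (tmap (@lap_mode R d) (st n))).
Proof. by move=> v; rewrite /gr (usolE v) /tev sqnorm2_grad_ev freeze_lap. Qed.

Lemma continuous_gr t : t < T -> {for t, continuous gr}.
Proof.
apply: continuous_pieces => n; eexists; last exact: gr_pairing.
exact/smooth1_continuous/smooth1_pairing.
Qed.

(** The transport does no work, so the rate of the energy is the work minus
    the dissipation. *)
Lemma is_derive_energy (t : R) : t < T ->
  is_derive t 1 (fun t => 2^-1 * sqnorm2 (usol t)) (wk t - gr t).
Proof.
move=> tT; have v := valid_idx D27 T0 tT; set n := idx t in v.
have N : \near t, 2^-1 * pairing (U n t) (U n t) = 2^-1 * sqnorm2 (usol t).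
  near=> s; rewrite (@inner_usol n s)//; near: s.
  by apply: open_nbhs_nbhs; split=> //; exact: open_valid.
have D1 : is_derive t 1 (fun t => 2^-1 * pairing (U n t) (U n t)) (wk t - gr t).
  have -> : wk t - gr t = 2^-1 * (2 * pairing (U n t) (freeze t (tderiv (st n)))).
    rewrite /wk /gr (inner_work v) (pairing_force1 _ (@cdiv n)) -(usolE v).
    by rewrite addrK mulrA mulVf// mul1r.
  apply: (@is_deriveZ R R R (fun t => pairing (U n t) (U n t))).
  exact: is_derive_pairing.
have [d1 d2] := D1; apply: DeriveDef; first exact: near_eq_derivable N d1.
by rewrite -d2; apply: esym; apply: near_eq_derive.
Unshelve. all: by end_near. Qed.

Lemma within_lt (N : R -> R) a c : (forall t, t < T -> {for t, continuous N}) -> c < T ->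
  {within `[a, c], continuous N}.
Proof.
move=> h cT; apply: continuous_in_subspaceT => t; rewrite inE /= in_itv/= => /andP[_ tc].
by apply: h; exact: le_lt_trans cT.
Qed.

Lemma integrable_lt (N : R -> R) a c : (forall t, t < T -> {for t, continuous N}) -> c < T ->
  leb.-integrable `]a, c[ (EFin \o N).
Proof.
move=> h cT.
suff : leb.-integrable `[a, c] (EFin \o N).
  apply: integrableS => //.
  by move=> x /=; rewrite !in_itv/= => /andP[? ?]; rewrite !ltW.
by apply: continuous_compact_integrable; [exact: segment_compact|exact: within_lt].
Qed.

Lemma energy_balance (t0 t1 : R) : t0 < t1 -> t1 < T ->
  2^-1 * sqnorm2 (usol t1) - 2^-1 * sqnorm2 (usol t0) =
  \int[leb]_(t in `]t0, t1[) wk t - \int[leb]_(t in `]t0, t1[) gr t.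
Proof.
move=> t01 t1T.
have ch t : t < T -> {for t, continuous (fun t => wk t - gr t)}.
  by move=> tT; apply: cvgB; [exact: continuous_wk|exact: continuous_gr].
rewrite -RintegralB//; [|exact: integrable_lt continuous_wk _|exact: integrable_lt continuous_gr _].
pose Fe t := 2^-1 * sqnorm2 (usol t).
have cF t : t < T -> {for t, continuous Fe}.
  move=> tT; apply/differentiable_continuous/derivable1_diffP.
  by have [] := is_derive_energy tT.
have FTC := @continuous_FTC2 R (fun t => wk t - gr t) Fe t0 t1 t01 (within_lt (a := t0) ch t1T).
have dF : derivable_oo_LRcontinuous Fe t0 t1.
  split.
  - move=> t; rewrite in_itv/= => /andP[_ tt1].
    by have [] := is_derive_energy (lt_trans tt1 t1T).
  - by apply: cvg_at_right_filter; apply: cF; exact: lt_trans t1T.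
  - by apply: cvg_at_left_filter; exact: cF.
have dE : {in `]t0, t1[%R, derive1 Fe =1 (fun t => wk t - gr t)}.
  move=> t; rewrite in_itv/= => /andP[_ tt1].
  by rewrite derive1E; have [] := is_derive_energy (lt_trans tt1 t1T).
have {}FTC := FTC dF dE.
rewrite /Rintegral -(@integral_itv_bndoo R t0 t1 _ true false).
  by rewrite FTC -EFinB.
by have /integrableP[] := integrable_lt t0 ch t1T.
Qed.

Lemma oriented_lt (N : R -> R) (t0 t1 : R) :
  (forall t, t < T -> {for t, continuous N}) -> t0 < T -> t1 < T ->
  oriented_integral N t0 t1 (if t0 < t1 then \int[leb]_(t in `]t0, t1[) N t
    else - \int[leb]_(t in `]t1, t0[) N t).
Proof.
move=> h h0 h1; rewrite /oriented_integral; case: ltgtP => [lt01|lt10|<-].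
- by apply: limit_integral_integrable => //; exact: integrable_lt.
- by rewrite opprK; apply: limit_integral_integrable => //; exact: integrable_lt.
- by rewrite set_itvoo0 Rintegral_set0 oppr0; exact: limit_integral_point.
Qed.

Lemma usol_energy_equality : energy_equality T usol fsol.
Proof.
move=> t0 t1 /andP[_ h0] /andP[_ h1].
eexists; eexists; split; [exact: oriented_lt continuous_gr h0 h1|exact: oriented_lt continuous_wk h0 h1|].
case: ltgtP => [lt01|lt10|<-].
- by rewrite energy_balance// subrK.
- rewrite -[X in X + _]opprB (energy_balance lt10 h0) opprB.
  by rewrite addrAC subrr add0r.
- by rewrite set_itvoo0 !Rintegral_set0; lra.
Qed.

(** * Low-pass filters and the anomalous work *)

Lemma chi_even (chi : E -> R) : LP_cutoff chi -> forall x, chi (- x) = chi x.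
Proof.
move=> [_ mono _ _] x; apply/eqP; rewrite eq_le.
have e : enorm (- x) = enorm x by rewrite /enorm dotNN.
by rewrite !mono ?e.
Qed.

(** Monotonicity squeezes the cutoff between its value 1 at 0 and its value 0
    far away. *)
Lemma chi01 (chi : E -> R) : LP_cutoff chi -> forall x, 0 <= chi x <= 1.
Proof.
move=> [_ mono one zero] x.
have one0 : chi 0 = 1 by apply: one; rewrite enorm0 invr_ge0.
apply/andP; split; last by rewrite -one0; apply: mono; rewrite enorm0 enorm_ge0.
have [x1|x1] := leP 1 (enorm x); first by rewrite zero.
have [x0|x0] := eqVneq (enorm x) 0.
  by rewrite one// x0 invr_ge0.
have xp : 0 < enorm x by rewrite lt0r x0 enorm_ge0.
have e1 : enorm ((enorm x)^-1 *: x) = 1.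
  by rewrite enormZ ger0_norm ?mulVf// invr_ge0 enorm_ge0.
by rewrite -(zero ((enorm x)^-1 *: x)) ?e1//; apply: mono; rewrite e1 ltW.
Qed.

Lemma LP_symbolN (chi : E -> R) q : LP_cutoff chi -> forall x, LP_symbol chi q (- x) = LP_symbol chi q x.
Proof.
move=> hchi x; have eN := chi_even hchi.
by rewrite /LP_symbol !scalerN !eN.
Qed.

(** The symbol of the sum of the first q + 2 blocks, which telescopes. *)
Definition low (chi : E -> R) (q : nat) (x : E) : R := chi ((2^-1 ^+ q.+1) *: x).

Lemma LP_symbol_sum chi q x : \sum_(r < q.+2) LP_symbol chi (r%:Z - 1) x = low chi q x.
Proof.
rewrite /low; elim: q => [|q IH].
  rewrite 2!big_ord_recl big_ord0 addr0 /= /LP_symbol /= !scale1r expr1.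
  by rewrite [_ + (_ - _)]addrC subrK.
rewrite big_ord_recr /= IH /LP_symbol.
have -> : (q.+2%:Z - 1 : int) = q.+1%:Z by lia.
rewrite /= -exprnN -exprVn scalerA -exprS.
by rewrite addrC subrK.
Qed.

Lemma LP_le_ev chi q (W : seq mode) : LP_cutoff chi ->
  LP_le chi q (ev W) = ev (map (mult_mode (low chi q)) W).
Proof.
move=> hchi; apply/funext => x; rewrite /LP_le.
transitivity (\sum_(r < q.+2) ev (map (mult_mode (LP_symbol chi (r%:Z - 1))) W) x).
  by apply: eq_bigr => r _; rewrite /LP_block multiplier_ev//; exact: LP_symbolN.
rewrite ev_mult; under eq_bigr do rewrite ev_mult.
rewrite exchange_big; apply: eq_bigr => m _ /=.
by rewrite -scaler_suml LP_symbol_sum.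
Qed.

Lemma lowN chi q : LP_cutoff chi -> forall x, low chi q (- x) = low chi q x.
Proof. by move=> hchi x; rewrite /low scalerN chi_even. Qed.

Lemma low01 chi q : LP_cutoff chi -> forall x, 0 <= low chi q x ^+ 2 <= 1.
Proof.
move=> hchi x; have /andP[h0 h1] := chi01 hchi ((2^-1 ^+ q.+1) *: x).
by rewrite sqr_ge0 expr_le1.
Qed.

Definition defect chi q t :=
  inner (LP_le chi q (usol t)) (LP_le chi q (fsol t)) - inner (usol t) (fsol t).

Lemma defectE chi q n t : LP_cutoff chi -> valid n t -> defect chi q t =
  pairing (map (mult_mode (fun x => low chi q x ^+ 2)) (U n t)) (freeze t (force (st n)))
  - pairing (U n t) (freeze t (force (st n))).
Proof.
move=> hchi v; rewrite /defect (inner_work v) (usolE v) (fsolE v) !LP_le_ev// inner_ev.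
by rewrite pairing_mult//; exact: lowN.
Qed.

Lemma defect_le chi q n t : LP_cutoff chi -> valid n t ->
  `|defect chi q t| <= 2 * work_cst * (X n ^+ 2 / b n ^+ 6).
Proof.
move=> hchi v; rewrite (defectE _ hchi v); apply: le_trans (ler_normB _ _) _.
rewrite -mulrA mulr_natl mulr2n; apply: lerD.
  by apply: filtered_work_le; exact: low01.
by rewrite -(inner_work v); exact: work_le.
Qed.

(** The frequencies that are active at a given time are bounded, so that the
    filters eventually act as the identity. *)
Lemma defect_eq0 chi n t : LP_cutoff chi -> valid n t -> \forall q \near \oo, defect chi q t = 0.
Proof.
move=> hchi v; have pb := pb_ge0 n; have c0 : 0 <= C by have := C1; lra.
pose K := 1 + C * (X n ^+ 2 / b n ^+ 6).
have K1 : 1 <= K by rewrite /K lerDl mulr_ge0.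
exists (Num.truncn K).+1 => // q /= hq.
have Kq : K <= 2 ^+ q.
  apply: le_trans (ltW (truncnS_gt K)) _; rewrite -natrX ler_nat.
  by apply: leq_trans hq _; rewrite ltnW// ltn_expl.
rewrite (defectE _ hchi v).
suff -> : map (mult_mode (fun x => low chi q x ^+ 2)) (U n t) = U n t by rewrite subrr.
rewrite -[RHS]map_id; apply/eq_in_map => m mU.
have {}mU : dot (freq (fr m) : E) (freq (fr m)) <= K.
  have [z zl ->] : exists2 m0, m0 \in [seq z.2 | z : amplitude * mode <- st n] & fr m = fr m0.
    have : fr m \in map (@fr R d) (U n t) by exact: map_f.
    rewrite /freeze -map_comp (eq_map (g := @fr R d \o snd))// map_comp => /mapP[m0 ? ->].
    by exists m0.
  by apply: le_trans (cas_freq_le cas zl) _; rewrite /K lerDr.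
have [_ _ one _] := hchi.
have -> : mult_mode (fun x => low chi q x ^+ 2) m = mult_mode (fun=> 1) m.
  rewrite /mult_mode /low one ?expr1n// enormZ ger0_norm ?exprn_ge0 ?invr_ge0//.
  have e1 : enorm (freq (fr m) : E) <= K.
    apply: enorm_le; first lra.
    by apply: le_trans mU _; rewrite expr2 ler_peMr//; lra.
  have q0 : 0 < 2 ^+ q :> R by rewrite exprn_gt0.
  rewrite exprSr exprVn -ler_pdivlMl ?mulr_gt0 ?invr_gt0// invfM !invrK.
  by rewrite -mulrA mulfV// mulr1; exact: le_trans e1 Kq.
by case: (m) => k p a; rewrite /mult_mode /= scale1r.
Qed.

(** The common majorant of the works in all filters, up to a constant. *)
Definition dom t : R := X (idx t) ^+ 2 / b (idx t) ^+ 6.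

Lemma measurable_dom : measurable_fun `]0, T[ dom.
Proof.
rewrite (bigcup_slot D27 T0); apply/measurable_fun_bigcup => [|n]; first exact: measurable_slot.
apply: (eq_measurable_fun (cst (X n ^+ 2 / b n ^+ 6))); last exact: measurable_cst.
by move=> t; rewrite inE => /(slot_uniq D27 T0) h; rewrite /dom h.
Qed.

Lemma integrable_dom : leb.-integrable `]0, T[ (EFin \o dom).
Proof.
apply: (stage_integrable D27 T0 ler01 measurable_dom) => n t nt.
by rewrite /dom (slot_uniq D27 T0 nt) mul1r ger0_norm// pb_ge0.
Qed.

Lemma measurable_defect chi q : LP_cutoff chi -> measurable_fun `]0, T[ (defect chi q).
Proof.
move=> hchi; apply: (measurable_valid_real D27 T0) => n.
eexists; last by move=> t; exact: defectE.
have -> : (fun t => pairing (map (mult_mode (fun x => low chi q x ^+ 2)) (U n t))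
    (freeze t (force (st n))) - pairing (U n t) (freeze t (force (st n)))) =
  (fun t => pairing (freeze t (tmap (mult_mode (fun x => low chi q x ^+ 2)) (st n)))
    (freeze t (force (st n))) - pairing (U n t) (freeze t (force (st n)))).
  apply/funext => t; congr (pairing _ _ - _); rewrite /freeze /tmap -!map_comp.
  by apply: eq_map => z; rewrite /mult_mode /scale_mode /= !scalerA mulrC.
by move=> t; apply: cvgB; exact/smooth1_continuous/smooth1_pairing.
Qed.

(** Dominated convergence: the defects have a common integrable bound and
    vanish one time after another. *)
Lemma usol_anomalous chi : LP_cutoff chi -> anomalous_work_vanishes chi T usol fsol.
Proof.
move=> hchi; have T1 := T0; pose I := (`]T / 2, T[)%classic : set R.
have sub : I `<=` `]0, T[%classic.
  by move=> t; rewrite /I /= !in_itv/= => /andP[h ->]; rewrite andbT; lra.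
have mI : measurable I by exact: measurable_itv.
have T2 : T / 2 < T by lra.
have md q : measurable_fun I (defect chi q).
  by apply: measurable_funS (measurable_defect q hchi) => //; exact: measurable_itv.
have dle q t : I t -> `|defect chi q t| <= 2 * work_cst * dom t.
  move=> It; have := sub _ It; rewrite /= in_itv/= => /andP[_ tT].
  exact: defect_le hchi (valid_idx D27 T0 tT).
have idom : leb.-integrable I (EFin \o (fun t => 2 * work_cst * dom t)).
  have -> : EFin \o (fun t => 2 * work_cst * dom t) = (fun t => ((2 * work_cst)%:E * (dom t)%:E))%E by [].
  by apply: integrableZl => //; apply: integrableS integrable_dom => //; exact: measurable_itv.
have idef q : leb.-integrable I (EFin \o defect chi q).
  have c0 : 0 <= 2 * work_cst by rewrite mulr_ge0// work_cst_ge0.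
  have h : leb.-integrable `]0, T[ (EFin \o defect chi q).
    apply: (stage_integrable D27 T0 c0 (measurable_defect q hchi)) => n t /(slot_valid D27 T0).
    exact: defect_le.
  by apply: integrableS h => //; exact: measurable_itv.
have DC := @dominated_convergence _ _ _ leb I mI (fun q t => (defect chi q t)%:E)
   (cst 0%E) (EFin \o (fun t => 2 * work_cst * dom t)).
have [| | | | |_ _ DC'] := DC.
- by move=> q; apply/measurable_EFinP; exact: md.
- exact: measurable_cst.
- apply: aeW => t It; apply: cvg_near_cst.
  have := sub _ It; rewrite /= in_itv/= => /andP[_ tT].
  by apply: filterS (defect_eq0 hchi (valid_idx D27 T0 tT)) => q ->.
- exact: idom.
- by apply: aeW => t q It; rewrite lee_fin; exact: dle.
exists (fun q => \int[leb]_(t in I) defect chi q t); split.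
  by move=> q; apply: limit_integral_integrable T2 _; exact: idef.
move: DC'; rewrite integral0 => /fine_cvg; exact.
Qed.

(** * The energy at the final time *)

Lemma near_idx N : \forall t \near T^'-, t < T /\ (N <= idx t)%N.
Proof.
have N1 := nbhs_left_gt (t_ltT D T0 N); have N2 := nbhs_left_lt T.
apply: filterS2 N1 N2 => t h1 h2; split=> //.
rewrite leqNgt; apply/negP => iN; have [h3 _] := idxP D27 T0 h2.
by have := lt_trans h1 (lt_le_trans h3 (t_mono D27 T0 iN)); rewrite ltxx.
Qed.

Lemma step_ge (n : nat) : n%:R <= b n.
Proof. by rewrite ler_nat ltnW// (leq_trans (ltn_expl n (isT : 1 < 2)%N))// leq_exp2l// leq_addr. Qed.

Lemma step_mono m n : (m <= n)%N -> b m <= b n.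
Proof. by move=> mn; rewrite ler_nat leq_exp2l// leq_add2r. Qed.

(** The index of the stage, and with it the step, tends to infinity as t tends
    to T. *)
Lemma cvg_stage (g : R -> R) (l K : R) :
  (forall n t, valid n t -> `|l - g t| <= K * (b n)^-1) -> g @ T^'- --> l.
Proof.
move=> h; apply/cvgrPdist_le => eps e0.
have K0 : 0 <= `|K| by [].
pose N := (Num.truncn (`|K| / eps)).+1.
apply: filterS (near_idx N) => t [tT iN].
apply: le_trans (h _ _ (valid_idx D27 T0 tT)) _.
have b0 := b_gt0 (idx t) (R := R).
rewrite ler_pdivrMr//; apply: le_trans (ler_norm _) _.
rewrite mulrC -ler_pdivrMr//; apply: le_trans (ltW (truncnS_gt _)) _.
by apply: le_trans (step_ge _) _; exact: step_mono.
Qed.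

(** The energy stays near half the volume of the torus up to the time T, where
    the velocity is zero. *)
Lemma usol_jump : exists l : R, (fun t => sqnorm2 (usol t)) @ T^'- --> l /\
       sqnorm2 (usol T) < l.
Proof.
exists (vol R d / 2); split.
  apply: (@cvg_stage _ _ C) => n t v; rewrite distrC (inner_usol v).
  exact: (cas_energy cas).
rewrite /usol ltxx /sqnorm2 /inner (eq_torus_int (h := fun=> 0)) ?torus_int0.
  by rewrite divr_gt0 ?vol_gt0.
by move=> x; rewrite dot0l.
Qed.

(** * Lebesgue norms in space *)

(** A stage lasts about b^5 / X^2 = b^(5 - 2 D), and the p-th power of the
    norm is at most b^(D a p): the hypothesis on the exponent makes
    [stage_dominated] applicable. *)
Lemma in_Lp_pow (p a K : R) (N : R -> \bar R) : 0 < p -> 0 <= K ->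
  6 <= D%:R * (2 - a * p) ->
  measurable_fun `]0, T[ N -> (forall t, (0 <= N t)%E) ->
  (forall n t, slot n t -> (N t <= (K * X n `^ a)%:E)%E) ->
  in_Lp_time T p%:E N.
Proof.
move=> p0 K0 hp mN N0 hN; split=> //; rewrite unlock /Lnorm.
apply: poweR_lty.
under eq_integral => t _.
  rewrite gee0_abs; last by rewrite patchE; case: ifP.
  have -> : (((N \_ `]0%R, T[) t) `^ p = ((fun t => N t `^ p) \_ `]0%R, T[) t)%E.
    by rewrite !patchE; case: ifP => // _; rewrite poweR0r// gt_eqF.
  over.
rewrite -integral_mkcond.
apply: (@stage_dominated R D T D27 T0 _ (K `^ p)) => //.
- exact: powR_ge0.
- by apply: (measurableT_comp (measurable_poweR _)).
- by move=> t _; exact: poweR_ge0.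
move=> n t nt; have X1 := X_gt0 D n (R := R); have b1 := b_ge1 n (R := R).
have b0 := b_gt0 n (R := R).
apply: le_trans (le_poweR (ltW p0) (N0 t) (hN n t nt)) _.
rewrite poweR_EFin lee_fin powRM ?powR_ge0//.
apply: ler_wpM2l; first exact: powR_ge0.
rewrite -powRrM /peak -[X in X `^ _]powR_mulrn ?(ltW b0)// -powRrM.
have -> : (b n ^+ D) ^+ 2 / b n ^+ 6 = b n `^ (D%:R * 2 - 6).
  rewrite powRD; last by rewrite (gt_eqF b0) implybT.
  rewrite powRN -[_ `^ 6]/(b n `^ (6%:R)) powR_mulrn ?ltW//.
  by rewrite powRrM !powR_mulrn ?exprn_ge0 ?ltW.
by apply: ler_powR => //; lra.
Qed.

Lemma in_Lp_oo (K : R) (N : R -> \bar R) :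
  measurable_fun `]0, T[ N -> (forall t, (0 <= N t)%E) ->
  (forall t, 0 < t < T -> (N t <= K%:E)%E) -> in_Lp_time T +oo%E N.
Proof.
move=> mN N0 hN; split=> //; rewrite unlock /Lnorm; case: ifP => // _.
apply: (@le_lt_trans _ _ (`|K|%:E)%E); last by rewrite ltry.
apply/ess_supP; apply: nearW => t /=.
rewrite gee0_abs; last by rewrite patchE; case: ifP.
rewrite patchE; case: ifPn => [|_]; last by rewrite lee_fin.
rewrite inE /= in_itv/= => ht; apply: le_trans (hN t ht) _.
by rewrite lee_fin ler_norm.
Qed.

Lemma tev_sub_le (l : @tfield R d) t s x :
  enorm (tev l t x - tev l s x) <= \sum_(z <- l) `|aval z.1 t - aval z.1 s| * enorm (amp z.2).
Proof.
rewrite !tevE -sumrB; apply: le_trans (enorm_sum _ _) _; apply: ler_sum => z _.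
rewrite -scalerBl enormZ ler_wpM2r ?enorm_ge0// -mulrBr normrM.
by rewrite ler_piMl// wave_le1.
Qed.

Lemma tev_fmeas (l : @tfield R d) t : fmeas (tev l t).
Proof. by apply: fmeas_cont; exact: continuous_ev. Qed.

Lemma Lq_tev_fin (l : @tfield R d) (q : \bar R) t : (1 <= q)%E ->
  Lq_norm q (tev l t) = (fine (Lq_norm q (tev l t)))%:E.
Proof.
move=> q1; rewrite fineK//; apply: (@Lq_norm_fin_num _ _ q _ (l1 (freeze t l))) => //.
  exact: tev_fmeas.
by move=> x; exact: enorm_ev.
Qed.

(** The norm of the difference of two fields is at most a multiple of the
    differences of their amplitudes. This serves the measurability in time. *)
Lemma continuous_Lq (l : @tfield R d) (q : \bar R) : (1 <= q)%E ->
  continuous (fun t => fine (Lq_norm q (tev l t))).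
Proof.
move=> q1 t; pose h s := @Kq R d q * \sum_(z <- l) `|aval z.1 t - aval z.1 s| * enorm (amp z.2).
have Kq0 : 0 <= @Kq R d q by rewrite /Kq; case: (q) => [q'| |] //=; exact: powR_ge0.
have ch : {for t, continuous h}.
  apply: (@cvgM R R (nbhs t)); first exact: cvg_cst.
  apply: continuous_bigsum => z s; apply: (@cvgM R R (nbhs s)); last exact: cvg_cst.
  apply: cvg_norm; apply: cvgB; first exact: cvg_cst.
  exact/smooth1_continuous/aP.
have h0 : h t = 0 by rewrite /h big1 ?mulr0// => z _; rewrite subrr normr0 mul0r.
have one r s : fine (Lq_norm q (tev l r)) - fine (Lq_norm q (tev l s))
    <= @Kq R d q * \sum_(z <- l) `|aval z.1 r - aval z.1 s| * enorm (amp z.2).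
  rewrite lerBlDl -lee_fin EFinD -!Lq_tev_fin//.
  have m3 : fmeas (fun x => tev l r x - tev l s x).
    have -> : (fun x => tev l r x - tev l s x) =
        ev (freeze r l ++ map (scale_mode (-1)) (freeze s l)).
      by apply/funext => x; rewrite ev_cat ev_scale scaleN1r.
    by apply: fmeas_cont; exact: continuous_ev.
  apply: le_trans (Lq_norm_triangle (tev_fmeas l r) (tev_fmeas l s) m3 q1) _.
  rewrite leeD2l//; apply: Lq_norm_bounded => // x; exact: tev_sub_le.
apply/cvgrPdist_le => eps e0.
have := ch; rewrite /prop_for /continuous_at h0 => /cvgrPdist_le /(_ _ e0).
apply: filterS => s; rewrite sub0r normrN => hs.
apply: le_trans hs; apply: le_trans (ler_norm _).
rewrite ler_norml; apply/andP; split; last exact: one.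
rewrite lerNl opprB; apply: le_trans (one s t) _; rewrite /h.
by under eq_bigr do rewrite distrC.
Qed.

Lemma measurable_Lq (q : \bar R) (G : R -> E -> E) (l : nat -> @tfield R d) : (1 <= q)%E ->
  (forall n t, valid n t -> G t = tev (l n) t) ->
  measurable_fun `]0, T[ (fun t => Lq_norm q (G t)).
Proof.
move=> q1 h; apply: (measurable_valid_pieces D27 T0) => n.
exists (fun t => fine (Lq_norm q (tev (l n) t))); first exact: continuous_Lq.
by move=> t /h ->; exact: Lq_tev_fin.
Qed.

Let S : R := vol R d + C.
Let S0 : 0 <= S. Proof. by have := vol_gt0 R d; have := C1; rewrite /S; lra. Qed.

(** Interpolation between the maximum and the energy of a stage; the symbol
    allows for Littlewood-Paley blocks. *)
Lemma stage_Lq (q : R) n t s : 1 <= q -> (forall x, 0 <= s x <= 1) -> (forall x, s (- x) = s x) ->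
  (Lq_norm q%:E (ev (map (mult_mode s) (U n t)))
   <= ((if 2 <= q then (C * X n) `^ (q - 2) * S else vol R d + S) `^ q^-1)%:E)%E.
Proof.
move=> q1 hs sN; apply: Lq_norm_interp => //.
- by apply: fmeas_cont; exact: continuous_ev.
- move=> x; apply: le_trans (enorm_ev _ _) _; apply: le_trans (cas_l1 cas n t).
  rewrite /l1 big_map; apply: ler_sum => m _; rewrite /= enormZ.
  have /andP[h0 h1] := hs (freq (fr m)).
  by rewrite ger0_norm// ler_piMl// enorm_ge0.
- rewrite /sqnorm2 inner_ev pairing_mult//.
  have hs2 m : m \in [seq z.2 | z : amplitude * mode <- st n] ->
      0 <= s (freq (fr m)) ^+ 2 <= 1.
    by move=> _; have /andP[h0 h1] := hs (freq (fr m)); rewrite sqr_ge0 expr_le1.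
  have /andP[_] := @cas_symbol _ _ _ _ _ _ _ cas n t (fun x => s x ^+ 2) 1 hs2.
  by rewrite mul1r => /le_trans; apply; have /andP[] := energy_le n t.
- exact: tint_dot_ev.
Qed.

Lemma usol_ge0 (q : \bar R) t : (0 <= Lq_norm q (usol t))%E. Proof. exact: Lq_norm_ge0. Qed.

Lemma usol_Lq_low (q : R) t : 1 <= q <= 2 -> 0 < t < T ->
  (Lq_norm q%:E (usol t) <= ((vol R d + S) `^ q^-1)%:E)%E.
Proof.
move=> /andP[q1 q2] /andP[t0 tT]; have v := valid_idx D27 T0 tT.
rewrite (usolE v); have := @stage_Lq q (idx t) t (fun=> 1) q1.
rewrite mult_mode1 => /(_ _ _)/le_trans; apply => //; first by move=> _; rewrite ler01 lexx.
rewrite lee_fin; case: ifP => // q2'.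
have -> : q = 2 by apply/eqP; rewrite eq_le q2 q2'.
rewrite subrr powRr0 mul1r; apply: ge0_ler_powR; rewrite ?nnegrE ?invr_ge0//.
- by have := vol_gt0 R d; have := S0; lra.
- by have := vol_gt0 R d; lra.
Qed.

Lemma usol_L2 : in_Lp_time T +oo%E (fun t => Lq_norm 2%:E (usol t)).
Proof.
apply: (@in_Lp_oo ((vol R d + S) `^ 2^-1)).
- apply: (measurable_Lq (l := st)) => //; first by rewrite lee_fin ler1n.
  exact: usolE.
- by move=> t; exact: usol_ge0.
- by move=> t ht; apply: usol_Lq_low => //; rewrite lexx andbT ler1n.
Qed.

Lemma freeze_freq n t m : m \in U n t ->
  exists2 m0, m0 \in [seq z.2 | z : amplitude * mode <- st n] & fr m = fr m0.
Proof.
move=> mU; have : fr m \in map (@fr R d) (U n t) by exact: map_f.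
rewrite /freeze -map_comp (eq_map (g := @fr R d \o snd))// map_comp => /mapP[m0 ? ->].
by exists m0.
Qed.

Lemma freq_enorm n t m : m \in U n t -> enorm (freq (fr m) : E) <= C * (X n / b n ^+ 3).
Proof.
have X0 := X_gt0 D n (R := R); have b0 := b_gt0 n (R := R); have c1 := C1.
move=> /freeze_freq[m0 hm ->]; apply: enorm_le; first by pos.
apply: le_trans (cas_freq_le cas hm) _.
have -> : (C * (X n / b n ^+ 3)) ^+ 2 = C * (C * (X n ^+ 2 / b n ^+ 6)) by field; pos.
by rewrite ler_peMl// mulr_ge0 ?pb_ge0//; lra.
Qed.

(** * Weak limits of the velocity *)

Lemma freq_floor_ge n : b n / 4 <= X n ^+ 2 / b n ^+ 6 / 4.
Proof.
have b0 := b_gt0 n (R := R); have b1 := b_ge1 n (R := R).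
rewrite ler_pM2r// ler_pdivlMr ?exprn_gt0// -exprS /peak -exprM.
by apply: ler_weXn2l => //; have := D27; lia.
Qed.

(** The frequencies of the velocity leave every finite set, so only a tail of
    the Fourier coefficients of the test field matters, and this tail is small
    by Bessel's inequality. *)
Lemma cvg_weak (phi : E -> E) : L2_field phi ->
  (fun t => inner (usol t) phi) @ T^'- --> (0 : R).
Proof.
move=> Lphi; have tphi i := (L2_tint i Lphi).1; have tphi2 i := (L2_tint i Lphi).2.
have v0 := vol_gt0 R d; have S00 := S0.
apply/cvgrPdist_le => e e0.
(* The weight [a] splits the error evenly between the energy of the velocity
   and the tail of the test field. *)
have S1 : 0 < S + 1 by lra.
pose a := e / (2 * (S + 1)); have a0 : 0 < a by rewrite /a divr_gt0// mulr_gt0.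
pose cphi k := \sum_i coef2 (coord_fun phi i) k.
have c0 k : 0 <= cphi k by apply: sumr_ge0 => i _; exact: coef2_ge0.
have cB r : uniq r -> \sum_(k <- r) cphi k <=
    \sum_i vol R d * torus_int (fun x => coord_fun phi i x ^+ 2).
  by move=> ur; rewrite exchange_big /=; apply: ler_sum => i _; exact: bessel (tphi i) (tphi2 i) ur.
have tail0 : 0 < vol R d * a * (e / 2) by pos.
have [r0 hr0] := summable_tail c0 cB tail0.
pose M := \sum_(k <- r0) dot (freq k : E) (freq k).
have M0 : 0 <= M by apply: sumr_ge0 => k _; exact: dot_ge0.
(* From this stage on the frequencies exceed those in [r0]. *)
pose N := (Num.truncn (4 * M)).+1.
apply: filterS (near_idx N) => t [tT iN].
have v := valid_idx D27 T0 tT; set n := idx t in iN v.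
rewrite sub0r normrN (usolE v) /tev.
pose r := supp (U n t).
have ur : uniq r by exact: undup_uniq.
apply: le_trans (inner_fourier_le a0 tphi ur _) _; first by [].
have h1 : \sum_(k <- r) \sum_i coef2 (coord_fun (ev (U n t)) i) k <= vol R d * S.
  apply: le_trans (bessel_ev _ ur) _; apply: ler_wpM2l; first exact: ltW.
  by have /andP[] := energy_le n t.
have h2 : \sum_(k <- r) cphi k <= vol R d * a * (e / 2).
  apply: hr0 => // k kr; apply/negP => kr0.
  have : dot (freq k : E) (freq k) <= M.
    rewrite /M (big_rem k)//= lerDl; apply: sumr_ge0 => j _; exact: dot_ge0.
  have : X n ^+ 2 / b n ^+ 6 / 4 <= dot (freq k : E) (freq k).
    move: kr; rewrite mem_undup mem_cat => /orP[] /mapP[m /freeze_freq[m0 hm h] ->].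
      by rewrite h; exact: (cas_freq_ge cas hm).
    by rewrite freqN dotNN h; exact: (cas_freq_ge cas hm).
  have := freq_floor_ge n; have := step_ge n; have := truncnS_gt (4 * M).
  have : N%:R <= n%:R :> R by rewrite ler_nat.
  rewrite /N; lra.
apply: (@le_trans _ _ ((vol R d)^-1 * (a * (vol R d * S) + a^-1 * (vol R d * a * (e / 2))))).
  apply: ler_wpM2l; first by rewrite invr_ge0 ltW.
  apply: lerD; first by apply: ler_wpM2l => //; exact: ltW.
  by apply: ler_wpM2l => //; rewrite invr_ge0 ltW.
have -> : (vol R d)^-1 * (a * (vol R d * S) + a^-1 * (vol R d * a * (e / 2))) =
  e / 2 * (S / (S + 1)) + e / 2 by rewrite /a; field; rewrite ?(gt_eqF S1) ?(gt_eqF v0) ?(gt_eqF e0).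
have h : S / (S + 1) <= 1 by rewrite ler_pdivrMr; lra.
have : e / 2 * (S / (S + 1)) <= e / 2 * 1 by apply: ler_wpM2l => //; lra.
lra.
Qed.

(** Nothing moves before the first turnover. *)
Lemma usol_early t : t < T / 2 -> usol t = sl 0.
Proof.
rewrite -(t0E D T) => tt; have [h1 h2] := turn_lt D27 T0 0.
have v : valid 0 t by rewrite /= in_itv/=; exact: lt_trans tt (t_lt D27 T0 0).
by rewrite (usolE v); exact: (cas_old cas).
Qed.

Lemma usol_weak_endpoints : weak_endpoints T usol.
Proof.
have T1 := T0; split; split.
- by rewrite /usol T0; exact: L2_ev.
- move=> phi _; apply: cvg_near_cst; near=> t; rewrite !usol_early//; first lra.
  by near: t; apply: nbhs_right_lt; lra.
- have -> : usol T = ev [::] by rewrite /usol ltxx; apply/funext => x; rewrite /ev big_nil.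
  exact: L2_ev.
- move=> phi Lphi; rewrite {2}/usol ltxx.
  rewrite (_ : inner _ _ = 0); first exact: cvg_weak.
  by rewrite /inner (eq_torus_int (h := fun=> 0)) ?torus_int0// => x; rewrite dot0l.
Unshelve. all: by end_near. Qed.

(** * Limits of the force *)

Definition on_lattice n (k : F) := forall j, exists q : int, k 0 j = (step n)%:Z * q.

Lemma lattice_large n (k : F) : on_lattice n k -> k != 0 -> exists j, b n <= `|(k 0 j)%:~R|.
Proof.
move=> hk k0; have /existsP[j kj] : [exists j, k 0 j != 0].
  apply: contraNT k0 => /existsPn h; apply/eqP/rowP => j; rewrite mxE.
  by apply/eqP; rewrite -[_ == _]negbK h.
exists j; have [q hq] := hk j; rewrite hq intrM normrM.
have q0 : q != 0 by apply: contraNneq kj => q0; rewrite hq q0 mulr0.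
rewrite -[b n]mulr1; apply: ler_pM => //; first by rewrite ger0_norm.
by rewrite -intr_norm ler1z; move: q0; clear; lia.
Qed.

Lemma lattice_freeze n t m : m \in U n t -> on_lattice n (fr m) /\ fr m != 0.
Proof.
move=> /freeze_freq[m0 hm ->]; split=> [j|].
  exact: (cas_lattice cas).
apply/negP => /eqP h; have := cas_freq_ge cas hm.
by rewrite h freq0 dot0l; have := freq_floor_ge n; have := b_gt0 n (R := R); lra.
Qed.

(** Frequencies of the velocity are nonzero and lie on the lattice of the
    stage. In the transport term a frequency can only vanish when a mode meets
    one of the same frequency up to sign, and then incompressibility makes the
    amplitude zero. *)
Lemma force_modes n t m : m \in freeze t (force (st n)) ->
  amp m = 0 \/ exists j, b n <= `|(fr m 0 j)%:~R|.
Proof.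
rewrite /force !freeze_cat freeze_lap freeze_tconv !mem_cat.
have large k : on_lattice n k /\ k != 0 -> exists j, b n <= `|(k 0 j)%:~R|.
  by case; exact: lattice_large.
case/orP => [hm|/orP[/mapP[a aV ->]|]].
- right; apply: large.
  have : fr m \in map (@fr R d) (freeze t (tderiv (st n))) by exact: map_f.
  have -> : map (@fr R d) (freeze t (tderiv (st n))) = map (@fr R d) (U n t).
    by rewrite /freeze /tderiv -!map_comp; apply: eq_map.
  by move=> /mapP[a aV ->]; exact: lattice_freeze aV.
- by right; apply: large; exact: lattice_freeze aV.
move=> /flattenP[s0 /allpairsP[[a c] [/= aV cV ->]]].
have [la _] := lattice_freeze aV; have [lc _] := lattice_freeze cV.
have dc : dot (amp c) (freq (fr c)) = 0 by exact: (div_free_freeze (@cdiv n) cV).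
rewrite !inE => /orP[] /eqP -> /=.
- have [h|h] := eqVneq (fr a + fr c) 0.
    left; have -> : fr a = - fr c by apply/eqP; rewrite -addr_eq0 h.
    by rewrite freqN dotNr dc oppr0 mul0r scale0r.
  right; apply: lattice_large => // j; have [q1 h1] := la j; have [q2 h2] := lc j.
  by exists (q1 + q2); rewrite mxE h1 h2 mulrDr.
- have [h|h] := eqVneq (fr a - fr c) 0.
    left; have -> : fr a = fr c by apply/eqP; rewrite -subr_eq0 h.
    by rewrite dc mul0r scale0r.
  right; apply: lattice_large => // j; have [q1 h1] := la j; have [q2 h2] := lc j.
  by exists (q1 - q2); rewrite !mxE h1 h2 mulrBr.
Qed.

(** The time derivative, the Laplacian and the transport term are all at most
    of the order of the cube of the peak. *)
Lemma l1_force n t : l1 (freeze t (force (st n))) <= 3 * C ^+ 3 * X n ^+ 3.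
Proof.
have X0 := X_gt0 D n (R := R); have b1 := b_ge1 n (R := R); have c1 := C1.
have X1 : 1 <= X n by rewrite /peak exprn_ege1.
have c0 : 0 <= C by lra. have x0 : 0 <= X n by lra.
have lV := cas_l1 cas n t; have l0 := l1_ge0 (U n t).
have fV m : m \in U n t -> enorm (freq (fr m) : E) <= C * X n.
  move=> /freq_enorm h; apply: le_trans h _; apply: ler_wpM2l => //.
  by rewrite ler_pdivrMr ?exprn_gt0 ?b_gt0// ler_peMr// exprn_ege1.
rewrite /force !freeze_cat freeze_lap freeze_tconv !l1_cat.
have h1 : l1 (freeze t (tderiv (st n))) <= C ^+ 3 * X n ^+ 3.
  apply: le_trans (cas_dt_l1 cas n t) _; apply: ler_wpM2r; first exact: exprn_ge0.
  by rewrite exprS ler_peMr// exprn_ege1.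
have h2 : l1 (map (@lap_mode R d) (U n t)) <= C ^+ 3 * X n ^+ 3.
  apply: (@le_trans _ _ ((C * X n) ^+ 2 * l1 (U n t))).
    rewrite /l1 big_map mulr_sumr big_seq [leRHS]big_seq; apply: ler_sum => m mV /=.
    rewrite enormZ ger0_norm ?dot_ge0//; apply: ler_wpM2r; first exact: enorm_ge0.
    by rewrite -enorm_sqr; apply: sqr_le; [exact: enorm_ge0|exact: fV].
  have -> : C ^+ 3 * X n ^+ 3 = (C * X n) ^+ 2 * (C * X n) by ring.
  by apply: ler_wpM2l => //; exact: sqr_ge0.
have h3 : l1 (conv (U n t) (U n t)) <= C ^+ 3 * X n ^+ 3.
  apply: (@le_trans _ _ (C * X n * l1 (U n t) * l1 (U n t))).
    rewrite {1}/l1 /conv big_flatten /= big_allpairs_dep /=.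
    have -> : C * X n * l1 (U n t) * l1 (U n t) =
        \sum_(a <- U n t) \sum_(c <- U n t) C * X n * enorm (amp a) * enorm (amp c).
      rewrite -[LHS]mulrA /l1 big_distrlr mulr_sumr; apply: eq_bigr => a _ /=.
      by rewrite mulr_sumr; apply: eq_bigr => c _; rewrite mulrA.
    rewrite big_seq [leRHS]big_seq; apply: ler_sum => a aV; apply: ler_sum => c _.
    rewrite !big_cons big_nil addr0 /= !enormZ normrM [`|2^-1|]ger0_norm//.
    have -> : `|dot (amp c) (freq (fr a))| * 2^-1 * enorm (amp a) +
       `|dot (amp c) (freq (fr a))| * 2^-1 * enorm (amp a) =
       `|dot (amp c) (freq (fr a))| * enorm (amp a) by field.
    have -> : C * X n * enorm (amp a) * enorm (amp c) =
      (enorm (amp c) * (C * X n)) * enorm (amp a) by ring.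
    apply: ler_wpM2r; first exact: enorm_ge0.
    apply: le_trans (dot_le _ _) _; apply: ler_wpM2l; first exact: enorm_ge0.
    exact: fV.
  have -> : C ^+ 3 * X n ^+ 3 = C * X n * (C * X n) * (C * X n) by ring.
  by apply: ler_pM => //; rewrite ?mulr_ge0//; apply: ler_pM => //; rewrite mulr_ge0.
by apply: le_trans (lerD h1 (lerD h2 h3)) _; lra.
Qed.

(** Near time 0 the force is constant. At time T the amplitudes of the force
    grow like X^3 = b^(3 D), which the rapid decay of the Fourier coefficients
    of the test field more than compensates. *)
Lemma fsol_limits : has_dist_limit fsol (0^'+) /\ has_dist_limit fsol (T^'-).
Proof.
have T1 := T0; split.
  have early t : t < T / 2 -> fsol t = fsol 0.
    move=> tt; apply/funext => x; apply/rowP => i.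
    have P s : s < T / 2 -> fsol s x 0 i = - laplacian (coord_fun (sl 0) i) x +
       \sum_j partial j (fun y => coord_fun (sl 0) i y * coord_fun (sl 0) j y) x.
      move=> sT; have sT' : s < T by lra.
      have v := valid_idx D27 T0 sT'.
      rewrite (fsolE v) -(force_NSE x i (@cdiv (idx s)) (usol_near v)) (usol_early sT).
      have -> : derive1 (fun s0 => coord_fun (usol s0) i x) s = 0.
        apply: (@derive1_locally_cst _ _ _ (sl 0 x 0 i)); near=> s0.
        rewrite usol_early//; near: s0; exact: lt_nbhsl.
      by rewrite sub0r.
    by rewrite !P//; lra.
  exists (inner (fsol 0)); split; first by rewrite /fsol T0; exact: torus_distribution_ev.
  move=> phi _; apply: cvg_near_cst; near=> t; rewrite early//.
  by near: t; apply: nbhs_right_lt; lra.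
exists (fun=> 0); split.
  split=> [a phi psi _ _|]; first by rewrite mulr0 addr0.
  by exists 0, 0 => phi M _ _; rewrite normr0 mul0r.
(* The decay of order 3 D + 1 beats the cube of the peak by one factor b. *)
move=> phi hphi; have [K [K0 hK]] := coef_decay_max (3 * D).+1 hphi.
apply: (@cvg_stage _ _ (3 * C ^+ 3 * (d%:R * K))) => n t v.
have b0 := b_gt0 n (R := R); have X0 := X_gt0 D n (R := R).
rewrite sub0r normrN (fsolE v).
apply: le_trans (inner_high hphi b0 hK (@force_modes n t)) _.
have KY : 0 <= d%:R * (K / b n ^+ (3 * D).+1) by rewrite mulr_ge0// divr_ge0// exprn_ge0// ltW.
apply: le_trans (ler_wpM2r KY (l1_force n t)) _.
have -> : b n ^+ (3 * D).+1 = b n * X n ^+ 3 by rewrite exprS mulnC exprM.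
have -> // : 3 * C ^+ 3 * X n ^+ 3 * (d%:R * (K / (b n * X n ^+ 3))) =
  3 * C ^+ 3 * (d%:R * K) / b n.
by field; pos.
Unshelve. all: by end_near. Qed.

(** * Lebesgue and Besov norms in space-time *)

Variable (eps : R).
Hypotheses (eps0 : 0 < eps < 2) (Deps : 6 <= (D%:R - 3) * eps).

Lemma Deps' : 6 <= D%:R * eps.
Proof. by have /andP[h _] := eps0; have := Deps; lra. Qed.

(** In the n-th stage the L^q norm is at most a multiple of X^(1 - 2 / q) when
    q >= 2, and p (1 - 2 / q) = 2 - eps p; for q <= 2 it is bounded. *)
Lemma usol_LpLq (p q : \bar R) : (1 <= p)%E -> (1 <= q)%E ->
  (2%:E * p^-1 + 2%:E * q^-1 = (1 + eps)%:E)%E ->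
  in_Lp_time T p (fun t => Lq_norm q (usol t)).
Proof.
move=> p1 q1; have /andP[e0 e2] := eps0.
have m : measurable_fun `]0, T[ (fun t => Lq_norm q (usol t)).
  by apply: (measurable_Lq (l := st)) => //; exact: usolE.
have n0 t := usol_ge0 q t.
have De := Deps'.
have C0 : 0 <= C by have := C1; lra.
have D0 : 0 <= D%:R :> R by [].
case: p p1 => [p| |] // p1; case: q q1 m n0 => [q| |] // q1 m n0.
- rewrite !lee_fin in p1 q1.
  have p0 : 0 < p by lra. have q0 : 0 < q by lra.
  rewrite !inver !gt_eqF//= -!EFinM -EFinD => -[pq].
  have [q2|q2] := leP 2 q; last first.
    apply: (@in_Lp_pow p 0 ((vol R d + S) `^ q^-1)) => //.
    + exact: powR_ge0.
    + by rewrite mul0r subr0; have := D27; rewrite -(ler_nat R); lra.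
    + move=> n t nt; rewrite powRr0 mulr1; apply: usol_Lq_low; first by rewrite q1 ltW.
      have : (\bigcup_n slot n) t by exists n.
      by rewrite -(bigcup_slot D27 T0) /= in_itv.
  apply: (@in_Lp_pow p ((q - 2) / q) ((C `^ (q - 2) * S) `^ q^-1)) => //.
  + exact: powR_ge0.
  + have -> : 2 - (q - 2) / q * p = eps * p.
      have -> : (q - 2) / q = 1 - 2 * q^-1 by field; rewrite gt_eqF.
      have -> : 2 * q^-1 = 1 + eps - 2 * p^-1 by lra.
      by field; rewrite gt_eqF.
    by rewrite mulrA; apply: le_trans De _; rewrite ler_peMr// mulr_ge0// ltW.
  + move=> n t nt; have v := slot_valid D27 T0 nt; rewrite (usolE v).
    have := @stage_Lq q n t (fun=> 1) q1.
    rewrite mult_mode1 q2 => /(_ _ _)/le_trans; apply => //; first by move=> _; rewrite ler01 lexx.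
    have X0 := X_gt0 D n (R := R).
    have -> : (C * X n) `^ (q - 2) = C `^ (q - 2) * X n `^ (q - 2) by rewrite powRM// ltW.
    have CS : 0 <= C `^ (q - 2) * S by rewrite mulr_ge0 ?powR_ge0.
    by rewrite lee_fin mulrAC (powRM _ CS) ?powR_ge0// -[X in _ * X <= _]powRrM.
- rewrite lee_fin in p1; have p0 : 0 < p by lra.
  rewrite inver gt_eqF//= invey mule0 adde0 -EFinM => -[pq].
  apply: (@in_Lp_pow p 1 C) => //.
  + have h2 : 2 = (1 + eps) * p by rewrite -pq divfK// gt_eqF.
    have -> : 2 - 1 * p = eps * p by lra.
    by rewrite mulrA; apply: le_trans De _; rewrite ler_peMr// mulr_ge0// ltW.
  + move=> n t nt; have v := slot_valid D27 T0 nt; rewrite (usolE v).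
    rewrite -[C * _]mul1r powRr1 ?(ltW (X_gt0 _ _))//.
    apply: Lq_norm_bounded => //; first exact: tev_fmeas.
    by move=> x; apply: le_trans (enorm_ev _ _) _; exact: (cas_l1 cas).
- rewrite !lee_fin in q1; have q0 : 0 < q by lra.
  rewrite inver gt_eqF//= invey mule0 add0e -EFinM => -[pq].
  apply: (@in_Lp_oo ((vol R d + S) `^ q^-1)) => // t ht.
  apply: usol_Lq_low => //; rewrite q1 /=.
  have : 2 = (1 + eps) * q by rewrite -pq; field; rewrite gt_eqF.
  nra.
- rewrite !invey !mule0 adde0 => -[]; lra.
Qed.

Lemma LP_symbol01 (chi : E -> R) q : LP_cutoff chi -> forall x, 0 <= LP_symbol chi q x <= 1.
Proof.
move=> hchi x; have h01 := chi01 hchi; rewrite /LP_symbol; case: ifP => _; last exact: h01.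
set eta := _ *: x; have /andP[a0 a1] := h01 (2^-1 *: eta); have /andP[c0 c1] := h01 eta.
have : chi eta <= chi (2^-1 *: eta).
  have [_ mono _ _] := hchi; apply: mono.
  by rewrite enormZ ger0_norm ?invr_ge0// ler_piMl ?enorm_ge0//; lra.
move=> h; apply/andP; split; lra.
Qed.

(** Both cutoffs are 1 at such a low frequency. *)
Lemma LP_symbol_low (chi : E -> R) (q : nat) x : LP_cutoff chi ->
  2 * enorm x <= 2 ^+ q -> LP_symbol chi q x = 0.
Proof.
move=> hchi hx; have [_ _ one _] := hchi; rewrite /LP_symbol /=.
have q0 : 0 < 2 ^+ q :> R by rewrite exprn_gt0.
rewrite -exprnN.
have h : enorm (2 ^- q *: x) <= 2^-1.
  rewrite enormZ ger0_norm ?invr_ge0 ?(ltW q0)// mulrC ler_pdivrMr//; lra.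
rewrite !one ?subrr//.
rewrite enormZ ger0_norm ?invr_ge0//; apply: le_trans h.
by rewrite ler_piMl ?enorm_ge0//; lra.
Qed.

Definition lp_stage chi q n : @tfield R d := tmap (mult_mode (LP_symbol chi q)) (st n).

Lemma freeze_mult s l t :
  freeze t (tmap (mult_mode s) l) = map (mult_mode s) (freeze t l : seq mode).
Proof.
rewrite /freeze /tmap -!map_comp; apply: eq_map => z.
by rewrite /mult_mode /scale_mode /= !scalerA mulrC.
Qed.

Lemma LP_block_usol chi q n t : LP_cutoff chi -> valid n t ->
  LP_block chi q (usol t) = tev (lp_stage chi q n) t.
Proof.
move=> hchi v; rewrite /LP_block (usolE v) /tev multiplier_ev; last exact: LP_symbolN.
by rewrite freeze_mult.
Qed.

Lemma freq_scaleE n : X n / b n ^+ 3 = X n `^ (1 - 3 / D%:R).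
Proof.
have X0 := X_gt0 D n (R := R); have b0 := b_gt0 n (R := R).
have D0 : (D%:R : R) != 0 by rewrite pnatr_eq0; have := D27; lia.
rewrite powRD; last by rewrite (gt_eqF X0) implybT.
rewrite powRr1 ?(ltW X0)// powRN /peak -[X in X `^ _]powR_mulrn ?(ltW b0)// -powRrM.
by rewrite mulrCA mulfV// mulr1 -[3]/(3%:R) powR_mulrn// ltW.
Qed.

Lemma freq_scale_ge1 n : 1 <= X n / b n ^+ 3.
Proof.
have b0 := b_gt0 n (R := R); rewrite ler_pdivlMr ?exprn_gt0// mul1r /peak.
by apply: ler_weXn2l; [exact: b_ge1|have := D27; lia].
Qed.

(** Blocks above the frequencies of the stage vanish. For the others the
    factor 2^(q s) is at most a power of X / b^3 if s >= 0 and bounded if s <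
    0, and the L^3 norm is at most a multiple of X^(1 / 3). *)
Lemma usol_besov (chi : E -> R) : LP_cutoff chi ->
  in_Lp_time T 3%:E (fun t => besov_norm chi (3^-1 - eps) (usol t)).
Proof.
move=> hchi; set s := 3^-1 - eps; have /andP[e0 e2] := eps0.
have c1 := C1; have S00 := S0.
pose a : R := 3^-1 + Num.max s 0 * (1 - 3 / D%:R).
pose K : R := Num.max ((2 * C) `^ s) (2 `^ (- s)) * (C * S) `^ 3^-1.
have three : (3 : R)%:E = 3%:E :> \bar R by [].
have q31 : (1 <= 3%:E :> \bar R)%E by rewrite lee_fin; lra.
have D0 : 0 < (D%:R : R) by rewrite ltr0n; have := D27; lia.
have D27' : 27 <= (D%:R : R) by rewrite ler_nat.
apply: (@in_Lp_pow 3 a K) => //.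
- by rewrite /K mulr_ge0 ?powR_ge0// le_max powR_ge0.
- have De := Deps.
  have -> : D%:R * (2 - a * 3) = D%:R - 3 * Num.max s 0 * (D%:R - 3).
    by rewrite /a; field; rewrite gt_eqF.
  by rewrite maxEle; case: ifP => _; rewrite /s; lra.
- have -> : (fun t => besov_norm chi s (usol t)) = (fun t =>
     esups (fun m : nat => ((2 `^ ((m%:Z - 1)%:~R * s))%:E *
        Lq_norm 3%:E (LP_block chi (m%:Z - 1) (usol t)))%E) 0).
    apply/funext => t; rewrite /besov_norm /esups /sdrop /=; congr ereal_sup.
    apply/seteqP; split=> _ [q /= hq <-]; last first.
      by exists (q%:Z - 1) => //=; lia.
    have eq1 : (absz (q + 1))%:Z - 1 = q by lia.
    by exists (absz (q + 1)) => //=; rewrite eq1.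
  apply: measurable_fun_esups => m.
  apply: emeasurable_funM; first exact: measurable_cst.
  apply: (@measurable_Lq 3%:E _ (lp_stage chi (m%:Z - 1))) => // n t.
  exact: LP_block_usol.
- move=> t; apply: (@le_trans _ _ ((2 `^ ((0 : int)%:~R * s))%:E * Lq_norm 3%:E (LP_block chi 0 (usol t)))%E).
    by rewrite mule_ge0// ?Lq_norm_ge0// lee_fin powR_ge0.
  by apply: ereal_sup_ubound; exists 0.
move=> n t nt; have v := slot_valid D27 T0 nt.
have X0 := X_gt0 D n (R := R); have b0 := b_gt0 n (R := R).
apply: ge_ereal_sup => _ [q /= hq <-].
have KXa0 : 0 <= K * X n `^ a.
  by rewrite /K !mulr_ge0 ?powR_ge0// le_max powR_ge0.
rewrite (LP_block_usol q hchi v) /tev freeze_mult.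
have X3 := freq_scale_ge1 n.
(* Either the frequencies are so low that the block vanishes, or 2^q is at
   most a multiple of them. *)
have [zero|nz] := pselect (exists2 q' : nat, q = q' & 2 * (C * (X n / b n ^+ 3)) <= 2 ^+ q').
  case: zero => q' -> hq'.
  have -> : ev (map (mult_mode (LP_symbol chi q')) (U n t)) = fun=> 0.
    apply/funext => x; rewrite ev_mult big_seq big1// => m mU.
    rewrite LP_symbol_low ?scale0r//; apply: le_trans hq'.
    by rewrite ler_pM2l//; exact: freq_enorm mU.
  apply: (@le_trans _ _ 0%E); last by rewrite lee_fin.
  rewrite -[leRHS](mule0 (2 `^ (q'%:~R * s))%:E) lee_wpmul2l ?lee_fin ?powR_ge0//.
  have -> : 0%E = (@Kq R d 3%:E * 0)%:E by rewrite mulr0.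
  apply: Lq_norm_bounded => //.
    by apply: fmeas_cont; exact: cst_continuous.
  by move=> x; rewrite enorm0.
have q2 : 2 `^ q%:~R <= 2 * C * (X n / b n ^+ 3).
  case: q hq nz => [q|q] hq nz.
    rewrite -[q%:~R]/(q%:R) powR_mulrn// -mulrA; apply/ltW; rewrite ltNge.
    by apply/negP => h; apply: nz; exists q.
  have -> : Negz q = -1 by move: hq; clear; lia.
  rewrite powR_inv1//; apply: (@le_trans _ _ (2 * 1 * 1)); first lra.
  by apply: ler_pM => //; lra.
have qs : 2 `^ (q%:~R * s) <= Num.max ((2 * C) `^ s) (2 `^ (- s)) * X n `^ (Num.max s 0 * (1 - 3 / D%:R)).
  have [s0|s0] := leP 0 s.
    rewrite powRrM (le_trans (ge0_ler_powR s0 _ _ q2)) ?nnegrE ?powR_ge0//.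
      by pos.
    rewrite powRM; [|lra|by pos].
    rewrite freq_scaleE -powRrM [s * _]mulrC; apply: ler_wpM2r; first exact: powR_ge0.
    by rewrite le_max lexx.
  rewrite mul0r powRr0 mulr1 le_max; apply/orP; right.
  apply: ler_powR; first lra.
  have : (-1 : R) <= q%:~R by rewrite -[-1]/((-1)%:~R) ler_int.
  nra.
have L3 : (Lq_norm 3%:E (ev (map (mult_mode (LP_symbol chi q)) (U n t))) <=
    ((C * S) `^ 3^-1 * X n `^ 3^-1)%:E)%E.
  have := @stage_Lq 3 n t (LP_symbol chi q) _ (LP_symbol01 q hchi) (LP_symbolN q hchi).
  rewrite (_ : (2 <= 3 :> R) = true); last by apply/idP; lra.
  have -> : 3 - 2 = 1 :> R by ring.
  rewrite powRr1 ?mulr_ge0 ?(ltW X0)//; last lra.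
  move=> h; apply: le_trans (h _) _; first lra.
  have CS0 : 0 <= C * S by apply: mulr_ge0 => //; lra.
  by rewrite lee_fin mulrAC (powRM _ CS0) ?(ltW X0).
apply: le_trans (lee_wpmul2l _ L3) _; first by rewrite lee_fin powR_ge0.
have -> : X n `^ a = X n `^ 3^-1 * X n `^ (Num.max s 0 * (1 - 3 / D%:R)).
  by rewrite /a powRD// (gt_eqF X0) implybT.
rewrite -EFinM lee_fin /K.
have -> : Num.max ((2 * C) `^ s) (2 `^ (- s)) * (C * S) `^ 3^-1 *
   (X n `^ 3^-1 * X n `^ (Num.max s 0 * (1 - 3 / D%:R))) =
   Num.max ((2 * C) `^ s) (2 `^ (- s)) * X n `^ (Num.max s 0 * (1 - 3 / D%:R)) *
   ((C * S) `^ 3^-1 * X n `^ 3^-1) by ring.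
by apply: ler_wpM2r => //; rewrite mulr_ge0 ?powR_ge0.
Qed.

(** * The negative Sobolev norm of the force *)

Lemma supp_force n t : {subset supp (freeze t (force (st n))) <=
  supp [seq z.2 | z : amplitude * mode <- force (st n)]}.
Proof.
rewrite /supp /freeze.
have -> : map (@fr R d) [seq scale_mode (aval z.1 t) z.2 | z <- force (st n)] =
    map (@fr R d) [seq z.2 | z : amplitude * mode <- force (st n)].
  by rewrite -!map_comp; apply: eq_map.
have -> : [seq - fr m | m <- [seq scale_mode (aval z.1 t) z.2 | z <- force (st n)]] =
    [seq - fr m | m <- [seq z.2 | z : amplitude * mode <- force (st n)]].
  by rewrite -!map_comp; apply: eq_map.
by [].
Qed.

(** Each of the three parts of the force is O(X) in H^-1: the time derivative
    is O(X^2 / b^5) and the Laplacian O(X^2 / b^6) in L^2, and both live at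
    frequencies of order X / b^3; the transport term is the divergence of u
    (x) u, which is O(X) in L^2. *)
Lemma usol_Hm1 : in_Lp_time T (2 - eps)%:E (fun t => Hm1_norm (fsol t)).
Proof.
have /andP[e0 e2] := eps0; have c1 := C1; have v0 := vol_gt0 R d; have S00 := S0.
pose r n := supp [seq z.2 | z : amplitude * mode <- force (st n)].
have ur n : uniq (r n) by exact: undup_uniq.
have HE n t : valid n t -> Hm1_norm (fsol t) = ((hm1_sum (freeze t (force (st n))) (r n))%:E `^ 2^-1)%E.
  by move=> v; rewrite (fsolE v); apply: Hm1_ev => //; exact: supp_force.
pose K2 : R := (vol R d)^-1 ^+ 2 * (3 * (4 * vol R d * C + 4 * vol R d * C ^+ 2 * S + vol R d * (C ^+ 2 * S))).
have K20 : 0 <= K2 by rewrite /K2; pos.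
have De := Deps'.
apply: (@in_Lp_pow (2 - eps) 1 (K2 `^ 2^-1)); [lra|exact: powR_ge0| | | |].
- have -> : 2 - 1 * (2 - eps) = eps by ring.
  exact: De.
- apply: (measurable_valid_pieces D27 T0) => n.
  exists (fun t => (hm1_sum (freeze t (force (st n))) (r n)) `^ 2^-1); last first.
    by move=> t /HE ->; rewrite poweR_EFin.
  have cc i k p : continuous (fun t => coef (coord_fun (ev (freeze t (force (st n)))) i) k p).
    have -> : (fun t => coef (coord_fun (ev (freeze t (force (st n)))) i) k p) =
       (fun t => \sum_(z <- force (st n)) aval z.1 t * (amp z.2 0 i * mean2 z.2 (Mode k p 0))).
      apply/funext => t; rewrite coef_ev /freeze big_map; apply: eq_bigr => z _.
      by rewrite /= mxE /mean2 /=; ring.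
    apply: continuous_bigsum => z t; apply: (@cvgM R R (nbhs t)); last exact: cvg_cst.
    exact/smooth1_continuous/aP.
  have ch : continuous (fun t => hm1_sum (freeze t (force (st n))) (r n)).
    apply: continuous_bigsum => k t; apply: (@cvgM R R (nbhs t)); first exact: cvg_cst.
    apply: continuous_bigsum => i {}t.
    have -> : (fun t => sq_abs (fourier_coef (coord_fun (ev (freeze t (force (st n)))) i) k)) =
      (fun t => (vol R d)^-1 ^+ 2 * (coef (coord_fun (ev (freeze t (force (st n)))) i) k 0 *
        coef (coord_fun (ev (freeze t (force (st n)))) i) k 0
       + coef (coord_fun (ev (freeze t (force (st n)))) i) k (- (pi / 2)) *
        coef (coord_fun (ev (freeze t (force (st n)))) i) k (- (pi / 2)))).
      by apply/funext => s; rewrite sq_abs_fourier /coef2 !expr2.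
    apply: (@cvgM R R (nbhs t)); first exact: cvg_cst.
    by apply: (@cvgD R R R (nbhs t)); apply: (@cvgM R R (nbhs t)); exact: cc.
  move=> t; have -> : (fun t => hm1_sum (freeze t (force (st n))) (r n) `^ 2^-1) =
    (fun t => Num.sqrt (hm1_sum (freeze t (force (st n))) (r n))).
    apply/funext => s; rewrite powR12_sqrt//; apply: sumr_ge0 => k _.
    have /andP[w0 _] := @weight_ge0 R d k; apply: mulr_ge0 => //.
    by apply: sumr_ge0 => i _; rewrite sq_abs_fourier mulr_ge0 ?sqr_ge0// coef2_ge0.
  apply: (@continuous_comp R R R (fun t => hm1_sum (freeze t (force (st n))) (r n)) Num.sqrt).
    exact: ch.
  exact: sqrt_continuous.
- by move=> t; exact: poweR_ge0.
move=> n t nt; have v := slot_valid D27 T0 nt; rewrite (HE n t v) poweR_EFin lee_fin.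
have X0 := X_gt0 D n (R := R); have b0 := b_gt0 n (R := R).
rewrite powRr1 ?(ltW X0)//.
have -> : K2 `^ 2^-1 * X n = (K2 * X n ^+ 2) `^ 2^-1.
  by rewrite powRM ?sqr_ge0// -(powR_mulrn _ (ltW X0)) -powRrM mulfV// powRr1// ltW.
have hm0 : 0 <= hm1_sum (freeze t (force (st n))) (r n).
  apply: sumr_ge0 => k _; have /andP[w0 _] := @weight_ge0 R d k; apply: mulr_ge0 => //.
  by apply: sumr_ge0 => i _; rewrite sq_abs_fourier mulr_ge0 ?sqr_ge0// coef2_ge0.
apply: ge0_ler_powR; rewrite ?nnegrE ?invr_ge0//; first by pos.
pose V := U n t; pose DV := freeze t (tderiv (st n)); pose LV := map (@lap_mode R d) V.
(* [Y] bounds the squares of the active frequencies from below; from above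
   they are at most [4 * C * Y]. *)
pose Y := X n ^+ 2 / b n ^+ 6 / 4.
have Y0 : 0 < Y by rewrite /Y; pos.
have dV : div_free V by exact/div_free_freeze/cdiv.
have EV : pairing V V <= S by have /andP[] := energy_le n t.
have EV0 : 0 <= pairing V V by have /andP[] := energy_le n t.
have b1 := b_ge1 n (R := R).
have bW W' : \sum_(k <- r n) weight k * \sum_i coef2 (coord_fun (ev W') i) k =
   \sum_(k <- r n) \sum_i weight k * coef2 (coord_fun (ev W') i) k.
  by apply: eq_bigr => k _; rewrite mulr_sumr.
have s1 : \sum_(k <- r n) weight k * \sum_i coef2 (coord_fun (ev DV) i) k <= 4 * vol R d * C * X n ^+ 2.
  apply: le_trans (weighted_bessel (ur n) Y0 _) _.
    move=> m mD; have [m0 hm ->] : exists2 m0, m0 \in [seq z.2 | z : amplitude * mode <- st n] & fr m = fr m0.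
      have : fr m \in map (@fr R d) DV by exact: map_f.
      rewrite /DV /freeze /tderiv -!map_comp (eq_map (g := @fr R d \o snd))// map_comp.
      by move=> /mapP[m0 ? ->]; exists m0.
    exact: (cas_freq_ge cas hm).
  have -> : 4 * vol R d * C * X n ^+ 2 = Y^-1 * (vol R d * (C * (X n ^+ 4 / b n ^+ 10 * b n ^+ 4))).
    by rewrite /Y; field; pos.
  apply: ler_wpM2l; first by rewrite invr_ge0 ltW.
  apply: ler_wpM2l; first exact: ltW.
  apply: le_trans (cas_dt_energy cas n t) _; apply: ler_wpM2l; first lra.
  by rewrite ler_peMr ?exprn_ege1//; pos.
have hs4 m : m \in [seq z.2 | z : amplitude * mode <- st n] ->
   0 <= dot (freq (fr m) : E) (freq (fr m)) * dot (freq (fr m) : E) (freq (fr m)) <= (4 * C * Y) ^+ 2.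
  move=> hm; have h := cas_freq_le cas hm; have h0 := dot_ge0 (freq (fr m) : E).
  rewrite mulr_ge0//= expr2; have -> : 4 * C * Y = C * (X n ^+ 2 / b n ^+ 6) by rewrite /Y; field; pos.
  by apply: ler_pM.
have s2 : \sum_(k <- r n) weight k * \sum_i coef2 (coord_fun (ev LV) i) k <= 4 * vol R d * C ^+ 2 * S * X n ^+ 2.
  apply: le_trans (weighted_bessel (ur n) Y0 _) _.
    move=> m /mapP[m' /freeze_freq[m0 hm h] ->]; rewrite /= h.
    exact: (cas_freq_ge cas hm).
  have -> : 4 * vol R d * C ^+ 2 * S * X n ^+ 2 = Y^-1 * (vol R d * ((4 * C * Y) ^+ 2 * S * b n ^+ 6)).
    by rewrite /Y; field; pos.
  apply: ler_wpM2l; first by rewrite invr_ge0 ltW.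
  apply: ler_wpM2l; first exact: ltW.
  have -> : pairing LV LV = pairing (map (mult_mode (fun x => dot x x * dot x x)) V) V.
    by rewrite -pairing_lap.
  have /andP[_ h] := @cas_symbol _ _ _ _ _ _ _ cas n t (fun x => dot x x * dot x x) _ hs4.
  apply: le_trans h _; apply: (@le_trans _ _ ((4 * C * Y) ^+ 2 * S)).
    by apply: ler_wpM2l => //; exact: sqr_ge0.
  by rewrite ler_peMr ?exprn_ege1// mulr_ge0 ?sqr_ge0.
have s3 : \sum_(k <- r n) weight k * \sum_i coef2 (coord_fun (ev (conv V V)) i) k <= vol R d * (C ^+ 2 * S) * X n ^+ 2.
  apply: le_trans (conv_bessel dV (ur n)) _.
  have -> : vol R d * (C ^+ 2 * S) * X n ^+ 2 = vol R d * ((C * X n) ^+ 2 * S) by ring.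
  apply: ler_wpM2l; first exact: ltW.
  apply: ler_pM => //; first exact: sqr_ge0.
  by apply: sqr_le; [exact: l1_ge0|exact: (cas_l1 cas)].
rewrite /hm1_sum.
under eq_bigr => k _. rewrite (eq_bigr (fun i => (vol R d)^-1 ^+ 2 * coef2 (coord_fun (ev (freeze t (force (st n)))) i) k)); last by move=> i _; rewrite sq_abs_fourier.
  rewrite -mulr_sumr mulrCA. over.
rewrite -mulr_sumr /K2 -[leRHS]mulrA; apply: ler_wpM2l; first exact: sqr_ge0.
have -> : 3 * (4 * vol R d * C + 4 * vol R d * C ^+ 2 * S + vol R d * (C ^+ 2 * S)) * X n ^+ 2 =
  3 * (4 * vol R d * C * X n ^+ 2 + 4 * vol R d * C ^+ 2 * S * X n ^+ 2 + vol R d * (C ^+ 2 * S) * X n ^+ 2) by ring.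
apply: le_trans (ler_wpM2l _ (lerD (lerD s1 s2) s3)); last lra.
rewrite !bW -!big_split mulr_sumr; apply: ler_sum => k _ /=.
rewrite -!big_split mulr_sumr; apply: ler_sum => i _ /=.
have /andP[w0 _] := @weight_ge0 R d k.
have cadd p : coef (coord_fun (ev (freeze t (force (st n)))) i) k p =
   coef (coord_fun (ev DV) i) k p + coef (coord_fun (ev LV) i) k p + coef (coord_fun (ev (conv V V)) i) k p.
  by rewrite !coef_ev /force !freeze_cat !big_cat freeze_lap freeze_tconv /= addrA.
rewrite -!mulrDr mulrCA; apply: ler_wpM2l => //; rewrite /coef2 !cadd.
have sq3 (x y z : R) : (x + y + z) ^+ 2 <= 3 * (x ^+ 2 + y ^+ 2 + z ^+ 2).
  by have := sqr_ge0 (x - y); have := sqr_ge0 (x - z); have := sqr_ge0 (y - z); lra.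
set x1 := coef _ _ _; set x2 := coef _ _ _; set x3 := coef _ _ _.
set y1 := coef _ _ _; set y2 := coef _ _ _; set y3 := coef _ _ _.
have := sq3 x1 x2 x3; have := sq3 y1 y2 y3; lra.
Qed.

End solution.

Theorem theorem1p4 (R : realType) (d : nat) (hd : (3 <= d)%N) (T eps : R)
    (hT : 0 < T) (heps : 0 < eps < 2)
    (chi : 'rV[R]_d -> R) (hchi : LP_cutoff chi) :
  exists u f : R -> 'rV[R]_d -> 'rV[R]_d,
    (classN T u f /\ weak_endpoints T u) /\
    energy_equality T u f /\
    anomalous_work_vanishes chi T u f /\
    (exists l : R, (fun t => sqnorm2 (u t)) @ T^'- --> l /\
       sqnorm2 (u T) < l) /\
    in_Lp_time T 3%:E (fun t => besov_norm chi (3^-1 - eps) (u t)) /\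
    (forall p q : \bar R, (1 <= p)%E -> (1 <= q)%E ->
       (2%:E * p^-1 + 2%:E * q^-1 = (1 + eps)%:E)%E ->
       in_Lp_time T p (fun t => Lq_norm q (u t))) /\
    in_Lp_time T (2 - eps)%:E (fun t => Hm1_norm (f t)).
Proof.
have /andP[e0 e2] := heps.
(* The exponent D = 3 d e has to make the losses of powers of b negligible
   compared with X^eps. *)
pose e := (3 + (Num.truncn eps^-1).+1)%N.
have e3 : (3 <= e)%N by rewrite leq_addr.
have [C [st [sl [C1 cas]]]] := cascade_exists hd e3 hT.
have D27 : (27 <= 3 * d * e)%N by rewrite (leq_mul (leq_mul (leqnn 3) hd) e3).
have Deps : 6 <= ((3 * d * e)%:R - 3) * eps.
  have ee : 1 <= e%:R * eps.
    rewrite -ler_pdivrMr// mul1r; apply: le_trans (ltW (truncnS_gt _)) _.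
    by rewrite ler_nat leq_addl.
  have De : 9 * e%:R <= (3 * d * e)%:R :> R.
    by rewrite -natrM ler_nat leq_mul2r (leq_mul (leqnn 3) hd) orbT.
  have e3' : 3 <= e%:R :> R by rewrite ler_nat.
  have : 8 * e%:R * eps <= ((3 * d * e)%:R - 3) * eps by rewrite ler_pM2r//; lra.
  lra.
have [f0 fT] := fsol_limits D27 hT C1 cas.
exists (usol (3 * d * e) T st), (fsol (3 * d * e) T st); split.
  split; last exact: (usol_weak_endpoints D27 hT C1 cas).
  split.
  - by split; [exact: (smooth_usol D27 hT cas)|exact: (usol_L2 D27 hT C1 cas)].
  - exact: (smooth_fsol D27 hT cas).
  - exists (fun _ _ => 0); split; first exact: smooth_pressure.
    exact: (usol_NSE D27 hT cas).
  - exact: (classL_work D27 hT C1 cas).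
  - by split.
split; first exact: (usol_energy_equality D27 hT cas).
split; first exact: (usol_anomalous D27 hT C1 cas hchi).
split; first exact: (usol_jump D27 hT cas).
split; first exact: (usol_besov D27 hT C1 cas heps Deps hchi).
split; last exact: (usol_Hm1 D27 hT C1 cas heps Deps).
by move=> p q p1 q1 pq; exact: (usol_LpLq D27 hT C1 cas heps Deps p1 q1 pq).
Qed.
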